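(* Let $n\ge1$. (1) For every $1<q<\infty$ there exists a constant $C_{q,n}>0$ such that for all $c\in[2,\infty)$ and all $f\in L^q(\mathbb{R}^n)$, $$\left\|\left(\frac{1}{P_\infty(D)}-\frac{1}{P_c(D)}\right)f\right\|_{L^q}\le\frac{C_{q,n}}{c^2}\|f\|_{L^q}.$$ (2) For every $1<q<\infty$ there exists a constant $C_{q,n}>0$ such that for all $c\in[2,\infty)$ and all tempered distributions $f$ on $\mathbb{R}^n$ with $P_\infty(D)^{-1/2}f\in L^q(\mathbb{R}^n)$, $$\left\|\left(\frac{1}{P_\infty(D)}-\frac{1}{P_c(D)}\right)f\right\|_{L^q}\le\frac{C_{q,n}}{c}\left\|\frac{1}{P_\infty(D)^{1/2}}f\right\|_{L^q}.$$
   Context: For a symbol $\mathfrak{m}$ on $\mathbb{R}^n$, $\mathfrak{m}(D)$ is the Fourier multiplier operator $\widehat{\mathfrak{m}(D)f}(\xi)=\mathfrak{m}(\xi)\hat f(\xi)$. Here $P_c(\xi)=\left(\sqrt{c^2|\xi|^2+\frac{c^4}{4}}-\frac{c^2}{2}\right)+1$ and $P_\infty(\xi)=|\xi|^2+1$; $\frac1{P_c(D)}$, $\frac{1}{P_\infty(D)}$ and $\frac{1}{P_\infty(D)^{1/2}}$ are the multipliers with symbols $P_c(\xi)^{-1}$, $P_\infty(\xi)^{-1}$ and $P_\infty(\xi)^{-1/2}$. *)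

(* Defs.v *)
From HB Require Import structures.
From mathcomp Require Import all_boot all_order all_algebra.
From mathcomp Require Import all_classical all_reals all_analysis.
From mathcomp Require Import complex.

Set Implicit Arguments.
Unset Strict Implicit.
Unset Printing Implicit Defensive.
Import Order.TTheory GRing.Theory Num.Theory.
Import numFieldNormedType.Exports.
Local Open Scope classical_set_scope.
Local Open Scope ring_scope.

(* The sigma-algebra on R^n generated by the coordinates, that is, the Borel  *)
(* sigma-algebra; same construction as for n.-tuple R in the library.         *)
Section measurable_rV.
Context {R : realType} (n : nat).

Let coors : 'I_n -> 'rV[R]_n -> R := fun i x => x ord0 i.

Let rV_set0 : g_sigma_preimage coors set0.
Proof. exact: sigma_algebra0. Qed.

Let rV_setC A : g_sigma_preimage coors A -> g_sigma_preimage coors (~` A).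
Proof. exact: sigma_algebraC. Qed.

Let rV_bigcup (F : _^nat) : (forall i, g_sigma_preimage coors (F i)) ->
  g_sigma_preimage coors (\bigcup_i (F i)).
Proof. exact: sigma_algebra_bigcup. Qed.

HB.instance Definition _ := @isMeasurable.Build default_measure_display
  'rV[R]_n (g_sigma_preimage coors) rV_set0 rV_setC rV_bigcup.

End measurable_rV.

Section measurable_rV_lemmas.
Context {R : realType}.

Lemma measurable_fun_rVP d (T : measurableType d) n (f : T -> 'rV[R]_n) :
  measurable_fun [set: T] f <->
  forall i, measurable_fun [set: T] (fun x => f x ord0 i).
Proof.
pose c := fun (i : 'I_n) (x : 'rV[R]_n) => x ord0 i.
apply: (@iff_trans _ (g_sigma_preimage (fun i => c i \o f) `<=` measurable)).
  rewrite g_sigma_preimage_comp; split=> [mf A [/= C preC <-]|prefS].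
    exact: mf.
  by move=> _ A mA; apply: prefS; exists A.
split=> [cfS i|mf].
- move=> _ A mA.
  apply: cfS; apply: sub_sigma_algebra.
  case: n i => [[] []//|n i] in f c *.
  rewrite -bigcup_mkord_ord.
  exists i; first exact: ltn_ord.
  by exists A => //; rewrite inord_val.
- apply: smallest_sub; first exact: sigma_algebra_measurable.
  case: n => [|n] in f c mf *; first by rewrite big_ord0.
  rewrite -bigcup_mkord_ord; apply: bigcup_sub => i Ii.
  by move=> A [B mB <-]; exact: mf.
Qed.

Lemma measurable_coord n (i : 'I_n) :
  measurable_fun [set: 'rV[R]_n] (fun x : 'rV[R]_n => x ord0 i).
Proof. by move: i; apply/measurable_fun_rVP; exact: measurable_id. Qed.

Definition consv n (p : R * 'rV[R]_n) : 'rV[R]_n.+1 := row_mx p.1%:M p.2.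

Definition unconsv n (x : 'rV[R]_n.+1) : R * 'rV[R]_n :=
  (x ord0 ord0, \row_i x ord0 (lift ord0 i)).

Lemma consv0 n p : @consv n p ord0 ord0 = p.1.
Proof.
rewrite /consv mxE; case: splitP => [j|//] _.
by rewrite (ord1 j) !mxE eqxx.
Qed.

Lemma consvS n p i : @consv n p ord0 (lift ord0 i) = p.2 ord0 i.
Proof.
rewrite /consv mxE; case: splitP => [j|j /= [ij]].
  by rewrite (ord1 j) lift0.
by congr (p.2 _ _); exact/val_inj.
Qed.

Lemma consvK n : cancel (@consv n) (@unconsv n).
Proof.
move=> [a v]; rewrite /unconsv consv0; congr pair.
by apply/rowP => i; rewrite mxE consvS.
Qed.

Lemma measurable_consv n : measurable_fun setT (@consv n).
Proof.
apply/measurable_fun_rVP => i; have [j ->|->] := unliftP ord0 i.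
  under eq_fun do rewrite consvS.
  exact: measurableT_comp (measurable_coord j) measurable_snd.
under eq_fun do rewrite consv0.
exact: measurable_fst.
Qed.

Lemma measurable_unconsv n : measurable_fun setT (@unconsv n).
Proof.
apply: measurable_fun_pair => /=; first exact: measurable_coord.
apply/measurable_fun_rVP => i; under eq_fun do rewrite mxE.
exact: measurable_coord.
Qed.

End measurable_rV_lemmas.

(* The n-dimensional Lebesgue measure, by recursion on n: a unit mass at the  *)
(* point of R^0, and the image of the product measure under R * R^n ~ R^n.+1. *)
Section lebesgue_step.
Context {R : realType} (n : nat).
Variable mu : {sigma_finite_measure set 'rV[R]_n -> \bar R}.

Definition lebesgue_step : set 'rV[R]_n.+1 -> \bar R :=
  pushforward (@lebesgue_measure R \x mu)%E (@consv R n).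

Let prod : {measure set (measurableTypeR R * 'rV[R]_n)%type -> \bar R} :=
  (@lebesgue_measure R \x mu)%E.

Let nu : {measure set 'rV[R]_n.+1 -> \bar R} :=
  measure_function_pushforward__canonical__measure_function_Measure
    prod (@measurable_consv R n).

HB.instance Definition _ := isMeasure.Build _ _ _ lebesgue_step
  (measure0 nu) (measure_ge0 nu) (@measure_semi_sigma_additive _ _ _ nu).

Let lebesgue_step_sigma_finite : sigma_finite setT lebesgue_step.
Proof.
have /sigma_finiteP[F [FT ndF Foo]] := sigma_finiteT (@lebesgue_measure R).
have /sigma_finiteP[G [GT ndG Goo]] := sigma_finiteT mu.
exists (fun k => @unconsv R n @^-1` (F k `*` G k)).
  rewrite -preimage_bigcup (_ : \bigcup_k _ = setT) ?preimage_setT//.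
  rewrite -setXTT FT GT predeqE => -[x y]; split.
    by move=> [k _ [? ?]]; split; exists k.
  move=> [/= [k _ Fkx] [l _ Gly]]; exists (maxn k l) => //; split.
  - by move: x Fkx; exact/subsetPset/ndF/leq_maxl.
  - by move: y Gly; exact/subsetPset/ndG/leq_maxr.
move=> k; have [mF Fk] := Foo k; have [mG Gk] := Goo k; split.
  rewrite -[X in measurable X]setTI; apply: measurable_unconsv => //.
  exact: measurableX.
rewrite /lebesgue_step /pushforward -comp_preimage.
rewrite (_ : _ \o _ = id) ?preimage_id; last first.
  by apply/funext => p; exact: consvK.
by rewrite product_measure1E// lte_mul_pinfty// ge0_fin_numE.
Qed.

HB.instance Definition _ := Measure_isSigmaFinite.Build _ _ _ lebesgue_step
  lebesgue_step_sigma_finite.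

End lebesgue_step.

Fixpoint lebesgue_rV (R : realType) (n : nat) :
    {sigma_finite_measure set 'rV[R]_n -> \bar R} :=
  match n with
  | 0 => @dirac _ 'rV[R]_0 0 R
  | m.+1 => lebesgue_step (lebesgue_rV R m)
  end.

Lemma lebesgue_rV_box (R : realType) (n : nat) (A : 'I_n -> set R) :
  (forall i, measurable (A i)) ->
  lebesgue_rV R n [set x : 'rV[R]_n | forall i, A i (x ord0 i)] =
  (\prod_(i < n) @lebesgue_measure R (A i))%E.
Proof.
elim: n A => [A _|n IH A mA].
  rewrite big_ord0 /= diracE mem_set//=.
  by case.
have mB : measurable
    [set x : 'rV[R]_n | forall i, A (lift ord0 i) (x ord0 i)].
  rewrite (_ : mkset _ = \bigcap_(i in [set: 'I_n])
      ((fun x : 'rV[R]_n => x ord0 i) @^-1` A (lift ord0 i))); last first.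
    by apply/seteqP; split => x /= h i; [move=> _|]; apply: h.
  apply: fin_bigcap_measurable; first exact: finite_finset.
  move=> i _; rewrite -[X in measurable X]setTI.
  exact: measurable_coord.
rewrite big_ord_recl /= -IH// -product_measure1E//; last exact: (mA ord0).
rewrite /lebesgue_step /pushforward; congr (_ _).
apply/seteqP; split => -[a v] /=.
  move=> h; split; first by have := h ord0; rewrite consv0.
  by move=> i; have := h (lift ord0 i); rewrite consvS.
move=> [h0 h] i; have [j ->|->] := unliftP ord0 i.
  by rewrite consvS; exact: h.
by rewrite consv0.
Qed.

Local Open Scope complex_scope.

Section fourier_multipliers.
Context {R : realType} {n : nat}.
Local Notation V := 'rV[R]_n.
Local Notation mu := (lebesgue_rV R n).

Definition dotv (x y : V) : R := \sum_i x ord0 i * y ord0 i.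

(* The Euclidean norm; the library's norm on matrices is the sup norm. *)
Definition enorm (x : V) : R := Num.sqrt (dotv x x).

Definition cintegral (f : V -> R[i]) : R[i] :=
  (\int[mu]_x complex.Re (f x))%R +i* (\int[mu]_x complex.Im (f x))%R.

Definition Lq_norm (q : R) (f : V -> R[i]) : \bar R :=
  Lnorm mu q%:E (fun x => (Normc.normc (f x))%:E).

Definition in_Lq (q : R) (f : V -> R[i]) : Prop :=
  [/\ measurable_fun setT (fun x => complex.Re (f x)),
      measurable_fun setT (fun x => complex.Im (f x)) &
      (Lq_norm q f < +oo)%E].

(* Partial derivatives of complex-valued functions; `cpartials [:: i1; ..; ik]`
   is the iterated derivative d_i1 ... d_ik, so that words over 'I_n play the
   role of multi-indices.  *)
Definition cpartial (i : 'I_n) (f : V -> R[i]) : V -> R[i] := fun x =>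
  'D_(delta_mx ord0 i) (fun y => complex.Re (f y)) x +i*
  'D_(delta_mx ord0 i) (fun y => complex.Im (f y)) x.

Definition cpartials (s : seq 'I_n) (f : V -> R[i]) : V -> R[i] :=
  foldr cpartial f s.

Definition smooth (f : V -> R[i]) : Prop := forall s : seq 'I_n,
  [/\ continuous (fun x => complex.Re (cpartials s f x)),
      continuous (fun x => complex.Im (cpartials s f x)) &
      forall i x,
        derivable (fun y => complex.Re (cpartials s f y)) x (delta_mx ord0 i) /\
        derivable (fun y => complex.Im (cpartials s f y)) x (delta_mx ord0 i)].

Definition schwartz_seminorm (k : nat) (s : seq 'I_n) (f : V -> R[i]) :
    \bar R :=
  ereal_sup (range (fun x =>
    ((1 + enorm x) ^+ k * Normc.normc (cpartials s f x))%:E)).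

Definition schwartz (f : V -> R[i]) : Prop :=
  smooth f /\ forall k s, (schwartz_seminorm k s f < +oo)%E.

(* A tempered distribution is a continuous linear functional on the Schwartz
   space. It is encoded by a functional on all functions, of which only the
   values at Schwartz functions are meaningful: linearity, continuity and
   equality are only ever considered there. *)
Definition schwartz_functional : Type := (V -> R[i]) -> R[i].

Definition distribution_eq (S T : schwartz_functional) : Prop :=
  forall phi, schwartz phi -> S phi = T phi.

(* Continuity is with respect to the topology defined by the seminorms. *)
Definition tempered (T : schwartz_functional) : Prop :=
  (forall (a : R[i]) phi psi, schwartz phi -> schwartz psi ->
    T (fun x => a * phi x + psi x) = a * T phi + T psi) /\
  (forall phi, schwartz phi -> forall e : R, 0 < e ->
    exists (N : nat) (d : R), 0 < d /\
      forall psi, schwartz psi ->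
        (forall k s, (k <= N)%N -> (size s <= N)%N ->
          (schwartz_seminorm k s (fun x => psi x - phi x)%R < d%:E)%E) ->
        Normc.normc (T psi - T phi) < e).

Definition distribution_of_fun (f : V -> R[i]) : schwartz_functional :=
  fun phi => cintegral (fun x => f x * phi x).

Definition distribution_sub (S T : schwartz_functional) :
    schwartz_functional :=
  fun phi => S phi - T phi.

(* The angular frequency convention, for which |xi|^2 is the symbol of the
   negative Laplacian. *)
Definition fourier (f : V -> R[i]) : V -> R[i] := fun xi =>
  cintegral (fun x => f x * (cos (dotv x xi) -i* sin (dotv x xi))).

Definition inv_fourier (f : V -> R[i]) : V -> R[i] := fun x =>
  (((2 * pi) ^- n)%:C *
  cintegral (fun xi => f xi * (cos (dotv x xi) +i* sin (dotv x xi))))%R.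

(* On distributions, by transposition. *)
Definition fourierD (T : schwartz_functional) : schwartz_functional :=
  fun phi => T (fourier phi).

Definition inv_fourierD (T : schwartz_functional) : schwartz_functional :=
  fun phi => T (inv_fourier phi).

Definition mulD (m : V -> R[i]) (T : schwartz_functional) :
    schwartz_functional :=
  fun phi => T (fun xi => m xi * phi xi).

(* The operator m(D), meaningful for smooth symbols m of which all the
   derivatives have polynomial growth.  *)
Definition multiplier (m : V -> R[i]) (T : schwartz_functional) :
    schwartz_functional :=
  inv_fourierD (mulD m (fourierD T)).

Definition Pc (c : R) (xi : V) : R :=
  (Num.sqrt (c ^+ 2 * enorm xi ^+ 2 + c ^+ 4 / 4) - c ^+ 2 / 2) + 1.

Definition Pinfty (xi : V) : R := enorm xi ^+ 2 + 1.

Definition inv_Pc_D (c : R) : schwartz_functional -> schwartz_functional :=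
  multiplier (fun xi => ((Pc c xi)^-1)%:C).

Definition inv_Pinfty_D : schwartz_functional -> schwartz_functional :=
  multiplier (fun xi => ((Pinfty xi)^-1)%:C).

Definition inv_sqrt_Pinfty_D : schwartz_functional -> schwartz_functional :=
  multiplier (fun xi => (Pinfty xi `^ (- 2^-1))%:C).

End fourier_multipliers.

(* Main.v *)
(* The symbols are polynomials in explicit mixtures of Gaussians, whose kernels
   are positive finite measures, so no Mikhlin-type theorem is needed. Put
   A = |xi|^2, k = c/2, b = k - 1/c, a = 1 - 1/c^2, S = sqrt (A + k^2) and
   T = sqrt (A + 1). Then P_c = c (S - b) and A + a = (S - b)(S + b), whence
     1/P_oo - 1/P_c = c^-2 (2/(A+a) - 1/((A+1)(A+a))) - c^-1/(S+b),
     T (1/P_oo - 1/P_c) = c^-2 (2/T - 1/(T(A+a)) + 2c^-2/(T(A+a)))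
                          - c^-1 (1 - b/(S+b) - (S-T)/(S+b)).
   Each of 1/(A+a), 1/T, 1/(S+b), S - T is a function M(A) of the form
   \int w(t) exp(-s(t) A) dP(t) with w, s >= 0, so that the corresponding
   operator averages translations f(x + Y) with weights of total mass M(0); by
   Minkowski's inequality its norm on L^q is at most M(0), for all q at once.
   As M(0) is of order 1, 1, 1/c and c respectively, the two sums have norms
   O(c^-2) and O(c^-1). *)

(* A multiplier with symbol m sends a functional T to phi |-> T (fourier (m * inv_fourier phi)). So
   operators are first built on Schwartz functions: if U preserves them and has symbol m, then m *
   inv_fourier phi is inv_fourier (U phi), and Fourier inversion leaves T (U phi). The transpose of
   U, again an average of translations, supplies the L^q function. Hence the insistence on moments
   of all orders and the single direction of the inversion formula. The numbers a and b come from
   P_c = c (S - b). Rationalising by S + b turns 1/P_c into a resolvent 1/(A+a), which cancels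
   1/P_oo up to c^-2, and a remainder 1/(S+b) of bound O(1/c). In the second identity T (1/P_oo -
   1/P_c) tends to -1/c at high frequency, so its kernel has a point mass: the term 1, the identity
   operator, carries it. The bound of S - T grows like c, but S - T occurs only against 1/(S+b). *)
Require Import Defs.
From HB Require Import structures.
From mathcomp Require Import all_boot all_order all_algebra.
From mathcomp Require Import all_classical all_reals all_analysis.
From mathcomp Require Import complex.
From mathcomp Require Import measurable_realfun ring lra.
Import Order.TTheory GRing.Theory Num.Theory.
Import numFieldNormedType.Exports.
Local Open Scope classical_set_scope.
Local Open Scope ring_scope.

Set Implicit Arguments.
Unset Strict Implicit.
Unset Printing Implicit Defensive.

(** * Integration on R^n *)

Section product_sigma_finite.
Local Open Scope ereal_scope.
Context d1 d2 (T1 : measurableType d1) (T2 : measurableType d2) (R : realType).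
Variables (m1 : {sigma_finite_measure set T1 -> \bar R}).
Variables (m2 : {sigma_finite_measure set T2 -> \bar R}).

Let sf : sigma_finite setT (m1 \x m2).
Proof.
have /sigma_finiteP[F [FT ndF Foo]] := sigma_finiteT m1.
have /sigma_finiteP[G [GT ndG Goo]] := sigma_finiteT m2.
exists (fun k => F k `*` G k).
  rewrite -setXTT FT GT predeqE => -[x y]; split.
    move=> [/= [k _ Fkx] [l _ Gly]]; exists (maxn k l) => //; split.
    - by move: x Fkx; exact/subsetPset/ndF/leq_maxl.
    - by move: y Gly; exact/subsetPset/ndG/leq_maxr.
  by move=> [k _ [? ?]]; split; exists k.
move=> k; have [mF Fk] := Foo k; have [mG Gk] := Goo k; split.
  exact: measurableX.
by rewrite product_measure1E// lte_mul_pinfty// ge0_fin_numE.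
Qed.

(* The library only declares m1 \x m2 as sigma-finite for subprobabilities. *)
Definition sigma_finite_prod : set (T1 * T2) -> \bar R := m1 \x m2.

HB.instance Definition _ := Measure.on sigma_finite_prod.

HB.instance Definition _ :=
  Measure_isSigmaFinite.Build _ _ _ sigma_finite_prod sf.

End product_sigma_finite.

Section real_integrals.
Context d (T : measurableType d) (R : realType).
Variable mu : {measure set T -> \bar R}.

Lemma integrable_dominated (f g : T -> R) : measurable_fun setT f ->
  (forall x, `|f x| <= g x) -> mu.-integrable setT (EFin \o g) ->
  mu.-integrable setT (EFin \o f).
Proof.
move=> mf fg ig; apply: le_integrable ig => //.
- exact/measurable_EFinP.
- by move=> x _ /=; rewrite lee_fin (le_trans (fg x))// ler_norm.
Qed.

Lemma integrable_ge0P (f : T -> R) : measurable_fun setT f ->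
  (forall x, 0 <= f x) -> (\int[mu]_x (f x)%:E < +oo)%E ->
  mu.-integrable setT (EFin \o f).
Proof.
move=> mf f0 foo; apply/integrableP; split; first exact/measurable_EFinP.
by under eq_integral do rewrite /= ger0_norm//.
Qed.

Lemma integrable_lty_ge0 (f : T -> R) : (forall x, 0 <= f x) ->
  mu.-integrable setT (EFin \o f) -> (\int[mu]_x (f x)%:E < +oo)%E.
Proof.
move=> f0 /integrableP[_].
by under eq_integral do rewrite /= ger0_norm//.
Qed.

Lemma EFin_Rintegral (f : T -> R) : mu.-integrable setT (EFin \o f) ->
  (\int[mu]_x f x)%:E = (\int[mu]_x (f x)%:E)%E.
Proof. by move=> fi; rewrite /Rintegral fineK// integrable_fin_num. Qed.

Lemma normr_Rintegral_le (f g : T -> R) : measurable_fun setT f ->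
  (forall x, `|f x| <= g x) -> mu.-integrable setT (EFin \o g) ->
  `|\int[mu]_x f x| <= \int[mu]_x g x.
Proof.
move=> mf fg ig; have fi := integrable_dominated mf fg ig.
apply: le_trans (le_normr_Rintegral measurableT fi) _.
apply: le_Rintegral => //.
exact: (integrable_norm fi).
Qed.

Lemma integrableZl_fun (k : R) (f : T -> R) :
  mu.-integrable setT (EFin \o f) ->
  mu.-integrable setT (EFin \o (fun x => k * f x)).
Proof.
move=> fi; have := integrableZl measurableT k fi.
by apply: eq_integrable => //= x _; rewrite EFinM.
Qed.

Lemma integrableD_fun (f g : T -> R) :
  mu.-integrable setT (EFin \o f) -> mu.-integrable setT (EFin \o g) ->
  mu.-integrable setT (EFin \o (fun x => f x + g x)).
Proof.
move=> fi gi; have := integrableD measurableT fi gi.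
by apply: eq_integrable => //= x _; rewrite EFinD.
Qed.

End real_integrals.

Section real_fubini.
Context d1 d2 (T1 : measurableType d1) (T2 : measurableType d2) (R : realType).
Variables (m1 : {sigma_finite_measure set T1 -> \bar R}).
Variables (m2 : {sigma_finite_measure set T2 -> \bar R}).

(** Integrability is not assumed: the inner integral is a difference of two nonnegative ones, each
    measurable in x by Tonelli, and [fine] is measurable. *)
Lemma measurable_Rintegral2 (f : T1 * T2 -> R) : measurable_fun setT f ->
  measurable_fun setT (fun x => \int[m2]_y f (x, y)).
Proof.
move=> mf; apply: (measurableT_comp (fine_measurable measurableT)).
rewrite (_ : (fun x => _) =
  (fun x => (\int[m2]_y (EFin \o f)^\+%E (x, y) -
             \int[m2]_y (EFin \o f)^\-%E (x, y))%E)); last first.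
  apply/funext => x; rewrite integralE; congr (_ - _)%E;
    by apply: eq_integral => y _; rewrite (funeposE,funenegE) /= (funeposE,funenegE).
have mEf : measurable_fun setT (EFin \o f) by exact/measurable_EFinP.
apply: emeasurable_funB; apply: measurable_fun_fubini_tonelli_F => //.
- exact: measurable_funepos.
- exact: measurable_funeneg.
Qed.

(** The [fine] hidden in the inner integral changes its value only where it is infinite, which is a
    null set. *)
Lemma Rfubini1 (f : T1 * T2 -> R) :
  (m1 \x m2)%E.-integrable setT (EFin \o f) ->
  \int[m1]_x \int[m2]_y f (x, y) = \int[(m1 \x m2)%E]_z f z.
Proof.
move=> fi; rewrite [RHS]/Rintegral -(integral12_prod_meas1 fi).
congr fine; apply: ae_eq_integral => //.
- apply/measurable_EFinP; apply: measurable_Rintegral2.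
  by have /measurable_int/measurable_EFinP := fi.
- exact: (measurable_fubini_F fi).
- have := integrable_ae measurableT (integrable_fubini_F fi).
  apply: filterS => x /(_ I) xfin _.
  by rewrite /Rintegral fineK.
Qed.

Lemma Rfubini2 (f : T1 * T2 -> R) :
  (m1 \x m2)%E.-integrable setT (EFin \o f) ->
  \int[m2]_y \int[m1]_x f (x, y) = \int[(m1 \x m2)%E]_z f z.
Proof.
move=> fi; rewrite [RHS]/Rintegral -(integral21_prod_meas1 fi).
have mf : measurable_fun setT f by have /measurable_int/measurable_EFinP := fi.
have iG : m2.-integrable setT (fubini_G m1 (EFin \o f)).
  apply/integrableP; split; first exact: (measurable_fubini_G fi).
  have mEf : measurable_fun setT (EFin \o f) by exact/measurable_EFinP.
  have h := (@integrable21ltyP _ _ _ _ _ m1 m2 _ mEf).1 fi.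
  apply: le_lt_trans h.
  apply: ge0_le_integral => //.
  - by apply: measurableT_comp => //; exact: (measurable_fubini_G fi).
  - apply: (measurable_fun_fubini_tonelli_G (abse \o (EFin \o f))) => //=.
    by apply: measurableT_comp => //; exact/measurable_EFinP.
  - move=> y _; apply: le_abse_integral => //.
    exact/measurable_EFinP/(measurableT_comp mf).
congr fine; apply: ae_eq_integral => //.
- apply/measurable_EFinP.
  apply: (measurableT_comp (fine_measurable measurableT)).
  exact: (measurable_fubini_G fi).
- exact: (measurable_fubini_G fi).
- have := integrable_ae measurableT iG.
  apply: filterS => x /(_ I) xfin _.
  by rewrite /Rintegral fineK.
Qed.

Lemma Rfubini (f : T1 * T2 -> R) :
  (m1 \x m2)%E.-integrable setT (EFin \o f) ->
  \int[m1]_x \int[m2]_y f (x, y) = \int[m2]_y \int[m1]_x f (x, y).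
Proof. by move=> fi; rewrite Rfubini1// Rfubini2. Qed.

Lemma integrable_prodP (f : T1 * T2 -> R) (g : T1 * T2 -> R) :
  measurable_fun setT f -> measurable_fun setT g ->
  (forall z, `|f z| <= g z) ->
  (\int[m1]_x \int[m2]_y (g (x, y))%:E < +oo)%E ->
  (m1 \x m2)%E.-integrable setT (EFin \o f).
Proof.
move=> mf mg fg goo; apply/integrable12ltyP; first exact/measurable_EFinP.
apply: le_lt_trans goo; apply: ge0_le_integral => //.
- by move=> x _; apply: integral_ge0.
- apply: (measurable_fun_fubini_tonelli_F (abse \o (EFin \o f))) => //=.
  by apply: measurableT_comp => //; exact/measurable_EFinP.
- apply: (measurable_fun_fubini_tonelli_F (EFin \o g)) => //=.
    exact/measurable_EFinP.
  by move=> z; rewrite lee_fin (le_trans _ (fg z)).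
- move=> x _; apply: ge0_le_integral => //.
  + apply: measurableT_comp => //.
    exact/measurable_EFinP/(measurableT_comp mf).
  + exact/measurable_EFinP/(measurableT_comp mg).
  + by move=> y _; rewrite lee_fin.
Qed.

End real_fubini.

Section lebesgue_shift.
Variable R : realType.
Local Notation leb := (@lebesgue_measure R).

Lemma measurable_addr (a : R) : measurable_fun setT (fun x : R => x + a).
Proof. by apply: measurable_funD. Qed.

(** By uniqueness of Lebesgue measure: its image under the shift has the same values on the
    intervals ]u, v]. *)
Lemma ge0_integral_lebesgue_shift (f : R -> \bar R) (a : R) :
  measurable_fun setT f -> (forall x, 0 <= f x)%E ->
  (\int[leb]_x f (x + a)%R = \int[leb]_x f x)%E.
Proof.
move=> mf f0.
have ms : measurable_fun [set: measurableTypeR R]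
  (fun x : measurableTypeR R => (x : R) + a : measurableTypeR R).
  exact: measurable_addr.
pose nu : {measure set (measurableTypeR R) -> \bar R} :=
  measure_function_pushforward__canonical__measure_function_Measure leb ms.
have sE : forall X, measurable X -> leb X = nu X.
  move=> X mX; apply: (lebesgue_measure_unique (mu := nu)) => // {mX}X.
  move=> [[u v] _ <-] /=; rewrite /pushforward.
  rewrite (_ : _ @^-1` _ = `]u - a, v - a]%classic); last first.
    by apply/seteqP; split => x /=; rewrite !in_itv/= ltrBlDr lerBrDr.
  rewrite !lebesgue_measure_itv/= !lte_fin ltrD2r.
  by case: ifP => // _; rewrite -!EFinB; congr (_%:E); lra.
rewrite [RHS](eq_measure_integral nu); last by move=> A mA _; exact: sE.
by rewrite ge0_integral_pushforward.
Qed.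

Lemma integral_lebesgue_shift (f : R -> \bar R) (a : R) :
  measurable_fun setT f ->
  (\int[leb]_x f (x + a)%R = \int[leb]_x f x)%E.
Proof.
move=> mf; rewrite integralE [RHS]integralE; congr (_ - _)%E.
  rewrite -[RHS](ge0_integral_lebesgue_shift a)//.
    by apply: eq_integral => x _; rewrite !funeposE.
  exact: measurable_funepos.
rewrite -[RHS](ge0_integral_lebesgue_shift a)//.
  by apply: eq_integral => x _; rewrite !funenegE.
exact: measurable_funeneg.
Qed.

Lemma Rintegral_lebesgue_shift (f : R -> R) (a : R) : measurable_fun setT f ->
  \int[leb]_x f (x + a) = \int[leb]_x f x.
Proof.
move=> mf; rewrite /Rintegral; congr fine.
by apply: (@integral_lebesgue_shift (EFin \o f)); apply/measurable_EFinP.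
Qed.

Lemma integrable_lebesgue_shift (f : R -> R) (a : R) :
  leb.-integrable setT (EFin \o f) ->
  leb.-integrable setT (EFin \o (fun x => f (x + a))).
Proof.
move=> /integrableP[mf foo].
have mfE : measurable_fun setT f by apply/measurable_EFinP.
apply/integrableP; split.
  apply/measurable_EFinP; apply: (measurableT_comp mfE); exact: measurable_addr.
rewrite (ge0_integral_lebesgue_shift a (f := abse \o (EFin \o f)))//=.
apply: measurableT_comp => //; exact/measurable_EFinP.
Qed.

End lebesgue_shift.

Section lebesgue_rV_integral.
Variable R : realType.
Local Notation leb := (@lebesgue_measure R).
Local Notation mu n := (lebesgue_rV R n).

Lemma measurable_rVD d (T : measurableType d) n (f g : T -> 'rV[R]_n) :
  measurable_fun setT f -> measurable_fun setT g ->
  measurable_fun setT (fun x => f x + g x).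
Proof.
move=> /measurable_fun_rVP mf /measurable_fun_rVP mg.
apply/measurable_fun_rVP => i; under eq_fun do rewrite mxE.
exact: measurable_funD.
Qed.

Lemma measurable_rVZ d (T : measurableType d) n (k : T -> R) (f : T -> 'rV[R]_n) :
  measurable_fun setT k -> measurable_fun setT f ->
  measurable_fun setT (fun x => k x *: f x).
Proof.
move=> mk /measurable_fun_rVP mf.
apply/measurable_fun_rVP => i; under eq_fun do rewrite mxE.
exact: measurable_funM.
Qed.

Lemma measurable_rVN d (T : measurableType d) n (f : T -> 'rV[R]_n) :
  measurable_fun setT f -> measurable_fun setT (fun x => - f x).
Proof.
move=> /measurable_fun_rVP mf.
apply/measurable_fun_rVP => i; under eq_fun do rewrite mxE.
exact: measurable_funN.
Qed.

Lemma measurable_rVB d (T : measurableType d) n (f g : T -> 'rV[R]_n) :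
  measurable_fun setT f -> measurable_fun setT g ->
  measurable_fun setT (fun x => f x - g x).
Proof. by move=> mf mg; apply: measurable_rVD => //; exact: measurable_rVN. Qed.

Lemma ge0_integral_rV0 (f : 'rV[R]_0 -> \bar R) :
  measurable_fun setT f -> (\int[mu 0]_x f x = f 0%R)%E.
Proof. by move=> mf; rewrite integral_dirac// diracT mul1e. Qed.

Lemma ge0_integral_rVS n (f : 'rV[R]_n.+1 -> \bar R) :
  measurable_fun setT f -> (forall x, 0 <= f x)%E ->
  (\int[mu n.+1]_x f x = \int[leb]_a \int[mu n]_v f (consv (a, v)))%E.
Proof.
move=> mf f0.
have mc := @measurable_consv R n.
rewrite (eq_measure_integral
  (measure_function_pushforward__canonical__measure_function_Measure
    (leb \x mu n) mc))%E; last by move=> A mA _.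
rewrite ge0_integral_pushforward//.
rewrite preimage_setT.
apply: (fubini_tonelli1 (m1 := leb) (m2 := mu n) (f \o @consv R n)) => //=.
exact: measurableT_comp.
Qed.

Lemma consvD n (a b : R) (v w : 'rV[R]_n) :
  consv (a, v) + consv (b, w) = consv (a + b, v + w).
Proof.
apply/rowP => i; have [j ->|->] := unliftP ord0 i; rewrite mxE.
  by rewrite !consvS/= mxE.
by rewrite !consv0.
Qed.

Lemma unconsvK n : cancel (@unconsv R n) (@consv R n).
Proof.
move=> x; apply/rowP => i; have [j ->|->] := unliftP ord0 i.
  by rewrite consvS/= mxE.
by rewrite consv0.
Qed.

Lemma ge0_integral_rV_shift n (f : 'rV[R]_n -> \bar R) (y : 'rV[R]_n) :
  measurable_fun setT f -> (forall x, 0 <= f x)%E ->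
  (\int[mu n]_x f (x + y)%R = \int[mu n]_x f x)%E.
Proof.
elim: n => [|n IH] in f y *.
  by move=> mf f0; congr integral; apply/funext => x; rewrite (thinmx0 y) addr0.
move=> mf f0.
have mc := @measurable_consv R n.
have mfy : measurable_fun setT (fun x : 'rV[R]_n.+1 => f (x + y)).
  by apply: (measurableT_comp mf); exact: measurable_rVD.
rewrite (ge0_integral_rVS mfy (fun x => f0 _)) (ge0_integral_rVS mf f0).
rewrite -[y](unconsvK).
set b := (unconsv y).1; set w := (unconsv y).2.
have -> : unconsv y = (b, w) by exact: surjective_pairing.
under eq_integral => a _.
  under eq_integral do rewrite consvD.
  rewrite (IH (fun v => f (consv (a + b, v))) w)//; last first.
    by apply: (measurableT_comp mf); apply: (measurableT_comp mc).
  over.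
rewrite (ge0_integral_lebesgue_shift b
  (f := fun a => \int[mu n]_v f (consv (a, v)))%E)//.
- apply: (measurable_fun_fubini_tonelli_F (f \o @consv R n)) => //=.
  exact: measurableT_comp.
- by move=> a; apply: integral_ge0.
Qed.

Lemma integral_rV_shift n (f : 'rV[R]_n -> \bar R) (y : 'rV[R]_n) :
  measurable_fun setT f ->
  (\int[mu n]_x f (x + y)%R = \int[mu n]_x f x)%E.
Proof.
move=> mf; rewrite integralE [RHS]integralE; congr (_ - _)%E.
  rewrite -[RHS](ge0_integral_rV_shift y)//.
    by apply: eq_integral => x _; rewrite !funeposE.
  exact: measurable_funepos.
rewrite -[RHS](ge0_integral_rV_shift y)//.
  by apply: eq_integral => x _; rewrite !funenegE.
exact: measurable_funeneg.
Qed.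

Lemma Rintegral_rV_shift n (f : 'rV[R]_n -> R) (y : 'rV[R]_n) :
  measurable_fun setT f ->
  \int[mu n]_x f (x + y) = \int[mu n]_x f x.
Proof.
move=> mf; rewrite /Rintegral; congr fine.
apply: (@integral_rV_shift _ (EFin \o f)); exact/measurable_EFinP.
Qed.

Lemma integrable_rV_shift n (f : 'rV[R]_n -> R) (y : 'rV[R]_n) :
  (mu n).-integrable setT (EFin \o f) ->
  (mu n).-integrable setT (EFin \o (fun x => f (x + y))).
Proof.
move=> /integrableP[mf foo].
have mfE : measurable_fun setT f by exact/measurable_EFinP.
apply/integrableP; split.
  by apply/measurable_EFinP/(measurableT_comp mfE); exact: measurable_rVD.
rewrite (ge0_integral_rV_shift y (f := abse \o (EFin \o f)))//=.
exact: measurableT_comp.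
Qed.

Lemma measurable_prod_coord n (g : 'I_n -> R -> R) :
  (forall i, measurable_fun setT (g i)) ->
  measurable_fun setT (fun x : 'rV[R]_n => \prod_i g i (x ord0 i)).
Proof.
move=> mg; apply: measurable_prod => i _.
exact: (measurableT_comp (mg i) (measurable_coord i)).
Qed.

Lemma integral_rV_prod n (g : 'I_n -> R -> R) :
  (forall i, measurable_fun setT (g i)) -> (forall i x, 0 <= g i x) ->
  (forall i, \int[leb]_x (g i x)%:E < +oo)%E ->
  (\int[mu n]_x (\prod_i g i (x ord0 i))%:E = (\prod_i \int[leb]_x g i x)%:E)%E.
Proof.
elim: n => [|n IH] in g *.
  move=> mg _ _; rewrite ge0_integral_rV0 ?big_ord0//.
  by apply/measurable_EFinP; apply: measurable_prod_coord.
move=> mg g0 goo.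
have gi i : leb.-integrable setT (EFin \o g i).
  by apply: integrable_ge0P; [exact: mg|exact: g0|exact: goo].
rewrite ge0_integral_rVS//; last 2 first.
- by apply/measurable_EFinP; exact: measurable_prod_coord.
- by move=> x; rewrite lee_fin prodr_ge0.
under eq_integral => a _.
  under eq_integral => v _.
    rewrite big_ord_recl consv0/= EFinM.
    under eq_bigr do rewrite consvS/=.
    over.
  rewrite ge0_integralZl//; last 3 first.
  - by apply/measurable_EFinP; apply: (@measurable_prod_coord n (fun i => g (lift ord0 i))).
  - by move=> v _; rewrite lee_fin prodr_ge0.
  - by rewrite lee_fin.
  rewrite (IH (fun i => g (lift ord0 i)))//.
  over.
rewrite ge0_integralZr//; last 3 first.
- by apply/measurable_EFinP; exact: mg.
- by move=> x _; rewrite lee_fin.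
- by rewrite lee_fin prodr_ge0// => i _; apply: Rintegral_ge0.
by rewrite big_ord_recl EFinM EFin_Rintegral.
Qed.

End lebesgue_rV_integral.

(** * Derivatives on the line and under the integral sign *)

Section is_derive_rules.
Variable R : realType.
Implicit Types (f g : R -> R) (k x a b : R).

Lemma is_derive1_eq f x a b : is_derive x (1 : R) f a -> a = b ->
  is_derive x (1 : R) f b.
Proof. by move=> fa <-. Qed.

Lemma is_derive1_cst k x : is_derive x (1 : R) (fun=> k) 0.
Proof. exact: is_derive_cst. Qed.

Lemma is_derive1_id x : is_derive x (1 : R) (fun t => t) 1.
Proof. exact: is_derive_id. Qed.

Lemma is_derive1_compfun f g x a b : is_derive (g x) 1 f a ->
  is_derive x 1 g b -> is_derive x 1 (fun t => f (g t)) (a * b).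
Proof. by move=> fa gb; exact: is_derive1_comp. Qed.

Lemma is_derive1_mulfun f g x a b : is_derive x 1 f a ->
  is_derive x 1 g b -> is_derive x 1 (fun t => f t * g t) (a * g x + f x * b).
Proof.
move=> fa gb; have fg := is_deriveM fa gb.
by apply: (is_derive1_eq fg); rewrite /GRing.scale/= addrC [g x * a]mulrC.
Qed.

Lemma is_derive1_addfun f g x a b : is_derive x 1 f a ->
  is_derive x 1 g b -> is_derive x 1 (fun t => f t + g t) (a + b).
Proof. by move=> fa gb; exact: (@is_deriveD _ _ _ f g x 1 a b). Qed.

Lemma is_derive1_lin (k c x : R) : is_derive x 1 (fun t => t * k + c) k.
Proof.
apply: (@is_derive1_eq _ _ (1 * k + x * 0 + 0)).
  exact: (is_derive1_addfun (is_derive1_mulfun (is_derive1_id x)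
    (is_derive1_cst k x)) (is_derive1_cst c x)).
by rewrite mulr0 !addr0 mul1r.
Qed.

End is_derive_rules.

Section derive_under_integral.
Context d (T : measurableType d) (R : realType).
Variable mu : {measure set T -> \bar R}.

Lemma is_derive_Rintegral (f df : R -> T -> R) (G : T -> R) (a : R) :
  (forall h, mu.-integrable setT (EFin \o f h)) ->
  (forall (h : R) x, is_derive h (1 : R) (f ^~ x) (df h x)) ->
  (forall h x, `|h - a| < 1 -> `|df h x| <= G x) ->
  mu.-integrable setT (EFin \o G) ->
  is_derive a (1 : R) (fun h => \int[mu]_x f h x) (\int[mu]_x df a x).
Proof.
move=> fi fd fG Gi.
have G0 x : 0 <= G x.
  by apply: le_trans (fG a x _); rewrite ?normr_ge0// subrr normr0.
have d1E h x : partial1of2 f h x = df h x.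
  by rewrite partial1of2E; case: (fd h x).
have Ia : `]a - 1, a + 1[%classic a by rewrite /= in_itv/=; lra.
have IG h x : `]a - 1, a + 1[%classic h -> setT x -> `|partial1of2 f h x| <= G x.
  rewrite /= in_itv/= d1E => /andP[h1 h2] _; apply: fG.
  by rewrite ltr_norml; lra.
have fdd h x : `]a - 1, a + 1[%classic h -> setT x -> derivable (f ^~ x) h 1.
  by move=> _ _; case: (fd h x).
split.
  exact: (derivable_under_integral measurableT Ia (fun h _ => fi h) fdd G0 Gi IG).
rewrite -derive1E (differentiation_under_integral measurableT Ia (fun h _ => fi h) fdd G0 Gi IG).
by apply: eq_Rintegral => x _; exact: d1E.
Qed.

(** Integration by parts without boundary terms: the integral of g along a measure-preserving flow
    is constant in h, so its derivative at h = 0, which is the integral of dg, vanishes. *)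
Lemma Rintegral_flow_derive (shift : R -> T -> T) (g dg G : T -> R) :
  (forall x, shift 0 x = x) ->
  (forall h, mu.-integrable setT (EFin \o (fun x => g (shift h x)))) ->
  (forall h, \int[mu]_x g (shift h x) = \int[mu]_x g x) ->
  (forall (h : R) x, is_derive h (1 : R) (fun t => g (shift t x)) (dg (shift h x))) ->
  (forall h x, `|h| < 1 -> `|dg (shift h x)| <= G x) ->
  mu.-integrable setT (EFin \o G) ->
  \int[mu]_x dg x = 0.
Proof.
move=> s0 gi ginv gd dgG Gi.
have [_ D0] : is_derive (0 : R) 1 (fun h : R => \int[mu]_x g (shift h x))
    (\int[mu]_x dg (shift 0 x)).
  apply: (@is_derive_Rintegral (fun h x => g (shift h x))
    (fun h x => dg (shift h x)) G) => // h x; rewrite subr0; exact: dgG.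
have -> : \int[mu]_x dg x = \int[mu]_x dg (shift 0 x).
  by apply: eq_Rintegral => x _; rewrite s0.
rewrite -D0 (_ : (fun h => _) = cst (\int[mu]_x g x)) ?derive_cst//.
exact/funext.
Qed.

End derive_under_integral.

(** * Gaussian integrals on the line *)

Section cauchy_density.
Variable R : realType.
Local Notation leb := (@lebesgue_measure R).

Lemma measurable_oneDsqrV : measurable_fun setT (fun x : R => (1 + x ^+ 2)^-1).
Proof. by apply: continuous_measurable_fun; exact: continuous_oneDsqrV. Qed.

Lemma integral_oneDsqrV : (\int[leb]_x ((1 + x ^+ 2)^-1)%:E < +oo)%E.
Proof.
rewrite (@ge0_symfun_integralT _ (fun x : R => (1 + x ^+ 2)^-1)).
- rewrite -set_itvcy.
  have := @integral0y_oneDsqr R; rewrite /oneDsqr => ->.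
  by rewrite -EFinM ltry.
- by move=> x; rewrite invr_ge0 addr_ge0// sqr_ge0.
- exact: continuous_oneDsqrV.
- by move=> x; rewrite /= sqrrN.
Qed.

Lemma integrable_oneDsqrV :
  leb.-integrable setT (EFin \o (fun x : R => (1 + x ^+ 2)^-1)).
Proof.
apply: integrable_ge0P; [exact: measurable_oneDsqrV| |exact: integral_oneDsqrV].
by move=> x; rewrite invr_ge0 addr_ge0// sqr_ge0.
Qed.

End cauchy_density.

Section gaussian.
Variables (R : realType) (s : R).
Hypothesis s_neq0 : s != 0.
Local Notation leb := (@lebesgue_measure R).
Local Notation g := (normal_pdf 0 s).

Lemma normal_pdf0E x : g x = normal_peak s * expR (- (x ^+ 2 / (2 * s ^+ 2))).
Proof.
by rewrite normal_pdfE// /normal_fun subr0 mulNr -(mulr_natl (s ^+ 2)).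
Qed.

Lemma is_derive_normal_pdf (x : R) : is_derive x (1 : R) g (- (x / s ^+ 2) * g x).
Proof.
rewrite (_ : g = fun t => normal_peak s * expR (t ^+ 2 * - (2 * s ^+ 2)^-1 + 0)); last first.
  by apply/funext => t; rewrite normal_pdf0E mulrN addr0.
apply: (@is_derive1_eq _ _ _ (0 * expR (x ^+ 2 * - (2 * s ^+ 2)^-1 + 0) +
   normal_peak s * (expR (x ^+ 2 * - (2 * s ^+ 2)^-1 + 0) *
     (- (2 * s ^+ 2)^-1 * (1 * x + x * 1))))).
  exact: (is_derive1_mulfun (is_derive1_cst _ _) (is_derive1_compfun
    (is_derive_expR _) (is_derive1_compfun (is_derive1_lin _ _ _)
    (is_derive1_mulfun (is_derive1_id x) (is_derive1_id x))))).
by field.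
Qed.

Lemma normal_pdf_decay k : exists C : R, 0 <= C /\
  forall y, (1 + y ^+ 2) ^+ k * g y <= C.
Proof.
(* With t = y^2 / b the Gaussian exponent is (k+1) t. Each of the k factors 1 + y^2 <= (1 + b) (1 +
   t) <= (1 + b) exp t uses up one exp t, and one is left over; k+1 instead of k keeps b positive at
   k = 0. *)
pose b := 2 * s ^+ 2 * k.+1%:R.
have s2 : 0 < s ^+ 2 by rewrite exprn_even_gt0.
have b0 : 0 < b 
  by apply: mulr_gt0; rewrite ?ltr0n//; exact: mulr_gt0.
exists ((1 + b) ^+ k * normal_peak s); split.
  by rewrite mulr_ge0 ?normal_peak_ge0// exprn_ge0// addr_ge0// ltW.
move=> y; rewrite normal_pdf0E mulrCA [leRHS]mulrC.
rewrite ler_wpM2l ?normal_peak_ge0//.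
pose t := y ^+ 2 / b.
have t0 : 0 <= t by rewrite divr_ge0 ?sqr_ge0// ltW.
have yE : y ^+ 2 = b * t by rewrite /t mulrCA divff ?mulr1// gt_eqF.
have -> : y ^+ 2 / (2 * s ^+ 2) = t *+ k.+1.
  rewrite -mulr_natl /t /b; field.
  by rewrite s_neq0/= nat1r pnatr_eq0.
rewrite expRN -mulr_natl expRM_natl ler_pdivrMr ?exprn_gt0 ?expR_gt0//.
apply: (@le_trans _ _ (((1 + b) * expR t) ^+ k)).
  apply: lerXn2r; rewrite ?nnegrE ?addr_ge0 ?sqr_ge0 ?mulr_ge0 ?expR_ge0 ?addr_ge0//.
    exact: ltW.
  rewrite yE; apply: (@le_trans _ _ ((1 + b) * (1 + t))); first nra.
  by rewrite ler_pM2l ?expR_ge1Dx// addr_gt0.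
rewrite exprMn ler_wpM2l//; first by rewrite exprn_ge0// addr_ge0// ltW.
by rewrite exprS ler_peMl ?exprn_ge0 ?expR_ge0// -expR0 ler_expR.
Qed.

Lemma integrable_normal_pdf_poly k :
  leb.-integrable setT (EFin \o (fun y : R => (1 + y ^+ 2) ^+ k * g y)).
Proof.
have [C [C0 HC]] := normal_pdf_decay k.+1.
apply: (@integrable_dominated _ _ _ leb _ (fun y : R => C * (1 + y ^+ 2)^-1)).
- apply: measurable_funM; last exact: measurable_normal_pdf.
  by apply: measurable_funX; apply: measurable_funD => //; exact: measurable_funX.
- move=> y; have y1 : 0 < 1 + y ^+ 2 by rewrite ltr_pwDl// sqr_ge0.
  rewrite ger0_norm ?mulr_ge0 ?exprn_ge0 ?normal_pdf_ge0// ?(ltW y1)//.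
  by rewrite ler_pdivlMr// mulrAC -exprSr.
- apply: (integrableZl_fun (mu := leb) C); exact: integrable_oneDsqrV.
Qed.

Let oneDsqr_shift (x h : R) : `|h| < 1 -> (1 + (x + h) ^+ 2)^-1 <= 3 * (1 + x ^+ 2)^-1.
Proof.
rewrite ltr_norml => /andP[h1 h2].
have x1 : 0 < 1 + x ^+ 2 by rewrite ltr_pwDl// sqr_ge0.
have x2 : 0 < 1 + (x + h) ^+ 2 by rewrite ltr_pwDl// sqr_ge0.
rewrite ler_pdivlMr// mulrC ler_pdivrMr//.
(* This square equals 2 (x + h)^2 + 2 h^2 - x^2. *)
have := sqr_ge0 (x + 2 * h); have : h ^+ 2 <= 1 by nra.
nra.
Qed.

(** The integral F solves F' = - s^2 u F. Differentiating under the integral gives F' = - S, and S =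
    s^2 u F follows because a derivative integrates to 0. So F (u) exp (s^2 u^2 / 2) is constant,
    with value cos th at u = 0. *)
Lemma Rintegral_normal_pdf_cos (u th : R) :
  \int[leb]_x (g x * cos (x * u + th)) = expR (- (s ^+ 2 * u ^+ 2 / 2)) * cos th.
Proof.
have [C [C0 HC]] := normal_pdf_decay 2.
have HC1 y : (1 + `|y|) * g y <= 2 * C * (1 + y ^+ 2)^-1.
  have y1 : 0 < 1 + y ^+ 2 by rewrite ltr_pwDl// sqr_ge0.
  rewrite ler_pdivlMr//; apply: le_trans (_ : 2 * ((1 + y ^+ 2) ^+ 2 * g y) <= _).
    rewrite mulrAC mulrA ler_wpM2r ?normal_pdf_ge0//.
    have : `|y| <= 1 + `|y| ^+ 2 by have := sqr_ge0 (`|y| - 1); nra.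
    rewrite real_normK ?num_real// expr2 mulrA; nra.
  by rewrite ler_pM2l.
have icau (K : R) : leb.-integrable setT (EFin \o (fun y : R => K * (1 + y ^+ 2)^-1)).
  by apply: integrableZl_fun; exact: integrable_oneDsqrV.
have mg : measurable_fun setT g by exact: measurable_normal_pdf.
have mcos (v t : R) : measurable_fun setT (fun x : R => cos (x * v + t)).
  apply: continuous_measurable_fun => x.
  apply: (@continuous_comp _ _ _ (fun x : R => x * v + t) cos); last exact: continuous_cos.
  by apply: cvgD; [exact: mulrr_continuous|exact: cvg_cst].
have msin (v t : R) : measurable_fun setT (fun x : R => sin (x * v + t)).
  by under eq_fun do rewrite -cosBpihalf -addrA; exact: mcos.
have ig v t : leb.-integrable setT (EFin \o (fun x => g x * cos (x * v + t))).
  apply: (@integrable_dominated _ _ _ leb _ g); last exact: integrable_normal_pdf.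
    by apply: measurable_funM; [exact: mg|exact: mcos].
  by move=> x; rewrite normrM ger0_norm ?normal_pdf_ge0// ler_piMr ?normal_pdf_ge0// cos_max.
have igs v t : leb.-integrable setT (EFin \o (fun x => g x * sin (x * v + t))).
  by have := ig v (t - pi / 2); apply: eq_integrable => //= x _; rewrite addrA cosBpihalf.
pose F u := \int[leb]_x (g x * cos (x * u + th)).
pose S u := \int[leb]_x (x * g x * sin (x * u + th)).
have ixs v : leb.-integrable setT (EFin \o (fun x => x * g x * sin (x * v + th))).
  apply: (@integrable_dominated _ _ _ leb _ (fun y => 2 * C * (1 + y ^+ 2)^-1)) => //.
    apply: measurable_funM; last exact: msin.
    by apply: measurable_funM => //; exact: mg.
  move=> x; apply: le_trans (HC1 x).
  rewrite !normrM [`|g x|]ger0_norm ?normal_pdf_ge0//.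
  have := sin_max (x * v + th); have := normal_pdf_ge0 0 s x.
  have := normr_ge0 x; have := normr_ge0 (sin (x * v + th)).
  by move=> a b c e; rewrite -[leRHS]mulr1 ler_pM ?mulr_ge0// ler_wpM2r// lerDr.
have dF (v : R) : is_derive v (1 : R) F (- S v).
  rewrite (_ : - S v = \int[leb]_x (- (x * g x * sin (x * v + th)))); last first.
    rewrite -mulN1r -RintegralZl//.
    by apply: eq_Rintegral => x _; rewrite mulN1r.
  apply: (@is_derive_Rintegral _ _ _ leb (fun u x => g x * cos (x * u + th))
    (fun u x => - (x * g x * sin (x * u + th))) (fun y => 2 * C * (1 + y ^+ 2)^-1)) => //.
    move=> h x.
    apply: (@is_derive1_eq _ _ _ (0 * cos (x * h + th) +
      g x * (- sin (x * h + th) * x))); last by ring.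
    apply: (is_derive1_mulfun (is_derive1_cst _ _)); apply: is_derive1_compfun.
    under eq_fun do rewrite mulrC.
    exact: is_derive1_lin.
  move=> h x _; apply: le_trans (HC1 x).
  rewrite normrN !normrM [`|g x|]ger0_norm ?normal_pdf_ge0//.
  have := sin_max (x * h + th); have := normal_pdf_ge0 0 s x.
  have := normr_ge0 x; have := normr_ge0 (sin (x * h + th)).
  by move=> a b c e; rewrite -[leRHS]mulr1 ler_pM ?mulr_ge0// ler_wpM2r// lerDr.
have SF v : S v = s ^+ 2 * v * F v.
  have s2 : s ^+ 2 != 0 by rewrite expf_neq0.
  (* The integrand is the derivative of g (x) sin (x v + th), taken along the flow of
     translations. *)
  have : \int[leb]_x (- (s ^+ 2)^-1 * (x * g x * sin (x * v + th))
      + v * (g x * cos (x * v + th))) = 0.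
    apply: (@Rintegral_flow_derive _ _ _ leb (fun h x => x + h)
      (fun x => g x * sin (x * v + th)) _
      (fun x => ((s ^+ 2)^-1 + `|v|) * (2 * C * (3 * (1 + x ^+ 2)^-1)))).
    - by move=> x; rewrite addr0.
    - by move=> h; exact: (integrable_lebesgue_shift h (igs v th)).
    - move=> h; apply: (Rintegral_lebesgue_shift h (f := fun x => g x * sin (x * v + th))).
      by apply: measurable_funM; [exact: mg|exact: msin].
    - move=> h x.
      have sh : is_derive h (1 : R) (fun t : R => x + t) 1.
        by apply: (@is_derive1_eq _ _ _ (0 + 1)); rewrite add0r.
      apply: (@is_derive1_eq _ _ _ (- ((x + h) / s ^+ 2) * g (x + h) * 1 *
          sin ((x + h) * v + th) + g (x + h) * (cos ((x + h) * v + th) * (v * 1)))).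
        exact: (is_derive1_mulfun
          (is_derive1_compfun (is_derive_normal_pdf _) sh)
          (is_derive1_compfun (is_derive_sin _)
          (is_derive1_compfun (is_derive1_lin _ _ _) sh))).
      by field.
    - move=> h x h1; set y := x + h.
      apply: (@le_trans _ _ (((s ^+ 2)^-1 + `|v|) * ((1 + `|y|) * g y))).
        have gy := normal_pdf_ge0 0 s y.
        have s2' : 0 <= (s ^+ 2)^-1 by rewrite invr_ge0 sqr_ge0.
        apply: le_trans (ler_normD _ _) _; rewrite [leRHS]mulrDl; apply: lerD.
          rewrite normrM normrN (ger0_norm s2') ler_wpM2l// !normrM (ger0_norm gy).
          rewrite -[leRHS]mulr1 ler_pM ?mulr_ge0//; last exact: sin_max.
          by rewrite ler_wpM2r// lerDr.
        rewrite normrM ler_wpM2l// normrM (ger0_norm gy) mulrC.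
        by rewrite ler_wpM2r// (le_trans (cos_max _))// lerDl.
      apply: ler_wpM2l; first by rewrite addr_ge0 ?invr_ge0 ?sqr_ge0.
      apply: (le_trans (HC1 y)); apply: ler_wpM2l; first by rewrite mulr_ge0.
      exact: oneDsqr_shift.
    - by do 3 apply: integrableZl_fun; exact: integrable_oneDsqrV.
  rewrite RintegralD//; [|exact: integrableZl_fun|exact: integrableZl_fun].
  rewrite !RintegralZl// -/(S v) -/(F v) => /eqP.
  rewrite mulNr addrC subr_eq0 => /eqP vS.
  by rewrite -mulrA vS mulrA divff ?mul1r.
pose E v := F v * expR (v ^+ 2 * (s ^+ 2 / 2) + 0).
have EE : E u = E 0.
  apply: is_derive_0_is_cst => v.
  apply: (@is_derive1_eq _ _ _ (- S v * expR (v ^+ 2 * (s ^+ 2 / 2) + 0) +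
     F v * (expR (v ^+ 2 * (s ^+ 2 / 2) + 0) * (s ^+ 2 / 2 * (1 * v + v * 1))))).
    exact: (is_derive1_mulfun (dF v) (is_derive1_compfun
      (is_derive_expR _) (is_derive1_compfun (is_derive1_lin _ _ _)
      (is_derive1_mulfun (is_derive1_id v) (is_derive1_id v))))).
  by rewrite SF; field.
have F0 : F 0 = cos th.
  rewrite /F; under eq_Rintegral do rewrite mulr0 add0r.
  rewrite RintegralZr//; last exact: integrable_normal_pdf.
  by rewrite /Rintegral integral_normal_pdf mul1r.
move: EE; rewrite /E F0 expr0n/= mul0r add0r expR0 mulr1 addr0 => <-.
rewrite -/(F u) mulrCA -expRD.
by rewrite (_ : _ + _ = 0) ?expR0 ?mulr1//; field.
Qed.

End gaussian.

(** * Scalar product, polynomial weights and Gaussians on R^n *)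

Section dotv_lemmas.
Variables (R : realType) (n : nat).
Implicit Types x y z : 'rV[R]_n.

Lemma dotvC x y : dotv x y = dotv y x.
Proof. by apply: eq_bigr => i _; rewrite mulrC. Qed.

Lemma dotvDl x y z : dotv (x + y) z = dotv x z + dotv y z.
Proof. by rewrite -big_split; apply: eq_bigr => i _; rewrite mxE mulrDl. Qed.

Lemma dotvZl (k : R) x z : dotv (k *: x) z = k * dotv x z.
Proof. by rewrite mulr_sumr; apply: eq_bigr => i _; rewrite mxE mulrA. Qed.

Lemma dotvNl x z : dotv (- x) z = - dotv x z.
Proof. by rewrite -scaleN1r dotvZl mulN1r. Qed.

Lemma dotvBl x y z : dotv (x - y) z = dotv x z - dotv y z.
Proof. by rewrite dotvDl dotvNl. Qed.

Lemma dotv_ge0 x : 0 <= dotv x x.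
Proof. by apply: sumr_ge0 => i _; rewrite -expr2 sqr_ge0. Qed.

Lemma enorm_sqr x : enorm x ^+ 2 = dotv x x.
Proof. by rewrite /enorm sqr_sqrtr// dotv_ge0. Qed.

Lemma dotv_delta (i : 'I_n) y : dotv (delta_mx ord0 i) y = y ord0 i.
Proof.
rewrite /dotv (bigD1 i)//= big1 ?addr0 ?mxE ?eqxx ?mul1r//.
by move=> j ji; rewrite mxE eqxx/= (negbTE ji) mul0r.
Qed.

Lemma measurable_dotv d (T : measurableType d) (f g : T -> 'rV[R]_n) :
  measurable_fun setT f -> measurable_fun setT g ->
  measurable_fun setT (fun t => dotv (f t) (g t)).
Proof.
move=> /measurable_fun_rVP mf /measurable_fun_rVP mg.
by apply: measurable_sum => i; apply: measurable_funM.
Qed.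

Lemma measurable_cos_fun d (T : measurableType d) (f : T -> R) :
  measurable_fun setT f -> measurable_fun setT (fun t => cos (f t)).
Proof.
move=> mf; apply: (measurableT_comp _ mf).
by apply: continuous_measurable_fun; exact: continuous_cos.
Qed.

End dotv_lemmas.

Section polynomial_weight.
Variables (R : realType) (n : nat).
Local Notation V := 'rV[R]_n.
Local Notation mu := (lebesgue_rV R n).

(** A substitute for 1 + |x| that factors over the coordinates, so that its integrals reduce to the
    line, and that is submultiplicative, so that translations cost only a factor. *)
Definition pweight (x : V) : R := \prod_i (1 + `|x ord0 i|).

Lemma pweight_ge1 x : 1 <= pweight x.
Proof.
rewrite /pweight; elim/big_rec: _ => // i y _ y1.
by rewrite (le_trans y1)// ler_peMl ?(le_trans ler01)// lerDl.
Qed.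

Lemma pweight_gt0 x : 0 < pweight x.
Proof. by rewrite (lt_le_trans ltr01)// pweight_ge1. Qed.

Lemma pweight_ge0 x : 0 <= pweight x. Proof. exact/ltW/pweight_gt0. Qed.

Lemma pweightD x y : pweight (x + y) <= pweight x * pweight y.
Proof.
rewrite /pweight -big_split/=; apply: ler_prod => i _; rewrite addr_ge0//= mxE.
have := ler_normD (x ord0 i) (y ord0 i).
have := normr_ge0 (x ord0 i); have := normr_ge0 (y ord0 i); nra.
Qed.

Lemma pweightN x : pweight (- x) = pweight x.
Proof. by apply: eq_bigr => i _; rewrite mxE normrN. Qed.

Lemma pweightZ (k : R) x : pweight (k *: x) <= (1 + `|k|) ^+ n * pweight x.
Proof.
rewrite -[X in _ ^+ X](card_ord n) -prodr_const -big_split/=.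
apply: ler_prod => i _; rewrite addr_ge0//= mxE normrM.
have := normr_ge0 (x ord0 i); have := normr_ge0 k; nra.
Qed.

Lemma pweight_delta (i : 'I_n) (h : R) :
  pweight (h *: delta_mx ord0 i) = 1 + `|h|.
Proof.
rewrite /pweight (bigD1 i)//= !mxE !eqxx mulr1 big1 ?mulr1// => j ji.
by rewrite !mxE eqxx/= (negbTE ji) mulr0 normr0 addr0.
Qed.

Lemma ler_coord_enorm (i : 'I_n) (x : V) : `|x ord0 i| <= enorm x.
Proof.
rewrite /enorm -sqrtr_sqr ler_sqrt ?dotv_ge0// /dotv (bigD1 i)//= -expr2 lerDl.
by apply: sumr_ge0 => j _; rewrite -expr2 sqr_ge0.
Qed.

Lemma pweight_le_enorm x : pweight x <= (1 + enorm x) ^+ n.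
Proof.
rewrite -[X in _ ^+ X](card_ord n) -prodr_const; apply: ler_prod => i _.
by rewrite addr_ge0//= lerD2l ler_coord_enorm.
Qed.

(** By induction on the coordinates, (p - 1)^2 dominates the sum of squares s. For t >= 0 and p >=
    1, (1 + t) p - 1 = (p - 1) + t p, whose square is at least (p - 1)^2 + t^2. *)
Lemma enorm_le_pweight x : 1 + enorm x <= pweight x.
Proof.
have [p1 xp] : 1 <= pweight x /\ dotv x x <= (pweight x - 1) ^+ 2.
  rewrite /dotv /pweight.
  elim/big_rec2: _ => [|i s p _ [s1 IH]]; first by rewrite subrr expr0n.
  have x0 := normr_ge0 (x ord0 i); split; first by nra.
  rewrite -expr2 -[x ord0 i ^+ 2]real_normK ?num_real//.
  set t := `|x ord0 i| in x0 *.
  have : t ^+ 2 <= t ^+ 2 * p ^+ 2 by rewrite ler_peMr ?sqr_ge0// exprn_ege1.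
  have : 0 <= t * p * (p - 1) by rewrite !mulr_ge0 ?subr_ge0// (le_trans ler01).
  nra.
rewrite addrC -lerBrDr -[leRHS]ger0_norm ?subr_ge0// -sqrtr_sqr ler_wsqrtr//.
Qed.

Lemma measurable_pweight : measurable_fun setT pweight.
Proof.
apply: (@measurable_prod_coord _ _ (fun _ t => 1 + `|t|)) => i.
by apply: measurable_funD => //; exact: normr_measurable.
Qed.

Lemma measurable_pweightX k : measurable_fun setT (fun x => pweight x ^+ k).
Proof. by apply: measurable_funX; exact: measurable_pweight. Qed.

Lemma integrable_pweightV :
  mu.-integrable setT (EFin \o (fun x => (pweight x ^+ 2)^-1)).
Proof.
have E x : (pweight x ^+ 2)^-1 = \prod_i ((1 + `|x ord0 i|) ^+ 2)^-1.
  by rewrite /pweight -prodrXl prodfV.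
pose h (t : R) := ((1 + `|t|) ^+ 2)^-1.
have h0 t : 0 <= h t by rewrite invr_ge0 exprn_ge0// addr_ge0.
have hle t : h t <= (1 + t ^+ 2)^-1.
  rewrite lef_pV2 ?posrE; last 2 first.
  - by rewrite exprn_gt0// ltr_pwDl.
  - by rewrite ltr_pwDl// sqr_ge0.
  by rewrite -[t ^+ 2]real_normK ?num_real//; have := normr_ge0 t; nra.
have mh : measurable_fun setT h.
  (* As (1 + |t|)^2 = 1 + (2 |t| + t^2), measurability is inherited from that of 1 / (1 + u^2). *)
  rewrite (_ : h = (fun t => (1 + t ^+ 2)^-1) \o (fun t => Num.sqrt (2 * `|t| + t ^+ 2))).
    apply: measurableT_comp; first exact: measurable_oneDsqrV.
    apply: (@measurableT_comp _ _ _ _ _ _ (@Num.sqrt R)).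
      by apply: continuous_measurable_fun; exact: sqrt_continuous.
    apply: measurable_funD; last exact: measurable_funX.
    by apply: measurable_funM => //; exact: normr_measurable.
  apply/funext => t /=; rewrite sqr_sqrtr; last first.
    by rewrite addr_ge0 ?sqr_ge0// mulr_ge0.
  rewrite /h; congr (_^-1).
  by rewrite -[t ^+ 2]real_normK ?num_real//; ring.
apply: integrable_ge0P.
- under eq_fun do rewrite E.
  exact: (@measurable_prod_coord _ _ (fun _ => h)).
- by move=> x; rewrite invr_ge0 exprn_ge0// pweight_ge0.
- under eq_integral do rewrite E.
  rewrite (@integral_rV_prod _ _ (fun _ => h))// ?ltry// => _.
  apply: le_lt_trans (integral_oneDsqrV R).
  apply: ge0_le_integral => //.
  + by move=> x _; rewrite lee_fin.
  + by apply/measurable_EFinP; exact: mh.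
  + by apply/measurable_EFinP; exact: measurable_oneDsqrV.
  + by move=> x _; rewrite lee_fin.
Qed.

End polynomial_weight.

Section gaussV.
Variables (R : realType).
Local Notation leb := (@lebesgue_measure R).
Local Notation mu n := (lebesgue_rV R n).

Lemma integral_rVS n (f : 'rV[R]_n.+1 -> R) :
  (mu n.+1).-integrable setT (EFin \o f) ->
  (leb \x mu n)%E.-integrable setT (EFin \o (f \o @consv R n)) /\
  \int[mu n.+1]_x f x = \int[leb]_a \int[mu n]_v f (consv (a, v)).
Proof.
move=> fi; have mf : measurable_fun setT f by have /measurable_int/measurable_EFinP := fi.
have mc := @measurable_consv R n.
have fci : (leb \x mu n)%E.-integrable setT (EFin \o (f \o @consv R n)).
  apply/integrableP; split; first by apply/measurable_EFinP/measurableT_comp.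
  have /integrableP[_] := fi.
  rewrite ge0_integral_rVS//; last by apply: measurableT_comp => //; exact/measurable_EFinP.
  rewrite (fubini_tonelli1 (m1 := leb) (m2 := mu n) (abse \o (EFin \o (f \o @consv R n))))//=.
  by apply: measurableT_comp => //; apply/measurable_EFinP/measurableT_comp.
split=> //.
rewrite [RHS](Rfubini1 (m1 := leb) (m2 := mu n) (f := f \o @consv R n) fci) [LHS]/Rintegral [RHS]/Rintegral; congr fine.
rewrite (eq_measure_integral
  (measure_function_pushforward__canonical__measure_function_Measure
    (leb \x mu n) mc))%E; last by move=> A mA _.
rewrite integral_pushforward ?preimage_setT//=.
exact/measurable_EFinP.
Qed.

Variable s : R.
Hypothesis s_neq0 : s != 0.

Definition gaussV n (x : 'rV[R]_n) : R := \prod_i normal_pdf 0 s (x ord0 i).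

Lemma gaussV_ge0 n (x : 'rV[R]_n) : 0 <= gaussV x.
Proof. by apply: prodr_ge0 => i _; exact: normal_pdf_ge0. Qed.

Lemma measurable_gaussV n : measurable_fun setT (@gaussV n).
Proof.
apply: (@measurable_prod_coord _ _ (fun _ => normal_pdf 0 s)) => i.
exact: measurable_normal_pdf.
Qed.

Lemma gaussV_cons n a (v : 'rV[R]_n) :
  gaussV (consv (a, v)) = normal_pdf 0 s a * gaussV v.
Proof.
rewrite /gaussV big_ord_recl consv0; congr (_ * _).
by apply: eq_bigr => i _; rewrite consvS.
Qed.

Lemma dotv_cons n a (v : 'rV[R]_n) x :
  dotv (consv (a, v)) x = a * x ord0 ord0 + dotv v (unconsv x).2.
Proof.
rewrite /dotv big_ord_recl consv0; congr (_ + _).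
by apply: eq_bigr => i _; rewrite consvS mxE.
Qed.

Lemma integrable_gaussV n (k : nat) : (mu n).-integrable setT
  (EFin \o (fun x => pweight x ^+ k * gaussV x)).
Proof.
pose h (t : R) := (1 + `|t|) ^+ k * normal_pdf 0 s t.
have h0 t : 0 <= h t by rewrite mulr_ge0 ?exprn_ge0 ?addr_ge0// normal_pdf_ge0.
have mh : measurable_fun setT h.
  apply: measurable_funM; last exact: measurable_normal_pdf.
  apply: measurable_funX; apply: measurable_funD => //; exact: normr_measurable.
have E (x : 'rV[R]_n) : pweight x ^+ k * gaussV x = \prod_i h (x ord0 i).
  by rewrite /pweight /gaussV -prodrXl -big_split.
apply: integrable_ge0P.
- under eq_fun do rewrite E.
  exact: (@measurable_prod_coord _ _ (fun _ => h)).
- by move=> x; rewrite E prodr_ge0.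
- under eq_integral do rewrite E.
  rewrite (@integral_rV_prod _ _ (fun _ => h))// ?ltry// => _.
  have := integrable_normal_pdf_poly s_neq0 k.
  move/(integrableZl_fun (mu := leb) (2 ^+ k)).
  move/integrable_lty_ge0 => h1; apply: le_lt_trans (h1 _); last first.
    by move=> x; rewrite !mulr_ge0 ?exprn_ge0 ?addr_ge0 ?sqr_ge0// normal_pdf_ge0.
  apply: ge0_le_integral => //.
  + by move=> x _; rewrite lee_fin.
  + by apply/measurable_EFinP; exact: mh.
  + apply/measurable_EFinP; apply: measurable_funM => //.
    apply: measurable_funM; last exact: measurable_normal_pdf.
    by apply: measurable_funX; apply: measurable_funD => //; exact: measurable_funX.
  + move=> x _; rewrite lee_fin /h mulrA ler_wpM2r ?normal_pdf_ge0// -exprMn.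
    apply: lerXn2r; rewrite ?nnegrE ?mulr_ge0 ?addr_ge0 ?sqr_ge0//.
    by rewrite -[x ^+ 2]real_normK ?num_real//; have := sqr_ge0 (`|x| - 1); nra.
Qed.

Lemma integrable_gaussV0 n : (mu n).-integrable setT (EFin \o (@gaussV n)).
Proof.
have := integrable_gaussV n 0; apply: eq_integrable => //= x _.
by rewrite expr0 mul1r.
Qed.

Lemma integrable_gaussV_cos n (xi : 'rV[R]_n) th : (mu n).-integrable setT
  (EFin \o (fun x => gaussV x * cos (dotv x xi + th))).
Proof.
apply: (@integrable_dominated _ _ _ (mu n) _ (@gaussV n)) (integrable_gaussV0 n).
  apply: measurable_funM; first exact: measurable_gaussV.
  apply: measurable_cos_fun; apply: measurable_funD => //.
  exact: measurable_dotv.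
move=> x; rewrite normrM ger0_norm ?gaussV_ge0// ler_piMr ?gaussV_ge0//.
exact: cos_max.
Qed.

(** The phase is arbitrary for the sake of the induction: in the integral over the last n
    coordinates, the first one enters only as a shift of the phase. *)
Lemma Rintegral_gaussV_cos n (xi : 'rV[R]_n) th :
  \int[mu n]_x (gaussV x * cos (dotv x xi + th)) =
  expR (- (s ^+ 2 * dotv xi xi / 2)) * cos th.
Proof.
elim: n => [|n IH] in xi th *.
  rewrite /Rintegral ge0_integral_rV0.
    by rewrite /gaussV /dotv !big_ord0 /= add0r mulr0 mul0r oppr0 expR0.
  by have /measurable_int := integrable_gaussV_cos xi th.
have [_ ->] := integral_rVS (integrable_gaussV_cos xi th).
under eq_Rintegral => a _.
  under eq_Rintegral do rewrite gaussV_cons dotv_cons -mulrA [a * _ + _]addrC -addrA.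
  rewrite RintegralZl//; last exact: integrable_gaussV_cos.
  rewrite IH mulrCA.
  over.
rewrite RintegralZl//; last first.
  apply: (@integrable_dominated _ _ _ leb _ (normal_pdf 0 s)); last exact: integrable_normal_pdf.
    apply: measurable_funM; first exact: measurable_normal_pdf.
    by apply: measurable_cos_fun; apply: measurable_funD => //; apply: measurable_funM.
  by move=> x; rewrite normrM ger0_norm ?normal_pdf_ge0// ler_piMr ?normal_pdf_ge0// cos_max.
rewrite Rintegral_normal_pdf_cos// mulrA -expRD; congr (expR _ * _).
rewrite -[in RHS](unconsvK xi) (surjective_pairing (unconsv xi)).
by rewrite dotv_cons consv0 consvK/= expr2; field.
Qed.

Lemma Rintegral_gaussV n : \int[mu n]_x (gaussV x) = 1.
Proof.
have := Rintegral_gaussV_cos (0 : 'rV[R]_n) 0.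
have d0 (x : 'rV[R]_n) : dotv x 0 = 0 by rewrite dotvC -(scale0r 0) dotvZl mul0r.
rewrite d0 mulr0 mul0r oppr0 expR0 mul1r cos0 => <-.
by apply: eq_Rintegral => x _; rewrite d0 addr0 cos0 mulr1.
Qed.

End gaussV.

(** * Schwartz functions *)

Section line_derivative.
Variables (R : realType) (V : normedModType R).
Implicit Types (f : V -> R) (x v : V).

Lemma is_derive_lineP f x v (h d : R) :
  is_derive h (1 : R) (fun t : R => f (x + t *: v)) d <->
  is_derive (x + h *: v) v f d.
Proof.
have E : (fun k : R => k^-1 *: (((fun t : R => f (x + t *: v)) \o shift h) (k *: (1 : R))
      - f (x + h *: v))) =
    (fun k : R => k^-1 *: ((f \o shift (x + h *: v)) (k *: v) - f (x + h *: v))).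
  apply/funext => k /=; congr (_ *: (f _ - _)).
  rewrite [k *: (1 : R)]mulr1 scalerDl addrCA; congr (_ + _).
split=> -[dx vx]; split.
- by move: dx; rewrite /derivable E.
- by move: vx; rewrite /derive E.
- by move: dx; rewrite /derivable -E.
- by move: vx; rewrite /derive -E.
Qed.

Lemma is_derive_line f x v (h : R) : derivable f (x + h *: v) v ->
  is_derive h (1 : R) (fun t : R => f (x + t *: v)) ('D_v f (x + h *: v)).
Proof. by move=> df; apply/is_derive_lineP; exact: derivableP. Qed.

Lemma is_derive_of_line f x v (d : R) :
  is_derive (0 : R) (1 : R) (fun t : R => f (x + t *: v)) d -> is_derive x v f d.
Proof. by move=> /is_derive_lineP; rewrite scale0r addr0. Qed.

Lemma line_lipschitz f x v (h M : R) : 0 <= M ->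
  (forall y, derivable f y v) -> (forall y, `|'D_v f y| <= M) ->
  `|f (x + h *: v) - f x| <= M * `|h|.
Proof.
move=> M0 df dM.
have dl (t : R) := is_derive_line (df (x + t *: v)).
have cf (a b : R) : {within `[a, b], continuous (fun t : R => f (x + t *: v))}.
  apply: derivable_within_continuous => t _; exact: (@ex_derive _ _ _ _ _ _ _ (dl t)).
have key (a b : R) : a < b -> `|f (x + b *: v) - f (x + a *: v)| <= M * (b - a).
  move=> ab; have [c _ ->] := MVT ab (fun t _ => dl t) (cf a b).
  by rewrite normrM [`|b - a|]gtr0_norm ?subr_gt0// ler_wpM2r// subr_ge0 ltW.
have [h0|h0|->] := ltgtP h 0; last by rewrite scale0r addr0 subrr !normr0 mulr0.
- by have := key _ _ h0; rewrite scale0r addr0 distrC sub0r (ltr0_norm h0).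
- by have := key _ _ h0; rewrite scale0r addr0 subr0 (gtr0_norm h0).
Qed.

End line_derivative.

Section rV_continuity.
Variables (R : realType) (n : nat).
Local Notation V := 'rV[R]_n.

Lemma rV_norm_lt (x : V) (e : R) : 0 < e -> (forall i, `|x ord0 i| < e) -> `|x| < e.
Proof.
move=> e0 xe; rewrite /Num.norm/= mx_normrE.
by apply: bigmax_lt => // -[i j] _ /=; rewrite (ord1 i).
Qed.

Lemma rV_coord_le_norm (x : V) i : `|x ord0 i| <= `|x|.
Proof.
by rewrite /(`|x|) /= mx_normrE; apply: (@le_bigmax _ _ _ _ (fun ij => `|x ij.1 ij.2|) (ord0, i)).
Qed.

Let approx (m : nat) (z : {ffun 'I_n -> int}) : V := \row_i ((z i)%:~R / m.+1%:R).
Let grid (m : nat) (x : V) : {ffun 'I_n -> int} :=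
  [ffun i => Num.floor (m.+1%:R * x ord0 i)].

(** The sigma-algebra is generated by the coordinates, so open sets are not at hand. Instead f is
    the pointwise limit of its values at the points of a grid of mesh 1/(m+1), and each
    approximation is constant on countably many half-open boxes. *)
Lemma measurable_continuous_rV (f : V -> R) : continuous f -> measurable_fun setT f.
Proof.
move=> cf.
apply: (@measurable_fun_cvg _ _ _ _ (fun m x => f (approx m (grid m x)))).
- move=> m _ B mB; rewrite setTI.
  rewrite (_ : _ @^-1` _ = \bigcup_(z : {ffun 'I_n -> int})
     [set x | B (f (approx m z)) /\ grid m x = z]); last first.
    by apply/seteqP; split => [x /= Bx|x [z _ /= [Bz ->]]//]; exists (grid m x).
  apply: countable_bigcupT_measurable; first exact: countableP.
  move=> z; have [Bz|nBz] := pselect (B (f (approx m z))); last first.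
    by rewrite (_ : [set x | _] = set0)//; apply/seteqP; split => // x [].
  rewrite (_ : [set x | _] = \bigcap_(i in [set: 'I_n])
      ((fun x : V => x ord0 i) @^-1`
        [set t | (z i)%:~R / m.+1%:R <= t < (z i + 1)%:~R / m.+1%:R])); last first.
    apply/seteqP; split => [x [_ /= gx] i _ /=|x /= gx].
      by rewrite ler_pdivrMr// ltr_pdivlMr// mulrC -floor_eq -gx ffunE.
    split=> //; apply/ffunP => i; rewrite ffunE; apply/eqP; rewrite floor_eq.
    by have := gx i I; rewrite /= ler_pdivrMr// ltr_pdivlMr// mulrC.
  apply: fin_bigcap_measurable; first exact: finite_finset.
  move=> i _; rewrite -[X in measurable X]setTI; apply: measurable_coord => //.
  rewrite (_ : [set t | _] = `[(z i)%:~R / m.+1%:R, (z i + 1)%:~R / m.+1%:R[%classic)//.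
- move=> x _; apply: (@cvg_comp _ _ _ (fun m => approx m (grid m x)) f _ (nbhs x)); last exact: cf.
  apply/cvgrPdist_lt => e e0.
  near=> m; apply: rV_norm_lt => // i.
  rewrite !mxE ffunE.
  have m0 : (0 : R) < m.+1%:R by [].
  set y := x ord0 i.
  have := floor_itv (m.+1%:R * y).
  rewrite intrD => /andP[l1 l2].
  have me : m.+1%:R^-1 < e by near: m; exact: (near_infty_natSinv_lt (PosNum e0)).
  rewrite ger0_norm; last by rewrite subr_ge0 ler_pdivrMr// [leRHS]mulrC.
  apply: le_lt_trans me.
  by rewrite lerBlDr -[X in X + _]mul1r -mulrDl ler_pdivlMr// [leLHS]mulrC addrC ltW.
Unshelve. all: by end_near. Qed.

End rV_continuity.

Section real_schwartz.
Variables (R : realType) (n : nat).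
Local Notation V := 'rV[R]_n.
Local Notation mu := (lebesgue_rV R n).
Local Notation e_ i := (delta_mx ord0 i : V).

Definition partials (s : seq 'I_n) (f : V -> R) : V -> R :=
  foldr (fun i g x => 'D_(e_ i) g x) f s.

(** The Schwartz space of real functions, with the product weight. All the analysis is done on real
    functions, and complex ones are only assembled at the end. *)
Definition rschwartz (f : V -> R) : Prop := forall s,
  [/\ continuous (partials s f),
      forall i x, derivable (partials s f) x (e_ i) &
      forall k, exists C, forall x, pweight x ^+ k * `|partials s f x| <= C].

Lemma partials_cat s t f : partials (s ++ t) f = partials s (partials t f).
Proof. by rewrite /partials foldr_cat. Qed.

Lemma rschwartz_partials s f : rschwartz f -> rschwartz (partials s f).
Proof. by move=> fS t; rewrite -partials_cat; exact: fS. Qed.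

Lemma rschwartz_continuous f : rschwartz f -> continuous f.
Proof. by move=> /(_ [::])[]. Qed.

Lemma rschwartz_measurable f : rschwartz f -> measurable_fun setT f.
Proof. by move=> /rschwartz_continuous/measurable_continuous_rV. Qed.

Lemma rschwartz_derivable f i x : rschwartz f -> derivable f x (e_ i).
Proof. by move=> /(_ [::])[]. Qed.

Lemma rschwartz_decay f k : rschwartz f ->
  exists C, 0 < C /\ forall x, `|f x| <= C / pweight x ^+ k.
Proof.
move=> /(_ [::])[_ _ /(_ k)[C HC]]; exists (`|C| + 1); split.
  by rewrite ltr_pwDr.
move=> x; rewrite ler_pdivlMr ?exprn_gt0 ?pweight_gt0// mulrC (le_trans (HC x))//.
by rewrite (le_trans (ler_norm C))// lerDl.
Qed.

Lemma rschwartz_bounded f : rschwartz f -> exists C, 0 < C /\ forall x, `|f x| <= C.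
Proof.
move=> /(rschwartz_decay 0)[C [C0 HC]]; exists C; split => // x.
by have := HC x; rewrite expr0 divr1.
Qed.

Lemma integrable_pweight_decay (C : R) :
  mu.-integrable setT (EFin \o (fun x => C / pweight x ^+ 2)).
Proof. by apply: integrableZl_fun; exact: integrable_pweightV. Qed.

Lemma rschwartz_integrable f : rschwartz f -> mu.-integrable setT (EFin \o f).
Proof.
move=> fS; have [C [_ HC]] := rschwartz_decay 2 fS.
apply: (integrable_dominated _ HC (integrable_pweight_decay C)).
exact: rschwartz_measurable.
Qed.

Lemma partialsD s f g : rschwartz f -> rschwartz g ->
  partials s (fun x => f x + g x) = (fun x => partials s f x + partials s g x).
Proof.
move=> fS gS; elim: s => //= i s ->; apply/funext => x.
by rewrite deriveD//; [case: (fS s)|case: (gS s)].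
Qed.

Lemma partialsZ s (a : R) f : rschwartz f ->
  partials s (fun x => a * f x) = (fun x => a * partials s f x).
Proof.
move=> fS; elim: s => //= i s ->; apply/funext => x.
by rewrite (@deriveZ _ _ _ (partials s f) a)//; case: (fS s).
Qed.

Lemma rschwartzD f g : rschwartz f -> rschwartz g ->
  rschwartz (fun x => f x + g x).
Proof.
move=> fS gS s; rewrite partialsD//.
have [cf df bf] := fS s; have [cg dg bg] := gS s; split.
- by move=> x; exact: (continuousD (cf x) (cg x)).
- by move=> i x; apply: derivableD.
- move=> k; have [C HC] := bf k; have [D HD] := bg k.
  exists (C + D) => x; apply: le_trans (lerD (HC x) (HD x)).
  by rewrite -mulrDr ler_wpM2l ?ler_normD// exprn_ge0// pweight_ge0.
Qed.

Lemma rschwartzZ (a : R) f : rschwartz f -> rschwartz (fun x => a * f x).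
Proof.
move=> fS s; rewrite partialsZ//.
have [cf df bf] := fS s; split.
- by move=> x; exact: (continuousM (@cst_continuous _ _ a x) (cf x)).
- by move=> i x; apply: (@derivableZ _ _ _ (partials s f) a).
- move=> k; have [C HC] := bf k.
  exists (`|a| * C) => x; rewrite normrM mulrCA.
  exact: ler_wpM2l.
Qed.

Lemma rschwartz_line f i x (h : R) : rschwartz f ->
  is_derive h (1 : R) (fun t : R => f (x + t *: e_ i))
    (partials [:: i] f (x + h *: e_ i)).
Proof. by move=> fS; apply: is_derive_line; exact: rschwartz_derivable. Qed.

Lemma rschwartz_lipschitz f : rschwartz f -> exists L, 0 <= L /\
  forall x y, `|f x - f y| <= L * \sum_i `|x ord0 i - y ord0 i|.
Proof.
move=> fS.
have [L [L0 HL]] : exists L, 0 <= L /\ forall i x, `|partials [:: i] f x| <= L.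
  have := fun i => rschwartz_bounded (rschwartz_partials [:: i] fS).
  move=> /choice[C HC]; exists (\sum_i C i); split.
    by apply: sumr_ge0 => i _; apply: ltW; case: (HC i).
  move=> i x; apply: le_trans ((HC i).2 x) _.
  rewrite (bigD1 i)//= lerDl; apply: sumr_ge0 => j _; apply: ltW; by case: (HC j).
exists L; split => // x y.
(* The coordinates are moved one at a time, each along a line where the mean value theorem
   applies. *)
have key (s : seq 'I_n) (d : 'I_n -> R) z :
    `|f (z + \sum_(i <- s) d i *: e_ i) - f z| <= L * \sum_(i <- s) `|d i|.
  elim: s z => [|i s IH] z.
    by rewrite !big_nil addr0 subrr normr0 mulr0.
  rewrite !big_cons mulrDr.
  set w := z + d i *: e_ i.
  have -> : z + (d i *: e_ i + \sum_(j <- s) d j *: e_ j) =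
      w + \sum_(j <- s) d j *: e_ j by rewrite addrA.
  rewrite -[X in `|X - _|](subrK (f w)) -[X in `|X|]addrA.
  apply: le_trans (ler_normD _ _) _; rewrite [leRHS]addrC; apply: lerD; first exact: IH.
  apply: line_lipschitz => // u; first exact: rschwartz_derivable.
  exact: HL.
have xE : x = y + \sum_i (x ord0 i - y ord0 i) *: e_ i.
  apply/rowP => j; rewrite mxE summxE (bigD1 j)//= !mxE !eqxx mulr1 big1 ?addr0.
    by rewrite addrC subrK.
  by move=> i ij; rewrite !mxE eqxx/= eq_sym (negbTE ij) mulr0.
by have := key (index_enum 'I_n) (fun i => x ord0 i - y ord0 i) y; rewrite -xE.
Qed.

Lemma lipschitz_continuous_rV (f : V -> R) (L : R) :
  (forall x y, `|f x - f y| <= L * \sum_i `|x ord0 i - y ord0 i|) ->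
  continuous f.
Proof.
move=> fL x; apply/(@cvgrPdist_lt _ _ _ (nbhs x)) => e e0.
have M0 : 0 < (`|L| + 1) * (n%:R + 1) by rewrite mulr_gt0 ?ltr_pwDr.
near=> y; apply: le_lt_trans (fL x y) _.
have xy : `|x - y| < e / ((`|L| + 1) * (n%:R + 1)).
  near: y; apply: (@cvgr_dist_lt _ _ _ (nbhs x) _ id x); [exact: cvg_id|exact: divr_gt0].
have S : \sum_i `|x ord0 i - y ord0 i| <= n%:R * `|x - y|.
  rewrite -[X in X%:R](card_ord n) mulr_natl -sumr_const.
  apply: ler_sum => i _; have := rV_coord_le_norm (x - y) i.
  by rewrite !mxE.
rewrite ltr_pdivlMr// in xy; apply: le_lt_trans xy.
have s0 : 0 <= \sum_i `|x ord0 i - y ord0 i| by apply: sumr_ge0.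
apply: (@le_trans _ _ (`|L| * (n%:R * `|x - y|))).
  apply: le_trans (_ : `|L| * \sum_i `|x ord0 i - y ord0 i| <= _).
    by rewrite ler_wpM2r// ler_norm.
  by rewrite ler_wpM2l.
have := normr_ge0 L; have := normr_ge0 (x - y); have : (0 : R) <= n%:R by [].
set a := `|L|; set b := `|x - y|; set m := n%:R => m0 b0 a0.
have : 0 <= a * b by rewrite mulr_ge0.
have : 0 <= m * b by rewrite mulr_ge0.
nra.
Unshelve. all: by end_near. Qed.

End real_schwartz.

Section complex_schwartz.
Variables (R : realType) (n : nat).
Local Notation V := 'rV[R]_n.
Local Open Scope complex_scope.
Implicit Types f : V -> R[i].

Lemma cpartialsE s f x : cpartials s f x =
  partials s (fun y => complex.Re (f y)) x +i*
  partials s (fun y => complex.Im (f y)) x.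
Proof.
elim: s x => [|i s IH] x /=; first by case: (f x).
rewrite /cpartial.
have -> : (fun y => complex.Re (cpartials s f y)) =
    partials s (fun y => complex.Re (f y)) by apply/funext => y; rewrite IH.
by have -> : (fun y => complex.Im (cpartials s f y)) =
    partials s (fun y => complex.Im (f y)) by apply/funext => y; rewrite IH.
Qed.

Lemma normc_Re (z : R[i]) : `|complex.Re z| <= Normc.normc z.
Proof.
case: z => a b /=; rewrite -sqrtr_sqr ler_sqrt ?addr_ge0 ?sqr_ge0//.
by rewrite lerDl sqr_ge0.
Qed.

Lemma normc_Im (z : R[i]) : `|complex.Im z| <= Normc.normc z.
Proof.
case: z => a b /=; rewrite -sqrtr_sqr ler_sqrt ?addr_ge0 ?sqr_ge0//.
by rewrite lerDr sqr_ge0.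
Qed.

Lemma normc_le (a b : R) : Normc.normc (a +i* b) <= `|a| + `|b|.
Proof.
rewrite /= -[leRHS]ger0_norm ?addr_ge0// -sqrtr_sqr ler_wsqrtr//.
rewrite -[a ^+ 2]real_normK ?num_real// -[b ^+ 2]real_normK ?num_real//.
by have := normr_ge0 a; have := normr_ge0 b; nra.
Qed.

(** The two families of weights give the same seminorm conditions, since 1 + |x| <= pweight x <= (1
    + |x|)^n. *)
Lemma schwartz_rschwartz f : schwartz f <->
  rschwartz (fun y => complex.Re (f y)) /\ rschwartz (fun y => complex.Im (f y)).
Proof.
have ReE s : (fun x => complex.Re (cpartials s f x)) = partials s (fun y => complex.Re (f y)).
  by apply/funext => x; rewrite cpartialsE.
have ImE s : (fun x => complex.Im (cpartials s f x)) = partials s (fun y => complex.Im (f y)).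
  by apply/funext => x; rewrite cpartialsE.
have pk (k : nat) (x : V) : pweight x ^+ k <= (1 + enorm x) ^+ (n * k).
  rewrite exprM; apply: lerXn2r; rewrite ?nnegrE ?pweight_ge0//.
    by rewrite exprn_ge0// addr_ge0// sqrtr_ge0.
  exact: pweight_le_enorm.
split=> [[fs fb]|[fr fi]].
  have bd s k : exists C, forall x, pweight x ^+ k * Normc.normc (cpartials s f x) <= C.
    have := fb (n * k)%N s; rewrite /schwartz_seminorm.
    set S := ereal_sup _ => Soo.
    have S1 x : (((1 + enorm x) ^+ (n * k) * Normc.normc (cpartials s f x))%:E <= S)%E.
      by apply: ereal_sup_ubound; exists x.
    exists (fine S) => x; rewrite -lee_fin fineK; last first.
      by rewrite fin_real// Soo andbT (lt_le_trans _ (S1 0))// ltNyr.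
    apply: le_trans (S1 x); rewrite lee_fin ler_wpM2r//.
    exact: le_trans (normr_ge0 _) (normc_Re _).
  split=> s; have [cR cI dRI] := fs s; split.
  - by move: cR; rewrite ReE.
  - by move=> i x; have [+ _] := dRI i x; rewrite ReE.
  - move=> k; have [C HC] := bd s k; exists C => x; apply: le_trans (HC x).
    rewrite cpartialsE; apply: ler_wpM2l; first by rewrite exprn_ge0// pweight_ge0.
    exact: normc_Re (_ +i* _).
  - by move: cI; rewrite ImE.
  - by move=> i x; have [_ +] := dRI i x; rewrite ImE.
  - move=> k; have [C HC] := bd s k; exists C => x; apply: le_trans (HC x).
    rewrite cpartialsE; apply: ler_wpM2l; first by rewrite exprn_ge0// pweight_ge0.
    exact: normc_Im (_ +i* _).
split=> [s|k s].
  have [cR dR _] := fr s; have [cI dI _] := fi s.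
  by split; rewrite ?ReE ?ImE// => i x; rewrite ReE ImE; split.
have [_ _ /(_ k)[C HC]] := fr s; have [_ _ /(_ k)[D HD]] := fi s.
apply: (@le_lt_trans _ _ (C + D)%:E); last exact: ltry.
apply: ge_ereal_sup => _ [x _ <-]; rewrite lee_fin.
rewrite cpartialsE; apply: le_trans (lerD (HC x) (HD x)); rewrite -mulrDr.
apply: ler_pM; rewrite ?exprn_ge0 ?addr_ge0 ?sqrtr_ge0//.
  apply: lerXn2r; rewrite ?nnegrE ?pweight_ge0 ?addr_ge0 ?sqrtr_ge0//.
  exact: enorm_le_pweight.
exact: normc_le.
Qed.

End complex_schwartz.

(** * Averages of translations *)

Section trigonometric_transform.
Variables (R : realType) (n : nat).
Local Notation V := 'rV[R]_n.
Local Notation mu := (lebesgue_rV R n).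

(* The real and imaginary parts of the Fourier integral of a real function are
   recovered as the phases [th = 0] and [th = - pi / 2]. *)
Definition trigt (f : V -> R) (xi : V) (th : R) : R :=
  \int[mu]_x (f x * cos (dotv x xi + th)).

Lemma measurable_trig_fun (xi : V) th :
  measurable_fun setT (fun x : V => cos (dotv x xi + th)).
Proof.
apply: measurable_cos_fun; apply: measurable_funD => //.
exact: measurable_dotv.
Qed.

Lemma integrable_trig (f : V -> R) xi th : mu.-integrable setT (EFin \o f) ->
  mu.-integrable setT (EFin \o (fun x => f x * cos (dotv x xi + th))).
Proof.
move=> fi; have mf : measurable_fun setT f by have /measurable_int/measurable_EFinP := fi.
apply: (integrable_dominated _ _ (integrable_norm fi)).
  by apply: measurable_funM => //; exact: measurable_trig_fun.
by move=> x; rewrite normrM ler_piMr// cos_max.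
Qed.

Lemma trigt_phase (f : V -> R) xi th : mu.-integrable setT (EFin \o f) ->
  trigt f xi th = cos th * trigt f xi 0 - sin th * trigt f xi (- (pi / 2)).
Proof.
move=> fi; rewrite /trigt -!RintegralZl//; try exact: integrable_trig.
rewrite -RintegralB//; try by apply: integrableZl_fun; exact: integrable_trig.
apply: eq_Rintegral => x _; rewrite cosBpihalf addr0 cosD; ring.
Qed.

Lemma trigtD (f g : V -> R) xi th : mu.-integrable setT (EFin \o f) ->
  mu.-integrable setT (EFin \o g) ->
  trigt (fun x => f x + g x) xi th = trigt f xi th + trigt g xi th.
Proof.
move=> fi gi; rewrite /trigt -RintegralD//; try exact: integrable_trig.
by apply: eq_Rintegral => x _; rewrite mulrDl.
Qed.

Lemma trigtZ a (f : V -> R) xi th : mu.-integrable setT (EFin \o f) ->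
  trigt (fun x => a * f x) xi th = a * trigt f xi th.
Proof.
move=> fi; rewrite /trigt -RintegralZl//; last exact: integrable_trig.
by apply: eq_Rintegral => x _; rewrite mulrA.
Qed.

End trigonometric_transform.

Section weighted_translations.
Variables (R : realType) (n : nat).
Local Notation V := 'rV[R]_n.
Local Notation mu := (lebesgue_rV R n).
Variables (d : measure_display) (T : measurableType d).
Variable P : {sigma_finite_measure set T -> \bar R}.
Variables (W : T -> R) (Y : T -> V).
Hypotheses (mW : measurable_fun setT W) (W0 : forall t, 0 <= W t).
Hypothesis mY : measurable_fun setT Y.
Hypothesis Wmom : forall k,
  P.-integrable setT (EFin \o (fun t => W t * pweight (Y t) ^+ k)).

Definition wtrans (f : V -> R) (x : V) : R := \int[P]_t (W t * f (x + Y t)).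

Lemma integrable_weight : P.-integrable setT (EFin \o W).
Proof.
have := Wmom 0; apply: eq_integrable => //= t _.
by rewrite expr0 mulr1.
Qed.

Lemma integrable_weightM (g : T -> R) C : measurable_fun setT g ->
  (forall t, `|g t| <= C) -> P.-integrable setT (EFin \o (fun t => W t * g t)).
Proof.
move=> mg gC; apply: (@integrable_dominated _ _ _ P _ (fun t => C * W t)).
- exact: measurable_funM.
- by move=> t; rewrite normrM ger0_norm// mulrC ler_wpM2r.
- by apply: integrableZl_fun; exact: integrable_weight.
Qed.

Lemma measurable_shiftY x : measurable_fun setT (fun t => x + Y t).
Proof. exact: measurable_rVD. Qed.

Lemma integrable_wtrans (f : V -> R) (C : R) (x : V) : measurable_fun setT f ->
  (forall y, `|f y| <= C) -> P.-integrable setT (EFin \o (fun t => W t * f (x + Y t))).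
Proof.
move=> mf fC; apply: (integrable_weightM (C := C)) => //.
by apply: (measurableT_comp mf); exact: measurable_shiftY.
Qed.

Lemma wtrans_derive (f : V -> R) i x : rschwartz f ->
  is_derive x (delta_mx ord0 i : V) (wtrans f) (wtrans (partials [:: i] f) x).
Proof.
move=> fS; have f'S := rschwartz_partials [:: i] fS.
have [C [C0 fC]] := rschwartz_bounded fS.
have [D [D0 f'D]] := rschwartz_bounded f'S.
apply: is_derive_of_line.
have -> : wtrans (partials [:: i] f) x = \int[P]_t
    (W t * partials [:: i] f (x + Y t + 0 *: (delta_mx ord0 i : V))).
  by apply: eq_Rintegral => t _; rewrite scale0r addr0.
have -> : (fun h : R => wtrans f (x + h *: (delta_mx ord0 i : V))) =
    (fun h : R => \int[P]_t (W t * f (x + Y t + h *: (delta_mx ord0 i : V)))).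
  by apply/funext => h; apply: eq_Rintegral => t _; rewrite addrAC.
apply: (@is_derive_Rintegral _ _ _ P
  (fun h t => W t * f (x + Y t + h *: (delta_mx ord0 i : V)))
  (fun h t => W t * partials [:: i] f (x + Y t + h *: (delta_mx ord0 i : V)))
  (fun t => D * W t)).
- move=> h; apply: (integrable_weightM (C := C)) => //.
  apply: (measurableT_comp (rschwartz_measurable fS)).
  by apply: measurable_rVD => //; exact: measurable_shiftY.
- move=> h t; apply: (@is_derive1_eq _ _ _ (0 * f (x + Y t + h *: (delta_mx ord0 i : V)) +
    W t * partials [:: i] f (x + Y t + h *: (delta_mx ord0 i : V)))); last first.
    by rewrite mul0r add0r.
  exact: (is_derive1_mulfun (is_derive1_cst _ _) (rschwartz_line _ _ _ fS)).
- by move=> h t _; rewrite normrM ger0_norm// mulrC ler_wpM2r.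
- by apply: integrableZl_fun; exact: integrable_weight.
Qed.

Lemma partials_wtrans s (f : V -> R) : rschwartz f ->
  partials s (wtrans f) = wtrans (partials s f).
Proof.
move=> fS; elim: s => //= i s ->; apply/funext => x.
by have [_ ->] := wtrans_derive i x (rschwartz_partials s fS).
Qed.

(** Derivatives commute with the average, so it suffices to bound [wtrans f] itself. Continuity
    comes from the Lipschitz bound on f. Decay comes from pweight x <= pweight (Y t) * pweight (x +
    Y t): the first factor is absorbed by the moments of Y, the second by the decay of f. *)
Lemma rschwartz_wtrans (f : V -> R) : rschwartz f -> rschwartz (wtrans f).
Proof.
move=> fS s; rewrite partials_wtrans//; have {fS} := rschwartz_partials s fS.
move: (partials s f) => {}f fS.
have mf := rschwartz_measurable fS.
have [C [C0 fC]] := rschwartz_bounded fS.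
split.
- have [L [L0 fL]] := rschwartz_lipschitz fS.
  apply: (@lipschitz_continuous_rV _ _ _ (L * \int[P]_t W t)) => x y.
  rewrite -RintegralB//; try exact: (integrable_wtrans _ mf fC).
  rewrite mulrAC -RintegralZl//; last exact: integrable_weight.
  apply: normr_Rintegral_le.
  + apply: measurable_funB; apply: measurable_funM => //;
      apply: (measurableT_comp mf); exact: measurable_shiftY.
  + move=> t; rewrite -mulrBr normrM ger0_norm// [leRHS]mulrC ler_wpM2l//.
    apply: le_trans (fL _ _) _; apply: ler_wpM2l => //.
    by apply: ler_sum => i _; rewrite !mxE opprD addrACA subrr addr0.
  + by apply: integrableZl_fun; exact: integrable_weight.
- by move=> i x; have [] := wtrans_derive i x fS.
- move=> k; have [D [D0 fD]] := rschwartz_decay k fS.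
  exists (D * \int[P]_t (W t * pweight (Y t) ^+ k)) => x.
  have pk y : 0 < pweight (y : V) ^+ k by rewrite exprn_gt0// pweight_gt0.
  rewrite -[pweight x ^+ k]ger0_norm ?(ltW (pk x))// -normrM -RintegralZl//; last first.
    exact: (integrable_wtrans _ mf fC).
  rewrite -RintegralZl//; apply: normr_Rintegral_le.
  + apply: measurable_funM => //; apply: measurable_funM => //.
    by apply: (measurableT_comp mf); exact: measurable_shiftY.
  + move=> t; rewrite !normrM (ger0_norm (ltW (pk x))) (ger0_norm (W0 t)).
    rewrite mulrCA [leRHS]mulrCA ler_wpM2l//.
    apply: le_trans (ler_wpM2l (ltW (pk x)) (fD _)) _.
    have pxY : pweight x ^+ k <= pweight (Y t) ^+ k * pweight (x + Y t) ^+ k.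
      rewrite -exprMn; apply: lerXn2r; rewrite ?nnegrE ?mulr_ge0 ?pweight_ge0//.
      rewrite -{1}[x](addrK (Y t)) mulrC -[in X in _ * X](pweightN (Y t)).
      exact: pweightD.
    by rewrite mulrA ler_pdivrMr// mulrC -mulrA ler_wpM2l// ltW.
  + by apply: integrableZl_fun; exact: Wmom.
Qed.

(** For Fubini's theorem: after removal of W, the dominating function may depend on t as long as its
    integrals in x are bounded uniformly, which translation invariance provides. *)
Lemma integrable_prod_unif (f : V * T -> R) (k : V * T -> R) (D : R) :
  measurable_fun setT f -> measurable_fun setT k ->
  (forall z, `|f z| <= W z.2 * k z) -> (forall z, 0 <= k z) ->
  (forall t, \int[mu]_x (k (x, t))%:E <= D%:E)%E ->
  (mu \x P)%E.-integrable setT (EFin \o f).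
Proof.
move=> mf mk fk k0 kD; apply/integrable21ltyP; first exact/measurable_EFinP.
have Di : (\int[P]_t (W t * D)%:E < +oo)%E.
  under eq_integral do rewrite mulrC EFinM.
  rewrite integralZl//; last exact: integrable_weight.
  by rewrite -EFin_Rintegral ?integrable_weight// ltry.
have D0 (t : T) : 0 <= D 
  by rewrite -lee_fin (le_trans _ (kD t))// integral_ge0// => x _; rewrite lee_fin.
apply: le_lt_trans Di; apply: ge0_le_integral => //.
- by move=> t _; apply: integral_ge0.
- apply: (measurable_fun_fubini_tonelli_G (abse \o (EFin \o f))) => //=.
  by apply: measurableT_comp => //; exact/measurable_EFinP.
- by apply/measurable_EFinP; exact: measurable_funM.
- move=> t _; rewrite EFinM; apply: le_trans (lee_wpmul2l _ (kD t)); last by rewrite lee_fin.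
  rewrite -ge0_integralZl//.
  + apply: ge0_le_integral => //.
    * apply: measurableT_comp => //; apply/measurable_EFinP.
      exact: (measurableT_comp mf).
    * apply/measurable_EFinP; apply: measurable_funM => //.
      exact: (measurableT_comp mk).
    * by move=> x _; rewrite /= lee_fin (le_trans (fk _)).
  + by apply/measurable_EFinP; exact: (measurableT_comp mk).
  + by move=> x _; rewrite lee_fin.
  + by rewrite lee_fin.
Qed.

Lemma measurable_shift2 (f : V -> R) : measurable_fun setT f ->
  measurable_fun setT (fun z : V * T => f (z.1 + Y z.2)).
Proof.
move=> mf; apply: (measurableT_comp mf); apply: measurable_rVD => //.
exact: measurableT_comp.
Qed.

(** After Fubini, the translation by Y t becomes a shift of the phase by - Y t . xi. Asking for the
    cosine averages of Y at every phase encodes both the value of the symbol and, at th = - pi / 2,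
    the vanishing of the sine averages. *)
Lemma trigt_wtrans (m : V -> R) (f : V -> R) xi th :
  (forall xi th, \int[P]_t (W t * cos (dotv (Y t) xi + th)) = m xi * cos th) ->
  rschwartz f -> trigt (wtrans f) xi th = m xi * trigt f xi th.
Proof.
move=> Wm fS; have mf := rschwartz_measurable fS.
have fi := rschwartz_integrable fS.
have [C [C0 fC]] := rschwartz_bounded fS.
have Ki : (mu \x P)%E.-integrable setT (EFin \o
    (fun z : V * T => W z.2 * (f (z.1 + Y z.2) * cos (dotv z.1 xi + th)))).
  apply: (@integrable_prod_unif _ (fun z => `|f (z.1 + Y z.2)|) (\int[mu]_x `|f x|)).
  - apply: measurable_funM; first exact: measurableT_comp.
    apply: measurable_funM; first exact: measurable_shift2.
    apply: measurable_cos_fun; apply: measurable_funD => //.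
    exact: measurable_dotv.
  - by apply: measurableT_comp => //; exact: measurable_shift2.
  - move=> z; rewrite normrM ger0_norm// ler_wpM2l// normrM.
    by rewrite ler_piMr// cos_max.
  - by move=> z.
  - move=> t /=; rewrite (ge0_integral_rV_shift (Y t) (f := fun x => (`|f x|)%:E))//.
      by rewrite EFin_Rintegral//; exact: integrable_norm.
    by apply/measurable_EFinP; exact: measurableT_comp.
transitivity (\int[mu]_x \int[P]_t
    (W t * (f (x + Y t) * cos (dotv x xi + th)))).
  apply: eq_Rintegral => x _; rewrite /wtrans -RintegralZr//.
    by apply: eq_Rintegral => t _; rewrite mulrA.
  exact: (integrable_wtrans _ mf fC).
rewrite (Rfubini Ki)/=.
transitivity (\int[P]_t (W t * trigt f xi (- dotv (Y t) xi + th))).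
  apply: eq_Rintegral => t _.
  rewrite -[RHS]RintegralZl//; last exact: integrable_trig.
  rewrite -[RHS](Rintegral_rV_shift (Y t)).
    by apply: eq_Rintegral => x _; rewrite dotvDl addrA addrK.
  apply: measurable_funM => //; apply: measurable_funM => //.
  exact: measurable_trig_fun.
have mc th' : measurable_fun setT (fun t => cos (dotv (Y t) xi + th')).
  by apply: measurable_cos_fun; apply: measurable_funD => //; exact: measurable_dotv.
have ic th' : P.-integrable setT (EFin \o (fun t => W t * cos (dotv (Y t) xi + th'))).
  by apply: (integrable_weightM (C := 1)) => // t; exact: cos_max.
(* The shifted phase is expanded into the phases 0 and - pi / 2, so that t appears only in cosines
   of Y t . xi with constant phases, as in [Wm]. *)
transitivity (\int[P]_t (trigt f xi 0 * (W t * cos (dotv (Y t) xi - th)) +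
    trigt f xi (- (pi / 2)) * (W t * cos (dotv (Y t) xi + (- th - pi / 2))))).
  apply: eq_Rintegral => t _; rewrite (trigt_phase xi (- _ + th) fi).
  rewrite addrA cosBpihalf -cosN -[sin (- _ + _)]opprK -sinN !opprD !opprK; ring.
rewrite RintegralD//; [|exact: integrableZl_fun|exact: integrableZl_fun].
rewrite !RintegralZl// !Wm cosBpihalf sinN cosN (trigt_phase xi th fi); ring.
Qed.

End weighted_translations.

(** * Averages of translations on L^q and their transposes *)

Section weighted_translations_Lq.
Variables (R : realType) (n : nat).
Local Notation V := 'rV[R]_n.
Local Notation mu := (lebesgue_rV R n).
Variables (d : measure_display) (T : measurableType d).
Variable P : {sigma_finite_measure set T -> \bar R}.
Variables (W : T -> R) (Y : T -> V).
Hypotheses (mW : measurable_fun setT W) (W0 : forall t, 0 <= W t).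
Hypothesis mY : measurable_fun setT Y.
Hypothesis Wi : P.-integrable setT (EFin \o W).
Variable q : R.
Hypothesis q1 : 1 < q.

Let q0 : 0 < q. Proof. exact: lt_trans q1. Qed.
Let qN0 : q != 0. Proof. by rewrite gt_eqF. Qed.

Lemma measurable_powR_abs d' (T' : measurableType d') (h : T' -> R) (r : R) :
  measurable_fun setT h -> measurable_fun setT (fun x => `|h x| `^ r).
Proof.
move=> mh; apply: (@measurableT_comp _ _ _ _ _ _ (fun y : R => y `^ r)).
  exact: measurable_powR.
exact: measurableT_comp.
Qed.

Lemma Lnorm_lty (h : V -> R) :
  (Lnorm mu q%:E (EFin \o h) < +oo)%E ->
  (\int[mu]_x (`|h x| `^ q)%:E < +oo)%E.
Proof.
move=> hoo; have := poweR_lty q hoo.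
by rewrite poweR_Lnorm.
Qed.

Lemma measurable_wtrans (h : V -> R) : measurable_fun setT h ->
  measurable_fun setT (wtrans P W Y h).
Proof.
move=> mh; apply: (@measurable_Rintegral2 _ _ _ _ _ P
  (fun z : V * T => W z.2 * h (z.1 + Y z.2))).
apply: measurable_funM; first exact: measurableT_comp.
exact: (measurable_shift2 mY mh).
Qed.

(** Hoelder's inequality for the splitting W = W^(1/p) W^(1/q) with p the conjugate exponent of q;
    the first factor contributes the total mass to the power q / p = q - 1. *)
Lemma wtrans_powR_le (h : V -> R) x : measurable_fun setT h ->
  ((`|wtrans P W Y h x| `^ q)%:E <=
   ((\int[P]_t W t) `^ (q - 1))%:E *
   \int[P]_t (W t * `|h (x + Y t)| `^ q)%:E)%E.
Proof.
move=> mh; pose B := \int[P]_t W t.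
have B0 : 0 <= B by apply: Rintegral_ge0.
pose p := q / (q - 1).
have q10 : 0 < q - 1 by rewrite subr_gt0.
have p0 : 0 < p by rewrite divr_gt0.
have pq : p^-1 + q^-1 = 1 by rewrite /p; field; rewrite qN0 gt_eqF.
have mhY : measurable_fun setT (fun t => h (x + Y t)).
  by apply: (measurableT_comp mh); exact: measurable_rVD.
pose f1 t := W t `^ p^-1.
pose f2 t := W t `^ q^-1 * `|h (x + Y t)|.
have f1E t : `|f1 t| `^ p = W t.
  by rewrite ger0_norm ?powR_ge0// /f1 -powRrM mulVf ?powRr1// gt_eqF.
have f2E t : `|f2 t| `^ q = W t * `|h (x + Y t)| `^ q.
  rewrite ger0_norm ?mulr_ge0 ?powR_ge0// powRM ?powR_ge0//.
  by rewrite -powRrM mulVf// powRr1.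
have f12 t : f1 t * f2 t = W t * `|h (x + Y t)|.
  rewrite /f1 /f2 mulrA -powRD ?pq ?powRr1//.
  by rewrite oner_eq0.
have mpow (r : R) : measurable_fun setT (fun t => W t `^ r).
  by apply: (@measurableT_comp _ _ _ _ _ _ (fun y : R => y `^ r)).
have mf1 : measurable_fun setT f1 by exact: mpow.
have mf2 : measurable_fun setT f2.
  by apply: measurable_funM; [exact: mpow|exact: measurableT_comp].
have HJ := hoelder P mf1 mf2 p0 q0 pq.
rewrite Lnorm1 in HJ.
pose J := (\int[P]_t `|(EFin \o (f1 \* f2)%R) t|)%E; rewrite -/J in HJ.
have gJ : (`|wtrans P W Y h x|%:E <= J)%E.
  have aJ : (`| \int[P]_t (W t * h (x + Y t))%:E | <= J)%E.
    apply: le_trans (le_abse_integral _ _ _) _ => //.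
      by apply/measurable_EFinP; exact: measurable_funM.
    rewrite /J le_eqVlt; apply/orP; left; apply/eqP; apply: eq_integral => t _ /=.
    by rewrite f12 !normrM normr_id.
  (* If the integral is infinite, [fine] gives 0 and the bound is trivial; so h may be any
     measurable function. *)
  apply: le_trans aJ; rewrite /wtrans /Rintegral.
  by case: (\int[P]_t _)%E => [r| |]//=; rewrite normr0 leey.
have N1 : (Lnorm P p%:E (EFin \o f1) `^ q = (B `^ (q - 1))%:E)%E.
  have pE : q = p * (q - 1) by rewrite /p divfK// gt_eqF.
  rewrite pE poweRrM poweR_Lnorm ?gt_eqF//.
  under eq_integral do rewrite /= f1E.
  rewrite -EFin_Rintegral// poweR_EFin -pE.
  by [].
have N2 : (Lnorm P q%:E (EFin \o f2) `^ q = \int[P]_t (W t * `|h (x + Y t)| `^ q)%:E)%E.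
  by rewrite poweR_Lnorm//; apply: eq_integral => t _ /=; rewrite f2E.
rewrite -N1 -N2 -poweRM ?Lnorm_ge0// -poweR_EFin.
apply: gt0_ler_poweR; rewrite ?(ltW q0)//.
  by rewrite in_itv/= leey andbT.
  by rewrite in_itv/= leey andbT mule_ge0// Lnorm_ge0.
exact: le_trans gJ HJ.
Qed.

(** The pointwise Hoelder bound is integrated in x. By Tonelli and translation invariance the
    integral in t yields one more factor B, and B^(q-1) B = B^q. *)
Lemma Lnorm_wtrans (h : V -> R) : measurable_fun setT h ->
  (Lnorm mu q%:E (EFin \o wtrans P W Y h) <=
   (\int[P]_t W t)%:E * Lnorm mu q%:E (EFin \o h))%E.
Proof.
move=> mh; pose B := \int[P]_t W t; rewrite -/B.
have B0 : 0 <= B by apply: Rintegral_ge0.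
have mhq := measurable_powR_abs q mh.
have I1 : (\int[mu]_x (`|wtrans P W Y h x| `^ q)%:E <=
    (B `^ q)%:E * \int[mu]_x (`|h x| `^ q)%:E)%E.
  have mK : measurable_fun setT (fun z : V * T => (W z.2 * `|h (z.1 + Y z.2)| `^ q)%:E).
    apply/measurable_EFinP; apply: measurable_funM; first exact: measurableT_comp.
    exact: (measurable_shift2 mY mhq).
  apply: (@le_trans _ _ (\int[mu]_x ((B `^ (q - 1))%:E *
      \int[P]_t (W t * `|h (x + Y t)| `^ q)%:E))%E).
    apply: ge0_le_integral => //.
    - by apply/measurable_EFinP; apply: measurable_powR_abs; exact: measurable_wtrans.
    - apply: emeasurable_funM => //.
      apply: (measurable_fun_fubini_tonelli_F
        (fun z : V * T => (W z.2 * `|h (z.1 + Y z.2)| `^ q)%:E)) => //.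
      by move=> z; rewrite lee_fin mulr_ge0// powR_ge0.
    - by move=> x _; exact: wtrans_powR_le.
  rewrite ge0_integralZl//; last 3 first.
  - apply: (measurable_fun_fubini_tonelli_F
      (fun z : V * T => (W z.2 * `|h (z.1 + Y z.2)| `^ q)%:E)) => //.
    by move=> z; rewrite lee_fin mulr_ge0// powR_ge0.
  - by move=> x _; apply: integral_ge0 => t _; rewrite lee_fin mulr_ge0// powR_ge0.
  - by rewrite lee_fin powR_ge0.
  rewrite (@fubini_tonelli _ _ _ _ _ mu P
    (fun z : V * T => (W z.2 * `|h (z.1 + Y z.2)| `^ q)%:E))//; last first.
    by move=> z; rewrite lee_fin mulr_ge0// powR_ge0.
  rewrite /=; under eq_integral => t _.
    under eq_integral do rewrite EFinM.
    rewrite ge0_integralZl//; last 2 first.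
    - apply/measurable_EFinP; apply: (measurableT_comp mhq).
      exact: measurable_rVD.
    - by rewrite lee_fin.
    rewrite (ge0_integral_rV_shift (Y t) (f := fun x => (`|h x| `^ q)%:E)); last 2 first.
    - exact/measurable_EFinP.
    - by move=> x; rewrite lee_fin powR_ge0.
    over.
  rewrite ge0_integralZr//; last 3 first.
  - exact/measurable_EFinP.
  - by move=> t _; rewrite lee_fin.
  - by apply: integral_ge0 => x _; rewrite lee_fin powR_ge0.
  rewrite -EFin_Rintegral// -/B muleA -EFinM.
  by rewrite mulrC mulr_powRB1.
rewrite unlock.
have -> : (\int[mu]_x `|(EFin \o wtrans P W Y h) x| `^ q =
    \int[mu]_x (`|wtrans P W Y h x| `^ q)%:E)%E by [].
have -> : (\int[mu]_x `|(EFin \o h) x| `^ q = \int[mu]_x (`|h x| `^ q)%:E)%E by [].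
have I0 (g : V -> R) : (0 <= \int[mu]_x (`|g x| `^ q)%:E)%E.
  by apply: integral_ge0 => x _; rewrite lee_fin powR_ge0.
have := I0 h; have := I0 (wtrans P W Y h) => I2 I3.
apply: (@le_trans _ _ (((B `^ q)%:E * \int[mu]_x (`|h x| `^ q)%:E) `^ q^-1)%E).
  apply: gt0_ler_poweR; rewrite ?invr_ge0 ?(ltW q0)//.
    by rewrite in_itv/= leey andbT; exact: I2.
  rewrite in_itv/= leey andbT; apply: mule_ge0; last exact: I3.
  by rewrite lee_fin powR_ge0.
rewrite poweRM ?lee_fin ?powR_ge0//.
by rewrite poweR_EFin -powRrM divff// powRr1.
Qed.

End weighted_translations_Lq.

Section weighted_translations_duality.
Variables (R : realType) (n : nat).
Local Notation V := 'rV[R]_n.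
Local Notation mu := (lebesgue_rV R n).
Variables (d : measure_display) (T : measurableType d).
Variable P : {sigma_finite_measure set T -> \bar R}.
Variables (W : T -> R) (Y : T -> V).
Hypotheses (mW : measurable_fun setT W) (W0 : forall t, 0 <= W t).
Hypothesis mY : measurable_fun setT Y.
Hypothesis Wmom : forall k,
  P.-integrable setT (EFin \o (fun t => W t * pweight (Y t) ^+ k)).
Variable q : R.
Hypothesis q1 : 1 < q.

(** Gives |h phi| <= |phi| + C |h|^q when |phi| <= C, so that pairings of L^q with Schwartz
    functions converge without recourse to the conjugate exponent. *)
Lemma le_1DpowR (u : R) : 0 <= u -> u <= 1 + u `^ q.
Proof.
move=> u0; have [u1|u1] := leP u 1; first by rewrite (le_trans u1)// lerDl powR_ge0.
by rewrite (le_trans (le1r_powR (ltW u1) (ltW q1)))// lerDr.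
Qed.

Lemma integrable_Lq_schwartz (h phi : V -> R) : measurable_fun setT h ->
  (\int[mu]_x (`|h x| `^ q)%:E < +oo)%E -> rschwartz phi ->
  mu.-integrable setT (EFin \o (fun x => h x * phi x)).
Proof.
move=> mh hoo pS; have [C [C0 pC]] := rschwartz_bounded pS.
have mp := rschwartz_measurable pS.
apply: (@integrable_dominated _ _ _ mu _ (fun x => `|phi x| + C * `|h x| `^ q)).
- exact: measurable_funM.
- move=> x; rewrite normrM; apply: le_trans (ler_wpM2r _ (le_1DpowR _)) _ => //.
  by rewrite mulrDl mul1r lerD2l mulrC ler_wpM2r// powR_ge0.
- apply: integrableD_fun; first exact/integrable_norm/rschwartz_integrable.
  apply: integrableZl_fun; apply: integrable_ge0P => //.
    exact: measurable_powR_abs.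
Qed.

(** Transposing an average of translations reverses the translations: Fubini, then the substitution
    of x + Y t for x, then Fubini again. *)
Lemma Rintegral_wtrans_dual (h phi : V -> R) : measurable_fun setT h ->
  (\int[mu]_x (`|h x| `^ q)%:E < +oo)%E -> rschwartz phi ->
  \int[mu]_x (wtrans P W (fun t => - Y t) h x * phi x) = \int[mu]_x (h x * wtrans P W Y phi x).
Proof.
move=> mh hoo pS; have [C [C0 pC]] := rschwartz_bounded pS.
have mp := rschwartz_measurable pS; have pi := rschwartz_integrable pS.
have mhq := measurable_powR_abs q mh.
have mNY : measurable_fun setT (fun t => - Y t) by exact: measurable_rVN.
have hqi : mu.-integrable setT (EFin \o (fun x => `|h x| `^ q)).
  by apply: integrable_ge0P => // x; exact: powR_ge0.
(* By translation invariance D is, for every t, the integral in x of the dominating function,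
   whichever of h and phi is translated. *)
pose D := \int[mu]_x (`|phi x|) + C * \int[mu]_x (`|h x| `^ q).
have DE : D%:E = (\int[mu]_x (`|phi x|%:E) + \int[mu]_x (C * `|h x| `^ q)%:E)%E.
  rewrite /D EFinD EFin_Rintegral; last exact: integrable_norm.
  by rewrite -RintegralZl// EFin_Rintegral//; exact: integrableZl_fun.
have fst_m : measurable_fun setT (fun z : V * T => h z.1) by exact: measurableT_comp.
have K1 : (mu \x P)%E.-integrable setT (EFin \o
    (fun z : V * T => W z.2 * (h (z.1 - Y z.2) * phi z.1))).
  apply: (@integrable_prod_unif _ _ _ _ P W Y mW W0 Wmom _
    (fun z => `|phi z.1| + C * `|h (z.1 - Y z.2)| `^ q) D).
  - apply: measurable_funM; first exact: measurableT_comp.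
    apply: measurable_funM; first exact: (measurable_shift2 mNY mh).
    exact: measurableT_comp.
  - apply: measurable_funD; first by do 2 apply: measurableT_comp => //.
    apply: measurable_funM => //; exact: (measurable_shift2 mNY mhq).
  - move=> z; rewrite normrM ger0_norm// ler_wpM2l// normrM.
    apply: le_trans (ler_wpM2r _ (le_1DpowR _)) _ => //.
    by rewrite mulrDl mul1r lerD2l mulrC ler_wpM2r// powR_ge0.
  - by move=> z; rewrite addr_ge0// mulr_ge0 ?powR_ge0// ltW.
  - move=> t; rewrite DE.
    rewrite -(ge0_integral_rV_shift (- Y t) (f := fun x => (C * `|h x| `^ q)%:E)); last 2 first.
    + by apply/measurable_EFinP; exact: measurable_funM.
    + by move=> x; rewrite lee_fin mulr_ge0 ?powR_ge0// ltW.
    rewrite -ge0_integralD//.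
    + by apply/measurable_EFinP; exact: measurableT_comp.
    + by move=> x _; rewrite lee_fin mulr_ge0 ?powR_ge0// ltW.
    + apply/measurable_EFinP; apply: measurable_funM => //.
      by apply: (measurableT_comp mhq); exact: measurable_rVD.
have K2 : (mu \x P)%E.-integrable setT (EFin \o
    (fun z : V * T => W z.2 * (h z.1 * phi (z.1 + Y z.2)))).
  apply: (@integrable_prod_unif _ _ _ _ P W Y mW W0 Wmom _
    (fun z => `|phi (z.1 + Y z.2)| + C * `|h z.1| `^ q) D).
  - apply: measurable_funM; first exact: measurableT_comp.
    apply: measurable_funM => //; exact: (measurable_shift2 mY mp).
  - apply: measurable_funD.
      by apply: measurableT_comp => //; exact: (measurable_shift2 mY mp).
    apply: measurable_funM => //; exact: (measurable_powR_abs q fst_m).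
  - move=> z; rewrite normrM ger0_norm// ler_wpM2l// normrM.
    apply: le_trans (ler_wpM2r _ (le_1DpowR _)) _ => //.
    by rewrite mulrDl mul1r lerD2l mulrC ler_wpM2r// powR_ge0.
  - by move=> z; rewrite addr_ge0// mulr_ge0 ?powR_ge0// ltW.
  - move=> t; rewrite DE.
    rewrite -(ge0_integral_rV_shift (Y t) (f := fun x => (`|phi x|)%:E))//; last first.
      by apply/measurable_EFinP; exact: measurableT_comp.
    rewrite -ge0_integralD//.
    + apply/measurable_EFinP; apply: measurableT_comp => //.
      by apply: (measurableT_comp mp); exact: measurable_rVD.
    + by move=> x _; rewrite lee_fin mulr_ge0 ?powR_ge0// ltW.
    + by apply/measurable_EFinP; exact: measurable_funM.
transitivity (\int[mu]_x \int[P]_t (W t * (h (x - Y t) * phi x))).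
  have mg : measurable_fun setT (wtrans P W (fun t => - Y t) h) by exact: measurable_wtrans.
  rewrite /Rintegral; congr fine; apply: ae_eq_integral => //.
  - by apply/measurable_EFinP; exact: measurable_funM.
  - apply/measurable_EFinP.
    by have /measurable_int/measurable_EFinP/(@measurable_Rintegral2 _ _ _ _ _ P) := K1.
  (* For almost every x, what is known to be integrable in t is the product with phi x. Where phi x
     = 0 both sides vanish, and elsewhere one divides by phi x. *)
  - have := ae_integrable1 K1; apply: filterS => x /= Kx _; congr EFin.
    have [->|px0] := eqVneq (phi x) 0.
      rewrite mulr0; under eq_integral do rewrite mulr0 mulr0.
      by rewrite integral0.
    rewrite /wtrans -RintegralZr//.
      by apply: eq_Rintegral => t _; rewrite mulrA.
    have := integrableZl_fun (phi x)^-1 Kx; apply: eq_integrable => //= t _.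
    by congr EFin; field.
rewrite (Rfubini K1)/=.
transitivity (\int[P]_t \int[mu]_x (W t * (h x * phi (x + Y t)))).
  apply: eq_Rintegral => t _.
  rewrite -[RHS](Rintegral_rV_shift (- Y t)).
    by apply: eq_Rintegral => x _; rewrite subrK.
  apply: measurable_funM => //; apply: measurable_funM => //.
  by apply: (measurableT_comp mp); exact: measurable_rVD.
rewrite -(Rfubini K2)/=; apply: eq_Rintegral => x _.
rewrite /wtrans -RintegralZl//; last exact: (integrable_wtrans mW W0 mY Wmom _ mp pC).
by apply: eq_Rintegral => t _; rewrite mulrCA.
Qed.

End weighted_translations_duality.

(** * The calculus of bounded symbols, and Gaussian mixtures *)

Section bounded_multipliers.
Variables (R : realType) (n : nat).
Local Notation V := 'rV[R]_n.
Local Notation mu := (lebesgue_rV R n).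

Definition in_rLq (q : R) (h : V -> R) : Prop :=
  measurable_fun setT h /\ (Lnorm mu q%:E (EFin \o h) < +oo)%E.

(* An operator on Schwartz functions with real symbol m, together with its
   transpose on L^q, of norm at most B for every q at once. *)
Definition bounded_symbol (m : V -> R) (B : R) : Prop :=
  0 <= B /\ exists U : (V -> R) -> (V -> R),
  (forall phi, rschwartz phi -> rschwartz (U phi) /\
    forall xi th, trigt (U phi) xi th = m xi * trigt phi xi th) /\
  (forall q, 1 < q -> forall h, in_rLq q h -> exists g,
    [/\ in_rLq q g,
        (Lnorm mu q%:E (EFin \o g) <= B%:E * Lnorm mu q%:E (EFin \o h))%E &
        forall phi, rschwartz phi ->
          \int[mu]_x (g x * phi x) = \int[mu]_x (h x * U phi x)]).

Lemma in_rLq_le (q B : R) (g h : V -> R) : measurable_fun setT g ->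
  (Lnorm mu q%:E (EFin \o h) < +oo)%E ->
  (Lnorm mu q%:E (EFin \o g) <= B%:E * Lnorm mu q%:E (EFin \o h))%E ->
  0 <= B -> in_rLq q g.
Proof.
move=> mg hoo gh B0; split => //; apply: le_lt_trans gh _.
rewrite lte_mul_pinfty// ge0_fin_numE ?Lnorm_ge0//.
Qed.

Lemma bounded_symbol1 : bounded_symbol (fun=> 1) 1.
Proof.
split=> //; exists id; split=> [phi pS|q q1 h hq].
  by split => // xi th; rewrite mul1r.
by exists h; split => //; rewrite mul1e.
Qed.

Lemma Lnorm_scale (q a : R) (g : V -> R) : 0 < q -> measurable_fun setT g ->
  (Lnorm mu q%:E (EFin \o (fun x => (a * g x)%R)) =
   `|a|%:E * Lnorm mu q%:E (EFin \o g))%E.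
Proof.
move=> q0 mg; rewrite unlock.
have E : (\int[mu]_x `|(EFin \o (fun x => (a * g x)%R)) x| `^ q =
    (`|a| `^ q)%:E * \int[mu]_x `|(EFin \o g) x| `^ q)%E.
  rewrite -ge0_integralZl//.
  - by apply: eq_integral => x _ /=; rewrite normrM powRM// EFinM.
  - apply: (@measurableT_comp _ _ _ _ _ _ EFin) => //.
    exact: measurable_powR_abs.
  - by move=> x _; exact: poweR_ge0.
rewrite E poweRM ?lee_fin ?powR_ge0//.
  by rewrite poweR_EFin -powRrM divff ?gt_eqF// powRr1.
by apply: integral_ge0 => x _; exact: poweR_ge0.
Qed.

Lemma in_rLq_schwartz_integrable (q : R) (h phi : V -> R) : 1 < q -> in_rLq q h ->
  rschwartz phi -> mu.-integrable setT (EFin \o (fun x => h x * phi x)).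
Proof.
move=> q1 [mh hoo] pS; apply: (integrable_Lq_schwartz q1) => //.
exact: Lnorm_lty.
Qed.

Lemma bounded_symbol_lin (a1 a2 B1 B2 : R) (m1 m2 : V -> R) :
  bounded_symbol m1 B1 -> bounded_symbol m2 B2 ->
  bounded_symbol (fun xi => a1 * m1 xi + a2 * m2 xi) (`|a1| * B1 + `|a2| * B2).
Proof.
move=> [B10 [U1 [U1S U1q]]] [B20 [U2 [U2S U2q]]].
have B0 : 0 <= `|a1| * B1 + `|a2| * B2 by rewrite addr_ge0// mulr_ge0.
split=> //; exists (fun phi x => a1 * U1 phi x + a2 * U2 phi x).
split=> [phi pS|q q1 h hq].
  have [S1 T1] := U1S phi pS; have [S2 T2] := U2S phi pS; split.
    by apply: rschwartzD; exact: rschwartzZ.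
  move=> xi th; rewrite trigtD; try by apply: rschwartz_integrable; exact: rschwartzZ.
  rewrite !trigtZ; try exact: rschwartz_integrable.
  by rewrite T1 T2; ring.
have q0 : 0 < q by rewrite (lt_trans _ q1).
have [g1 [g1q g1N g1E]] := U1q q q1 h hq.
have [g2 [g2q g2N g2E]] := U2q q q1 h hq.
have mg1 := g1q.1; have mg2 := g2q.1.
have ma1 : measurable_fun setT (fun x => a1 * g1 x) by exact: measurable_funM.
have ma2 : measurable_fun setT (fun x => a2 * g2 x) by exact: measurable_funM.
have N : (Lnorm mu q%:E (EFin \o (fun x => (a1 * g1 x + a2 * g2 x)%R)) <=
    (`|a1| * B1 + `|a2| * B2)%:E * Lnorm mu q%:E (EFin \o h))%E.
  apply: le_trans (minkowski_EFin mu ma1 ma2 (ltW q1)) _.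
  rewrite !Lnorm_scale// EFinD ge0_muleDl ?lee_fin ?mulr_ge0// !EFinM -!muleA.
  by apply: leeD; apply: lee_wpmul2l; rewrite ?lee_fin.
exists (fun x => a1 * g1 x + a2 * g2 x); split => //.
  apply: in_rLq_le N B0; last by case: hq.
  exact: measurable_funD.
move=> phi pS; have [S1 _] := U1S phi pS; have [S2 _] := U2S phi pS.
have i1 := in_rLq_schwartz_integrable q1 g1q pS.
have i2 := in_rLq_schwartz_integrable q1 g2q pS.
have j1 := in_rLq_schwartz_integrable q1 hq S1.
have j2 := in_rLq_schwartz_integrable q1 hq S2.
transitivity (a1 * \int[mu]_x (g1 x * phi x) + a2 * \int[mu]_x (g2 x * phi x)).
  rewrite -!RintegralZl// -RintegralD//; try exact: integrableZl_fun.
  by apply: eq_Rintegral => x _; ring.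
rewrite g1E// g2E// -!RintegralZl// -RintegralD//; try exact: integrableZl_fun.
by apply: eq_Rintegral => x _; ring.
Qed.

Lemma bounded_symbolM (B1 B2 : R) (m1 m2 : V -> R) :
  bounded_symbol m1 B1 -> bounded_symbol m2 B2 ->
  bounded_symbol (fun xi => m1 xi * m2 xi) (B1 * B2).
Proof.
move=> [B10 [U1 [U1S U1q]]] [B20 [U2 [U2S U2q]]].
split; first exact: mulr_ge0.
exists (fun phi => U1 (U2 phi)); split=> [phi pS|q q1 h hq].
  have [S2 T2] := U2S phi pS; have [S1 T1] := U1S _ S2; split=> // xi th.
  by rewrite T1 T2 mulrA.
(* Transposition reverses composition: the transpose of U1 acts on h first. *)
have [g1 [g1q g1N g1E]] := U1q q q1 h hq.
have [g2 [g2q g2N g2E]] := U2q q q1 g1 g1q.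
exists g2; split => //.
  apply: le_trans g2N _; rewrite mulrC EFinM -muleA.
  by apply: lee_wpmul2l; rewrite ?lee_fin.
by move=> phi pS; rewrite g2E// g1E//; case: (U2S phi pS).
Qed.

Lemma bounded_symbolW (B B' : R) (m : V -> R) : bounded_symbol m B -> B <= B' ->
  bounded_symbol m B'.
Proof.
move=> [B0 [U [US Uq]]] BB'; split; first exact: le_trans BB'.
exists U; split => // q q1 h hq; have [g [gq gN gE]] := Uq q q1 h hq.
exists g; split => //; apply: le_trans gN _.
by apply: lee_wpmul2r; rewrite ?Lnorm_ge0// lee_fin.
Qed.

Lemma bounded_symbolZ (a B : R) (m : V -> R) : bounded_symbol m B ->
  bounded_symbol (fun xi => a * m xi) (`|a| * B).
Proof.
move=> mB; have := bounded_symbol_lin a 0 mB mB.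
rewrite normr0 mul0r addr0; congr bounded_symbol.
by apply/funext => xi; rewrite mul0r addr0.
Qed.

Lemma bounded_symbolD (B1 B2 : R) (m1 m2 : V -> R) :
  bounded_symbol m1 B1 -> bounded_symbol m2 B2 ->
  bounded_symbol (fun xi => m1 xi + m2 xi) (B1 + B2).
Proof.
move=> mB1 mB2; have := bounded_symbol_lin 1 1 mB1 mB2.
rewrite normr1 !mul1r; congr bounded_symbol.
by apply/funext => xi; rewrite !mul1r.
Qed.

Lemma bounded_symbolB (B1 B2 : R) (m1 m2 : V -> R) :
  bounded_symbol m1 B1 -> bounded_symbol m2 B2 ->
  bounded_symbol (fun xi => m1 xi - m2 xi) (B1 + B2).
Proof.
move=> mB1 mB2; have := bounded_symbol_lin 1 (-1) mB1 mB2.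
rewrite normrN normr1 !mul1r; congr bounded_symbol.
by apply/funext => xi; rewrite mul1r mulN1r.
Qed.

(** The bound is the total mass of W, read off from the symbol at xi = 0. The operator on Schwartz
    functions translates by Y, its transpose on L^q by - Y. *)
Lemma bounded_symbol_wtrans (d : measure_display) (T : measurableType d)
  (P : {sigma_finite_measure set T -> \bar R}) (W : T -> R) (Y : T -> V)
  (m : V -> R) :
  measurable_fun setT W -> (forall t, 0 <= W t) -> measurable_fun setT Y ->
  (forall k, P.-integrable setT (EFin \o (fun t => W t * pweight (Y t) ^+ k))) ->
  (forall xi th, \int[P]_t (W t * cos (dotv (Y t) xi + th)) = m xi * cos th) ->
  bounded_symbol m (m 0).
Proof.
move=> mW W0 mY Wmom Wm.
have m0 : \int[P]_t W t = m 0.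
  have := Wm 0 0; rewrite cos0 mulr1 => <-.
  apply: eq_Rintegral => t _.
  by rewrite dotvC -[0 : V](scale0r 0) dotvZl mul0r addr0 cos0 mulr1.
have Wi := integrable_weight Wmom.
have mNY : measurable_fun setT (fun t => - Y t) by exact: measurable_rVN.
split; first by rewrite -m0; apply: Rintegral_ge0.
exists (wtrans P W Y); split=> [phi pS|q q1 h [mh hoo]].
  by split=> [|xi th]; [exact: rschwartz_wtrans|exact: trigt_wtrans].
have N := Lnorm_wtrans mW W0 mNY Wi q1 mh; rewrite m0 in N.
exists (wtrans P W (fun t => - Y t) h); split => //.
  apply: in_rLq_le N _ => //; first exact: measurable_wtrans.
  by rewrite -m0; apply: Rintegral_ge0.
move=> phi pS; apply: (Rintegral_wtrans_dual mW W0 mY Wmom q1) => //.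
exact: Lnorm_lty.
Qed.

Lemma polynomial_le_gauss (N : nat) : exists C : R, 0 < C /\
  forall t : R, 0 <= t -> (1 + t) ^+ N <= C * expR (t ^+ 2 / 4).
Proof.
(* With y = 1 + t, y / (N+1) <= exp (y / (N+1)) gives y^(N+1) <= (N+1)^(N+1) exp y, and y <= 2 + t^2
   / 4 because (t / 2 - 1)^2 >= 0. *)
exists (N.+1%:R ^+ N.+1 * expR 2); split; first by rewrite mulr_gt0 ?exprn_gt0 ?expR_gt0.
move=> t t0; set y := 1 + t.
have y1 : 1 <= y by rewrite lerDl.
have y0 : 0 <= y by rewrite (le_trans ler01).
apply: (@le_trans _ _ (y ^+ N.+1)); first by rewrite exprS ler_peMl// exprn_ge0.
have yE : y = N.+1%:R * (y / N.+1%:R) by rewrite mulrCA divff ?mulr1.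
apply: (@le_trans _ _ (N.+1%:R ^+ N.+1 * expR y)); last first.
  rewrite -mulrA ler_wpM2l ?exprn_ge0// -expRD ler_expR /y.
  by have := sqr_ge0 (t / 2 - 1); nra.
rewrite [in leRHS]yE expRM_natl {1}yE exprMn ler_wpM2l ?exprn_ge0//.
apply: lerXn2r; rewrite ?nnegrE ?expR_ge0 ?divr_ge0//.
by apply: le_trans (expR_ge1Dx _); rewrite lerDr.
Qed.

(* Integrability is needed down to A = - 1/2, below zero, for all the moments of
   the translations to be finite, so that Schwartz functions are preserved. *)
Lemma bounded_symbol_mixture (d : measure_display) (T : measurableType d)
  (P : {sigma_finite_measure set T -> \bar R}) (w s : T -> R) (M : R -> R) :
  measurable_fun setT w -> (forall t, 0 <= w t) ->
  measurable_fun setT s -> (forall t, 0 <= s t) ->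
  (forall A, - 2^-1 <= A -> (\int[P]_t (w t * expR (- (s t * A)))%:E = (M A)%:E)%E) ->
  bounded_symbol (fun xi => M (dotv xi xi)) (M 0).
Proof.
move=> mw w0 ms s0 HM.
have d0 : dotv (0 : V) 0 = 0 by rewrite -{1}(scale0r (0 : V)) dotvZl mul0r.
have one0 : (1 : R) != 0 by [].
(* The function exp (- s |xi|^2) is the characteristic function of sqrt (2 s) Z with Z a standard
   Gaussian vector. So a mixture is an average of translations by sqrt (2 s t) z over the pairs (t,
   z). *)
pose PV : {sigma_finite_measure set (T * V)%type -> \bar R} :=
  sigma_finite_prod P mu.
pose W (z : T * V) := w z.1 * gaussV 1 z.2.
pose Y (z : T * V) : V := Num.sqrt (2 * s z.1) *: z.2.
have mW : measurable_fun setT W.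
  by apply: measurable_funM; [exact: measurableT_comp|
    apply: (measurableT_comp (@measurable_gaussV _ 1 n))].
have mY : measurable_fun setT Y.
  apply: measurable_rVZ => //.
  apply: (@measurableT_comp _ _ _ _ _ _ (@Num.sqrt R)).
    by apply: continuous_measurable_fun; exact: sqrt_continuous.
  by apply: measurable_funM => //; exact: measurableT_comp.
have W0 z : 0 <= W z by rewrite mulr_ge0// gaussV_ge0.
have mE A : measurable_fun setT (fun t => w t * expR (- (s t * A))).
  apply: measurable_funM => //; apply: (measurableT_comp (@measurable_expR R)).
  by apply: measurable_funN; exact: measurable_funM.
have wi A : - 2^-1 <= A ->
    P.-integrable setT (EFin \o (fun t => w t * expR (- (s t * A)))).
  move=> A2; apply: integrable_ge0P => //.
    by move=> t; rewrite mulr_ge0 ?expR_ge0.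
  by rewrite HM// ltry.
have Wmom k : PV.-integrable setT
    (EFin \o (fun z => W z * pweight (Y z) ^+ k)).
  have [C [C0 HC]] := polynomial_le_gauss (n * k).
  have mWY : measurable_fun setT (fun z => W z * pweight (Y z) ^+ k).
    apply: measurable_funM => //.
    by apply: (measurableT_comp (@measurable_pweightX R n k)).
  pose K := \int[mu]_z (pweight z ^+ k * gaussV 1 z).
  (* The weight of Y is at most (1 + sqrt (2 s))^n times that of z. By [polynomial_le_gauss] its
     powers cost exp (s / 2), which is the exponential of the mixture at A = - 1/2. *)
  pose b (z : T * V) := C * (w z.1 * expR (- (s z.1 * - 2^-1))) *
    (pweight z.2 ^+ k * gaussV 1 z.2).
  have mpg : measurable_fun setT (fun z : V => pweight z ^+ k * gaussV 1 z).
    by apply: measurable_funM; [exact: measurable_pweightX|exact: measurable_gaussV].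
  apply: (integrable_prodP (g := b)) => //.
  - apply: measurable_funM; last exact: (measurableT_comp mpg).
    by apply: measurable_funM => //; exact: (measurableT_comp (mE _)).
  - move=> z; rewrite ger0_norm; last by rewrite mulr_ge0// exprn_ge0// pweight_ge0.
    rewrite /W /b.
    have -> : C * (w z.1 * expR (- (s z.1 * - 2^-1))) * (pweight z.2 ^+ k * gaussV 1 z.2) =
      w z.1 * gaussV 1 z.2 * (C * expR (- (s z.1 * - 2^-1)) * pweight z.2 ^+ k) by ring.
    rewrite ler_wpM2l ?mulr_ge0 ?gaussV_ge0//.
    have := pweightZ (Num.sqrt (2 * s z.1)) z.2.
    rewrite ger0_norm ?sqrtr_ge0// => pz.
    apply: (@le_trans _ _ (((1 + Num.sqrt (2 * s z.1)) ^+ n * pweight z.2) ^+ k)).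
      apply: lerXn2r pz; rewrite nnegrE ?pweight_ge0//.
      by rewrite mulr_ge0 ?pweight_ge0// exprn_ge0// addr_ge0// sqrtr_ge0.
    rewrite exprMn -exprM ler_wpM2r ?exprn_ge0 ?pweight_ge0//.
    apply: le_trans (HC _ (sqrtr_ge0 _)) _.
    rewrite ler_wpM2l ?(ltW C0)// ler_expR sqr_sqrtr ?mulr_ge0//; lra.
  - rewrite /b /=; under eq_integral => t _.
      under eq_integral do rewrite EFinM.
      rewrite ge0_integralZl//; last 3 first.
      + exact/measurable_EFinP.
      + by move=> z _; rewrite lee_fin mulr_ge0 ?exprn_ge0 ?pweight_ge0 ?gaussV_ge0.
      + by rewrite lee_fin !mulr_ge0 ?expR_ge0// ltW.
      rewrite -EFin_Rintegral; last exact: integrable_gaussV.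
      rewrite -EFinM -/K mulrC.
      over.
    have := integrableZl_fun K (integrableZl_fun C (wi _ (lexx _))).
    move/integrable_lty_ge0; apply => t.
    rewrite !mulr_ge0 ?expR_ge0 ?(ltW C0)//; apply: Rintegral_ge0 => z _.
    by rewrite mulr_ge0 ?exprn_ge0 ?pweight_ge0 ?gaussV_ge0.
have Wsym xi th : \int[PV]_z (W z * cos (dotv (Y z) xi + th)) =
    M (dotv xi xi) * cos th.
  have xi0 : - 2^-1 <= dotv xi xi by rewrite (le_trans _ (dotv_ge0 xi))// oppr_le0 invr_ge0.
  rewrite -(Rfubini1 (f := fun z => W z * cos (dotv (Y z) xi + th))); last first.
    apply: (integrable_dominated (g := W)); last exact: (integrable_weight (P := PV) Wmom).
      apply: measurable_funM => //; apply: measurable_cos_fun.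
      by apply: measurable_funD => //; exact: measurable_dotv.
    by move=> z; rewrite normrM ger0_norm// ler_piMr// cos_max.
  transitivity (\int[P]_t (w t * expR (- (s t * dotv xi xi)) * cos th)).
    apply: eq_Rintegral => t _; rewrite /W /Y/=.
    under eq_Rintegral do rewrite dotvZl dotvC -dotvZl dotvC -mulrA.
    rewrite RintegralZl//; last exact: integrable_gaussV_cos.
    rewrite Rintegral_gaussV_cos// -[RHS]mulrA; congr (_ * (expR _ * _)).
    rewrite expr1n mul1r dotvZl dotvC dotvZl mulrA -expr2 sqr_sqrtr ?mulr_ge0//.
    by field.
  rewrite RintegralZr//; last exact: wi.
  by rewrite /Rintegral HM.
have := bounded_symbol_wtrans (P := PV) mW W0 mY Wmom Wsym.
by rewrite d0.
Qed.

End bounded_multipliers.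

(** * The symbols *)

Section laplace_integrals.
Variable R : realType.
Local Notation leb := (@lebesgue_measure R).
Implicit Types a b x A : R.

Lemma is_derive1_continuous (f : R -> R) x d :
  is_derive x (1 : R) f d -> {for x, continuous f}.
Proof. by move=> [fx _]; apply/differentiable_continuous/derivable1_diffP. Qed.

Lemma integral_indic_mul (D : set R) (f : R -> R) :
  (\int[leb]_x (\1_D x * f x)%:E = \int[leb]_(x in D) (f x)%:E)%E.
Proof.
rewrite [RHS]integral_mkcond; apply: eq_integral => x _.
rewrite patchE indicE; case: (x \in D); first by rewrite mul1r.
by rewrite mul0r.
Qed.

Lemma integral_expR_laplace A : 0 < A ->
  (\int[leb]_x (\1_`[0%R, +oo[ x * expR (- (x * A)))%:E = (A^-1)%:E)%E.
Proof.
move=> A0; rewrite -[RHS]mule1 -(integral_exponential_pdf A0).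
rewrite -ge0_integralZl//.
- apply: eq_integral => x _; rewrite /exponential_pdf patchE indicE -EFinM.
  case: (x \in _); last by rewrite mul0r mulr0.
  by rewrite mulrA mulVf ?gt_eqF// mulNr [A * x]mulrC.
- apply/measurable_EFinP; exact: measurable_exponential_pdf.
- by move=> x _; rewrite lee_fin exponential_pdf_ge0// ltW.
- by rewrite lee_fin invr_ge0 ltW.
Qed.

Lemma integral_gauss_laplace A : 0 < A ->
  (\int[leb]_x ((Num.sqrt pi)^-1 * expR (- (x ^+ 2 * A)))%:E =
   ((Num.sqrt A)^-1)%:E)%E.
Proof.
move=> A0; have sA : 0 < Num.sqrt A by rewrite sqrtr_gt0.
have p0 : 0 < (pi : R) := pi_gt0 R.
(* The Gaussian density of variance 1 / (2 A) is proportional to exp (- x^2 A). *)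
pose s : R := (Num.sqrt (2 * A))^-1.
have s0 : s != 0 by rewrite gt_eqF// invr_gt0 sqrtr_gt0 mulr_gt0.
have s2 : s ^+ 2 = (2 * A)^-1 by rewrite exprVn sqr_sqrtr// mulr_ge0// ltW.
have pk : normal_peak s = Num.sqrt A / Num.sqrt pi.
  rewrite /normal_peak s2 -(mulr_natl _ 2).
  have -> : 2 * ((2 * A)^-1 * pi) = pi / A by field; rewrite gt_eqF.
  by rewrite sqrtrM ?(ltW p0)// sqrtrV ?ltW// invfM invrK mulrC.
rewrite -[RHS]mule1 -(integral_normal_pdf 0 s) -ge0_integralZl//.
- apply: eq_integral => x _; rewrite -EFinM normal_pdf0E// pk s2.
  congr EFin; rewrite !mulrA mulVf ?gt_eqF// mul1r; congr (_ * expR (- _)).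
  by field; rewrite gt_eqF.
- apply/measurable_EFinP; exact: measurable_normal_pdf.
- by move=> x _; rewrite lee_fin normal_pdf_ge0.
Qed.

(** By partial fractions, x^2 / ((x^2 + a^2) (x^2 + b^2)) is the difference of a^2 / (x^2 + a^2) and
    b^2 / (x^2 + b^2), divided by a^2 - b^2. The arctangents contribute (a - b) pi / 2, and (a - b)
    / (a^2 - b^2) = 1 / (a + b). *)
Lemma integral_two_atan a b : 0 < a -> 0 < b -> a != b ->
  (\int[leb]_(x in `[0%R, +oo[)
     (2 / pi * (x ^+ 2 * (x ^+ 2 + b ^+ 2)^-1 * (a ^+ 2 + x ^+ 2)^-1))%:E =
   ((a + b)^-1)%:E)%E.
Proof.
move=> a0 b0 ab; have p0 : 0 < (pi : R) := pi_gt0 R.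
have ab0 : a ^+ 2 - b ^+ 2 != 0.
  by rewrite subr_sqr mulf_neq0// ?subr_eq0// gt_eqF// addr_gt0.
have pos (x e : R) : 0 < e -> 0 < x ^+ 2 + e ^+ 2.
  by move=> e0; rewrite ltr_wpDl ?sqr_ge0// exprn_gt0.
pose k : R := 2 / pi / (a ^+ 2 - b ^+ 2).
pose F (x : R) := k * a * atan (x * a^-1 + 0) + (- (k * b)) * atan (x * b^-1 + 0).
pose f (x : R) : R := 2 / pi * (x ^+ 2 * (x ^+ 2 + b ^+ 2)^-1 * (a ^+ 2 + x ^+ 2)^-1).
have dF (x : R) : is_derive x (1 : R) F (f x).
  apply: (@is_derive1_eq _ _ _ (
    (0 * atan (x * a^-1 + 0) + k * a * ((1 + (x * a^-1 + 0) ^+ 2)^-1 * a^-1)) +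
    (0 * atan (x * b^-1 + 0) + - (k * b) * ((1 + (x * b^-1 + 0) ^+ 2)^-1 * b^-1)))).
    apply: is_derive1_addfun; apply: is_derive1_mulfun;
      do ?exact: is_derive1_cst;
      apply: is_derive1_compfun; do ?exact: is_derive1_lin; exact: is_derive1_atan.
  move: p0; rewrite /f /k; generalize (pi : R) => p p0; field.
  rewrite ab0 (gt_eqF a0) (gt_eqF b0) (gt_eqF p0) (gt_eqF (pos x b b0)).
  by rewrite addrC (gt_eqF (pos x a a0)).
have cf : continuous f.
  move=> x; rewrite /f; apply: cvgM; first exact: cvg_cst.
  apply: cvgM; first apply: cvgM.
  - exact: exprn_continuous.
  - apply: cvgV; first by rewrite gt_eqF// pos.
    by apply: cvgD; [exact: exprn_continuous|exact: cvg_cst].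
  - apply: cvgV; first by rewrite gt_eqF// addrC pos.
    by apply: cvgD; [exact: cvg_cst|exact: exprn_continuous].
have lim (e : R) : 0 < e -> atan (x * e^-1 + 0) @[x --> +oo%R] --> (pi / 2 : R).
  move=> e0; under eq_fun do rewrite addr0.
  apply: (@cvg_comp _ _ _ (fun x : R => x * e^-1) (@atan R)); last exact: cvgy_atan.
  by apply: gt0_cvgMly => //; rewrite invr_gt0.
rewrite (ge0_continuous_FTC2y (f := f) (F := F)
  (l := k * a * (pi / 2) + (- (k * b)) * (pi / 2))).
- rewrite /F !mul0r !addr0 atan0 !mulr0 addr0 sube0 /k; congr EFin.
  have abs0 : a + b != 0 by rewrite gt_eqF// addr_gt0.
  move: (gt_eqF p0); generalize (pi : R) => p p0'; field.
  by rewrite abs0 ab0 p0'.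
- by move=> x x0; rewrite /f !mulr_ge0 ?invr_ge0 ?(ltW p0) ?addr_ge0 ?sqr_ge0.
- by apply: continuous_subspaceT => x; exact: cf.
- by apply: cvgD; apply: cvgM; do ?exact: cvg_cst; exact: lim.
- by move=> x _; have [] := dF x.
- by apply: cvg_at_right_filter; exact: (is_derive1_continuous (dF _)).
- by move=> x _; rewrite derive1E; have [_] := dF x.
Qed.

Lemma integral_half_sqrtV A (a b : R) : a <= b -> 0 < A + a ->
  (\int[leb]_(x in `[a, b]) (2^-1 * (Num.sqrt (A + x))^-1)%:E =
   (Num.sqrt (A + b) - Num.sqrt (A + a))%:E)%E.
Proof.
rewrite le_eqVlt => /predU1P[<- _|ab Aa].
  by rewrite set_itv1 integral_set1 subrr.
have dF (x : R) : a <= x -> is_derive x (1 : R) (fun x => Num.sqrt (x * 1 + A))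
    (2^-1 * (Num.sqrt (A + x))^-1).
  move=> ax; have Ax : 0 < A + x by rewrite (lt_le_trans Aa)// lerD2l.
  apply: (@is_derive1_eq _ _ _ ((2 * Num.sqrt (x * 1 + A))^-1 * 1)).
    apply: is_derive1_compfun; last exact: is_derive1_lin.
    by apply: is_derive1_sqrt; rewrite mulr1 addrC.
  by rewrite !mulr1 invfM addrC.
rewrite (@continuous_FTC2 _ (fun x => 2^-1 * (Num.sqrt (A + x))^-1)
  (fun x => Num.sqrt (x * 1 + A)) a b ab).
- by rewrite !mulr1 EFinB ![A + _]addrC.
- apply: continuous_in_subspaceT => x; rewrite inE/= in_itv/= => /andP[ax _].
  have Ax : 0 < A + x by rewrite (lt_le_trans Aa)// lerD2l.
  apply: cvgM; first exact: cvg_cst.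
  apply: cvgV; first by rewrite gt_eqF// sqrtr_gt0.
  apply: (@continuous_comp _ _ _ (fun x : R => A + x) (@Num.sqrt R)).
    by apply: continuousD; [exact: cvg_cst|exact: cvg_id].
  exact: sqrt_continuous.
- split.
  + by move=> x; rewrite in_itv/= => /andP[ax _]; have [] := dF x (ltW ax).
  + by apply: cvg_at_right_filter; exact: (is_derive1_continuous (dF _ _)).
  + by apply: cvg_at_left_filter; exact: (is_derive1_continuous (dF _ (ltW ab))).
- by move=> x; rewrite in_itv/= derive1E => /andP[ax _]; have [_] := dF x (ltW ax).
Qed.

End laplace_integrals.

Section elementary_symbols.
Variables (R : realType) (n : nat).
Local Notation V := 'rV[R]_n.
Local Notation leb := (@lebesgue_measure R).

Let ge0_fst_snd (f : R * R -> R) : measurable_fun setT f -> (forall z, 0 <= f z) ->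
  (\int[sigma_finite_prod leb leb]_z (f z)%:E =
   \int[leb]_x \int[leb]_y (f (x, y))%:E)%E.
Proof.
move=> mf f0; apply: (@fubini_tonelli1 _ _ _ _ _ leb leb (EFin \o f)) => //.
exact/measurable_EFinP.
Qed.

Let measurable_indic_comp (D : set R) (f : R * R -> R) : measurable D ->
  measurable_fun setT f -> measurable_fun setT (fun z => \1_D (f z) : R).
Proof.
move=> mD mf; apply: (@measurableT_comp _ _ _ _ _ _ (\1_D : R -> R)) => //.
Qed.

(** The mixture is the Laplace integral of exp (- u a) exp (- u A) over u >= 0. The threshold 3/4 is
    the least value of 1 - 1/c^2 for c >= 2, and it exceeds 1/2, which keeps A + a positive down to
    A = - 1/2. *)
Lemma bounded_symbol_resolvent (a : R) : 3 / 4 <= a ->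
  bounded_symbol (fun xi : V => (dotv xi xi + a)^-1) a^-1.
Proof.
move=> a1; rewrite -[X in bounded_symbol _ X^-1]add0r.
apply: (@bounded_symbol_mixture _ _ _ _ leb
  (* The exponent has to be nonnegative for all real u, hence |u|; the weight vanishes for u < 0. *)
  (fun u => \1_`[0%R, +oo[ u * expR (- (u * a))) (fun u => `|u|)
  (fun A => (A + a)^-1)).
- apply: measurable_funM; first exact: measurable_indic.
  by apply: (measurableT_comp (@measurable_expR R)); apply: measurable_funN;
    exact: measurable_funM.
- by move=> u; rewrite mulr_ge0 ?expR_ge0// indicE.
- exact: normr_measurable.
- by [].
- move=> A A1; have Aa : 0 < A + a by lra.
  rewrite -(integral_expR_laplace Aa); apply: eq_integral => u _.
  rewrite indicE mem_setE in_itv/= andbT; case: (leP 0 u) => u0; last by rewrite !mul0r.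
  rewrite !mul1r -expRD (ger0_norm u0); congr (expR _)%:E; ring.
Qed.

(** The mixture is the Gaussian integral of exp (- v^2 (A + 1)) over the line, divided by sqrt
    pi. *)
Lemma bounded_symbol_rsqrt :
  bounded_symbol (fun xi : V => (Num.sqrt (dotv xi xi + 1))^-1) 1.
Proof.
rewrite -[X in bounded_symbol _ X]invr1 -[X in bounded_symbol _ X^-1]sqrtr1.
rewrite -[X in bounded_symbol _ (Num.sqrt X)^-1]add0r.
apply: (@bounded_symbol_mixture _ _ _ _ leb
  (fun v => (Num.sqrt pi)^-1 * expR (- (v ^+ 2 * 1))) (fun v => v ^+ 2)
  (fun A => (Num.sqrt (A + 1))^-1)).
- apply: measurable_funM => //; apply: (measurableT_comp (@measurable_expR R)).
  by apply: measurable_funN; apply: measurable_funM => //; exact: measurable_funX.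
- by move=> v; rewrite mulr_ge0 ?expR_ge0// invr_ge0 sqrtr_ge0.
- exact: measurable_funX.
- by move=> v; exact: sqr_ge0.
- move=> A A1; have Aa : 0 < A + 1 by lra.
  rewrite -(integral_gauss_laplace Aa); apply: eq_integral => v _.
  rewrite -mulrA -expRD; congr (_ * expR _)%:E; ring.
Qed.

(* S - T = \int_1^{k^2} (A + l)^{-1/2} / 2 dl, with (A + l)^{-1/2} a Gaussian
   integral. *)
Lemma bounded_symbol_sqrt_subr (k : R) : 1 <= k ->
  bounded_symbol (fun xi : V => Num.sqrt (dotv xi xi + k ^+ 2) -
    Num.sqrt (dotv xi xi + 1)) (k - 1).
Proof.
move=> k1; have k0 : 0 <= k by lra.
have -> : k - 1 = Num.sqrt (0 + k ^+ 2) - Num.sqrt (0 + 1).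
  by rewrite !add0r sqrtr1 sqrtr_sqr ger0_norm.
pose w (z : R * R) := \1_`[1%R, k ^+ 2] z.1 *
  (2^-1 * ((Num.sqrt pi)^-1 * expR (- (z.2 ^+ 2 * z.1)))).
have w0 z : 0 <= w z.
  by rewrite !mulr_ge0 ?expR_ge0 ?invr_ge0 ?sqrtr_ge0// indicE.
have mX : measurable_fun setT (fun z : R * R => z.2 ^+ 2).
  exact: measurable_funX.
have mw : measurable_fun setT w.
  apply: measurable_funM; first exact: measurable_indic_comp.
  apply: measurable_funM => //; apply: measurable_funM => //.
  apply: (measurableT_comp (@measurable_expR R)); apply: measurable_funN.
  exact: measurable_funM.
apply: (@bounded_symbol_mixture _ _ _ _ (sigma_finite_prod leb leb) w
  (fun z => z.2 ^+ 2) (fun A => Num.sqrt (A + k ^+ 2) - Num.sqrt (A + 1))) => //.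
- by move=> z; exact: sqr_ge0.
- move=> A A1; rewrite ge0_fst_snd; last 2 first.
  + apply: measurable_funM => //; apply: (measurableT_comp (@measurable_expR R)).
    by apply: measurable_funN; exact: measurable_funM.
  + by move=> z; rewrite mulr_ge0 ?expR_ge0.
  rewrite -integral_half_sqrtV; [|nra|lra].
  rewrite -integral_indic_mul; apply: eq_integral => l _; rewrite /w/= indicE.
  case: (boolP (l \in _)) => lI; last first.
    by under eq_integral do rewrite !mul0r; rewrite mul0r integral0.
  move: lI; rewrite mem_setE in_itv/= => /andP[l1 _].
  have lA : 0 < A + l by lra.
  rewrite mul1r EFinM -(integral_gauss_laplace lA) -ge0_integralZl//; last first.
  + apply/measurable_EFinP; apply: measurable_funM => //.
    apply: (measurableT_comp (@measurable_expR R)); apply: measurable_funN.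
    by apply: measurable_funM => //; exact: measurable_funX.
  apply: eq_integral => v _; rewrite -EFinM mul1r -!mulrA -expRD.
  by congr (_ * (_ * expR _))%:E; ring.
Qed.

(* The mixture is 1/(S + b) = 2/pi \int_0^oo v^2/(v^2 + b^2) 1/(S^2 + v^2) dv,
   with the resolvent 1/(A + k^2 + v^2) expanded as a Laplace integral. *)
Lemma bounded_symbol_sqrtDV (k b : R) : 0 < k -> 0 < b -> b ^+ 2 + 3 / 4 <= k ^+ 2 ->
  bounded_symbol (fun xi : V => (Num.sqrt (dotv xi xi + k ^+ 2) + b)^-1) (k + b)^-1.
Proof.
move=> k0 b0 kb.
have -> : k + b = Num.sqrt (0 + k ^+ 2) + b.
  by rewrite add0r sqrtr_sqr ger0_norm// ltW.
pose g (v : R) := 2 / pi * (v ^+ 2 * (v ^+ 2 + b ^+ 2)^-1).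
have g0 v : 0 <= g v.
  apply: mulr_ge0; first by rewrite divr_ge0 ?pi_ge0.
  by apply: divr_ge0; rewrite ?addr_ge0 ?sqr_ge0.
have mg : measurable_fun setT g.
  apply: measurable_funM => //; apply: measurable_funM; first exact: measurable_funX.
  apply: continuous_measurable_fun => v.
  apply: cvgV; first by rewrite gt_eqF// ltr_wpDl ?sqr_ge0 ?exprn_gt0.
  by apply: cvgD; [exact: exprn_continuous|exact: cvg_cst].
pose w (z : R * R) := \1_`[0%R, +oo[ z.1 * (g z.1 *
  (\1_`[0%R, +oo[ z.2 * expR (- (z.2 * (k ^+ 2 + z.1 ^+ 2))))).
have w0 z : 0 <= w z.
  apply: mulr_ge0; first by rewrite indicE.
  by apply: mulr_ge0 => //; rewrite indicE mulr_ge0 ?expR_ge0.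
have mw : measurable_fun setT w.
  apply: measurable_funM; first exact: measurable_indic_comp.
  apply: measurable_funM; first exact: (measurableT_comp mg).
  apply: measurable_funM; first exact: measurable_indic_comp.
  apply: (measurableT_comp (@measurable_expR R)); apply: measurable_funN.
  apply: measurable_funM => //; apply: measurable_funD => //; exact: measurable_funX.
have mn : measurable_fun setT (fun z : R * R => `|z.2|).
  exact: measurableT_comp.
apply: (@bounded_symbol_mixture _ _ _ _ (sigma_finite_prod leb leb) w
  (fun z => `|z.2|) (fun A => (Num.sqrt (A + k ^+ 2) + b)^-1)) => //.
- move=> A A1; rewrite ge0_fst_snd; last 2 first.
  + apply: measurable_funM => //; apply: (measurableT_comp (@measurable_expR R)).
    apply: measurable_funN; exact: measurable_funM.
  + by move=> z; rewrite mulr_ge0 ?expR_ge0.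
  have Ak : 0 < A + k ^+ 2 by have := sqr_ge0 b; lra.
  set a := Num.sqrt (A + k ^+ 2).
  have a0 : 0 < a by rewrite sqrtr_gt0.
  have a2 : a ^+ 2 = A + k ^+ 2 by rewrite sqr_sqrtr ?ltW.
  (* As A >= - 1/2, the margin 3/4 in [kb] leaves a^2 - b^2 >= 1/4, so the partial fractions behind
     [integral_two_atan] are available. *)
  have ab : a != b.
    by apply/eqP => ab; move: a2; rewrite ab => ?; lra.
  rewrite -integral_two_atan//.
  rewrite -integral_indic_mul; apply: eq_integral => v _; rewrite /w/= indicE.
  have v0 : 0 < a ^+ 2 + v ^+ 2 by rewrite ltr_pwDl ?exprn_gt0 ?sqr_ge0.
  rewrite [2 / pi * _]mulrA -/(g v).
  case: (boolP (v \in _)) => _; last first.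
    by under eq_integral do rewrite !mul0r; rewrite mul0r integral0.
  rewrite mul1r EFinM -(integral_expR_laplace v0) -ge0_integralZl//; last 2 first.
  + apply/measurable_EFinP; apply: measurable_funM; first exact: measurable_indic.
    apply: (measurableT_comp (@measurable_expR R)); apply: measurable_funN.
    by exact: measurable_funM.
  + by rewrite lee_fin.
  apply: eq_integral => u _; rewrite -EFinM mul1r indicE mem_setE in_itv/= andbT.
  case: (leP 0 u) => u0; last by rewrite !mul0r !mulr0 mul0r.
  rewrite !mul1r -mulrA -expRD (ger0_norm u0); congr (_ * expR _)%:E.
  by rewrite a2; ring.
Qed.

End elementary_symbols.

Section symbols.
Variables (R : realType) (n : nat).
Local Notation V := 'rV[R]_n.
Implicit Types xi : V.

Lemma PinftyE xi : Pinfty xi = dotv xi xi + 1.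
Proof. by rewrite /Pinfty enorm_sqr. Qed.

Lemma Pinfty_gt0 xi : 0 < Pinfty xi.
Proof. by rewrite PinftyE ltr_wpDl ?dotv_ge0. Qed.

Lemma PinftyVsqrtE xi : Pinfty xi `^ (- 2^-1) = (Num.sqrt (dotv xi xi + 1))^-1.
Proof. by rewrite powRN powR12_sqrt PinftyE// addr_ge0 ?dotv_ge0. Qed.

Section fixed_speed.
Variable c : R.
Hypothesis c2 : 2 <= c.
Let k := c / 2.
Let b := k - c^-1.
Let a := 1 - (c ^+ 2)^-1.
Let S xi := Num.sqrt (dotv xi xi + k ^+ 2).
Let T xi := Num.sqrt (dotv xi xi + 1).

Let c0 : 0 < c. Proof. exact: lt_le_trans c2. Qed.

Let c2V : c^-1 <= 2^-1. Proof. by rewrite lef_pV2// posrE. Qed.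

Let a34 : 3 / 4 <= a.
Proof.
have cV0 : 0 < c^-1 by rewrite invr_gt0.
by rewrite /a -exprVn; have := c2V; nra.
Qed.

Let b0 : 0 < b.
Proof. by rewrite /b /k; have := c2V; have := c2; lra. Qed.

Let kbE : k ^+ 2 = b ^+ 2 + a.
Proof. by rewrite /b /a /k; field; rewrite gt_eqF. Qed.

Let Aa0 xi : 0 < dotv xi xi + a.
Proof. by rewrite ltr_wpDl ?dotv_ge0//; have := a34; lra. Qed.

Let S2 xi : S xi ^+ 2 = dotv xi xi + k ^+ 2.
Proof. by rewrite sqr_sqrtr// addr_ge0 ?dotv_ge0 ?sqr_ge0. Qed.

Let T2 xi : T xi ^+ 2 = dotv xi xi + 1.
Proof. by rewrite sqr_sqrtr// addr_ge0 ?dotv_ge0. Qed.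

Let T0 xi : 0 < T xi.
Proof. by rewrite sqrtr_gt0 ltr_wpDl ?dotv_ge0. Qed.

Let Sb0 xi : 0 < S xi + b.
Proof. by rewrite ltr_wpDl// sqrtr_ge0. Qed.

Let AaE xi : dotv xi xi + a = (S xi - b) * (S xi + b).
Proof. by rewrite -subr_sqr S2 kbE; ring. Qed.

Let PcE xi : Pc c xi = c * (S xi - b).
Proof.
rewrite /Pc enorm_sqr /S /b /k.
have -> : c ^+ 2 * dotv xi xi + c ^+ 4 / 4 = c ^+ 2 * (dotv xi xi + (c / 2) ^+ 2) by field.
rewrite sqrtrM ?sqr_ge0// sqrtr_sqr ger0_norm ?(ltW c0)//.
by field; rewrite gt_eqF.
Qed.

Let Smb0 xi : 0 < S xi - b.
Proof. by rewrite -(pmulr_lgt0 _ (Sb0 xi)) -AaE. Qed.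

(** Rationalised, 1/P_c is (S + b) / (c (A + a)). Writing S + b = 2 b + (S - b) with 2 b / c = 1 - 2
    / c^2, this is (1 - 2 / c^2) / (A + a) + c^-1 / (S + b). On the other side, 1/(A+1) - 1/(A+a) =
    - c^-2 / ((A+1) (A+a)). *)
Let subE xi : (Pinfty xi)^-1 - (Pc c xi)^-1 =
  (c ^+ 2)^-1 * (2 * (dotv xi xi + a)^-1 -
    (dotv xi xi + 1)^-1 * (dotv xi xi + a)^-1) - c^-1 * (S xi + b)^-1.
Proof.
have A1 : dotv xi xi + 1 = (S xi - b) * (S xi + b) + (c ^+ 2)^-1.
  by rewrite -AaE /a; ring.
rewrite PinftyE PcE AaE A1.
have := lt0r_neq0 (Sb0 xi); have := lt0r_neq0 (Smb0 xi).
have : (S xi - b) * (S xi + b) + (c ^+ 2)^-1 != 0.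
  by rewrite -A1 -T2 expf_neq0// gt_eqF.
rewrite /b /k; move: (S xi) => s h1 h2 h3.
have h0 := lt0r_neq0 c0; have n4 : (4 : R) != 0 by [].
have n2c : 2 * c != 0 by rewrite mulf_neq0.
(* The remaining side conditions are the nonvanishing of S + b, S - b and A + 1, with denominators
   cleared. *)
field; apply/and4P; split => //.
- have -> : s * (2 * c) + (c * c - 2) = 2 * c * (s + (c / 2 - c^-1)) by field.
  exact: mulf_neq0.
- have -> : s * (2 * c) - (c * c - 2) = 2 * c * (s - (c / 2 - c^-1)) by field.
  exact: mulf_neq0.
- have -> : (s * (2 * c) - (c * c - 2)) * (s * (2 * c) + (c * c - 2)) + 4 =
    (2 * c) ^+ 2 * ((s - (c / 2 - c^-1)) * (s + (c / 2 - c^-1)) + c ^- 2) by field.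
  by rewrite mulf_neq0// expf_neq0.
Qed.

(** Multiply [subE] by T and use T^2 = (A + a) + c^-2, which gives T / (A + a) = 1/T + c^-2 / (T (A
    + a)), T^2 = A + 1, and T = (S + b) - b - (S - T) in the last term. *)
Let TsubE xi : T xi * ((Pinfty xi)^-1 - (Pc c xi)^-1) =
  (c ^+ 2)^-1 * (2 * (T xi)^-1 - (T xi)^-1 * (dotv xi xi + a)^-1
    + (2 * (c ^+ 2)^-1) * ((T xi)^-1 * (dotv xi xi + a)^-1))
  - c^-1 * (1 - b * (S xi + b)^-1 - (S xi - T xi) * (S xi + b)^-1).
Proof.
rewrite subE -T2.
have Aa : dotv xi xi + a = T xi ^+ 2 - (c ^+ 2)^-1 by rewrite T2 /a; ring.
have := lt0r_neq0 (Aa0 xi); rewrite Aa.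
have := lt0r_neq0 (Sb0 xi); have := lt0r_neq0 (T0 xi).
have h0 := lt0r_neq0 c0.
move: (S xi) (T xi) => s t h1 h2 h3; field.
rewrite h0 h1 h2 /=.
have -> : (t * c) ^+ 2 - 1 = c ^+ 2 * (t ^+ 2 - c ^- 2) by field.
by rewrite andbT mulf_neq0// expf_neq0.
Qed.

Let bounded_symbol_a : bounded_symbol (fun xi : V => (dotv xi xi + a)^-1) (4 / 3).
Proof.
apply: bounded_symbolW (bounded_symbol_resolvent _ a34) _.
rewrite -[4 / 3]invf_div lef_pV2// posrE; have := a34; lra.
Qed.

Let bounded_symbol_S :
  bounded_symbol (fun xi : V => (S xi + b)^-1) (k + b)^-1.
Proof.
apply: bounded_symbol_sqrtDV => //; first by rewrite divr_gt0.
by rewrite kbE lerD2l.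
Qed.

Let kb0 : 0 < k + b. Proof. by rewrite addr_gt0// divr_gt0. Qed.

(** Here k + b = c - 1/c, which is at least 3 c / 4 because c >= 2. *)
Let kbV : (k + b)^-1 <= 4 / 3 * c^-1.
Proof.
rewrite -[4 / 3]invf_div -invfM lef_pV2 ?posrE// ?mulr_gt0//.
by rewrite /b /k; have := c2V; have := c2; lra.
Qed.

Lemma bounded_symbol_sub :
  bounded_symbol (fun xi : V => (Pinfty xi)^-1 - (Pc c xi)^-1) (6 / c ^+ 2).
Proof.
under eq_fun do rewrite subE.
have one34 : 3 / 4 <= (1 : R) by lra.
apply: bounded_symbolW (bounded_symbolB (bounded_symbolZ (c ^+ 2)^-1
  (bounded_symbolB (bounded_symbolZ 2 bounded_symbol_a)
    (bounded_symbolM (bounded_symbol_resolvent n one34) bounded_symbol_a)))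
  (bounded_symbolZ c^-1 bounded_symbol_S)) _.
(* The bounds add up to at most (8/3 + 4/3 + 4/3) / c^2 = (16/3) / c^2. *)
rewrite -exprVn; have cV0 : 0 <= c^-1 by rewrite invr_ge0 ltW.
rewrite ger0_norm ?sqr_ge0// !ger0_norm// invr1.
by have := kbV; move: (k + b)^-1 c^-1 cV0 => u v; nra.
Qed.

Lemma bounded_symbol_sqrt_sub :
  bounded_symbol (fun xi : V => Num.sqrt (dotv xi xi + 1) *
    ((Pinfty xi)^-1 - (Pc c xi)^-1)) (6 / c).
Proof.
under eq_fun do rewrite TsubE.
have k1 : 1 <= k by rewrite /k; have := c2; lra.
have TB := @bounded_symbol_rsqrt R n.
apply: bounded_symbolW (bounded_symbolB (bounded_symbolZ (c ^+ 2)^-1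
  (bounded_symbolD (bounded_symbolB (bounded_symbolZ 2 TB)
      (bounded_symbolM TB bounded_symbol_a))
    (bounded_symbolZ (2 * (c ^+ 2)^-1) (bounded_symbolM TB bounded_symbol_a))))
  (bounded_symbolZ c^-1 (bounded_symbolB (bounded_symbolB (@bounded_symbol1 R n)
    (bounded_symbolZ b bounded_symbol_S))
    (bounded_symbolM (bounded_symbol_sqrt_subr n k1) bounded_symbol_S)))) _.
rewrite -exprVn; have cV0 : 0 <= c^-1 by rewrite invr_ge0 ltW.
rewrite ger0_norm ?sqr_ge0// !ger0_norm ?(ltW b0) ?mulr_ge0 ?sqr_ge0//.
(* The large factors b and k - 1 add up to less than k + b, so the last bracket has bound at most 2.
   As 1/c <= 1/2, the first bracket contributes at most c^-2 (10/3 + 2/3) <= 2 / c. *)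
have e : b * (k + b)^-1 + (k - 1) * (k + b)^-1 <= 1.
  by rewrite -mulrDl ler_pdivrMr// mul1r; lra.
have := c2V; move: (c^-1) cV0 e => v v0 e v2.
have v22 : v ^+ 2 <= v / 2 by nra.
have : v ^+ 2 <= 4^-1 by nra.
by nra.
Qed.

Lemma bounded_symbol_PinftyV : bounded_symbol (fun xi : V => (Pinfty xi)^-1) 1.
Proof.
under eq_fun do rewrite PinftyE.
rewrite -[X in bounded_symbol _ X]invr1.
by apply: bounded_symbol_resolvent; lra.
Qed.

End fixed_speed.
End symbols.

(** * Fourier inversion *)

Section transform_decay.
Variables (R : realType) (n : nat).
Local Notation V := 'rV[R]_n.
Local Notation mu := (lebesgue_rV R n).
Implicit Types (f : V -> R) (xi x y : V).

Lemma normr_trigt_le f xi th : mu.-integrable setT (EFin \o f) ->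
  `|trigt f xi th| <= \int[mu]_x `|f x|.
Proof.
move=> fi; have mf : measurable_fun setT f by have /measurable_int/measurable_EFinP := fi.
apply: normr_Rintegral_le (integrable_norm fi).
  by apply: measurable_funM => //; exact: measurable_trig_fun.
by move=> x; rewrite normrM ler_piMr// cos_max.
Qed.

Lemma measurable_trigt f (th : V -> R) : measurable_fun setT f ->
  measurable_fun setT th -> measurable_fun setT (fun xi => trigt f xi (th xi)).
Proof.
move=> mf mth.
apply: (@measurable_Rintegral2 _ _ _ _ _ mu
  (fun z : V * V => f z.2 * cos (dotv z.2 z.1 + th z.1))).
apply: measurable_funM; first exact: (measurableT_comp mf).
apply: measurable_cos_fun; apply: measurable_funD.
  exact: measurable_dotv.
exact: (measurableT_comp mth).
Qed.

(** Integration by parts: the derivative of f (x) cos (x . xi + th) in the direction e_i integrates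
    to 0. The sine that appears is a cosine with phase shifted by - pi / 2. *)
Lemma trigt_partial f i xi th : rschwartz f ->
  trigt (partials [:: i] f) xi th = xi ord0 i * trigt f xi (th - pi / 2).
Proof.
move=> fS; have f'S := rschwartz_partials [:: i] fS.
have fi := rschwartz_integrable fS; have f'i := rschwartz_integrable f'S.
pose e := delta_mx ord0 i : V.
pose g x := f x * cos (dotv x xi + th).
pose dg x := partials [:: i] f x * cos (dotv x xi + th) +
  f x * (- sin (dotv x xi + th) * xi ord0 i).
have [C [C0 fC]] := rschwartz_decay 2 fS.
have [D [D0 f'D]] := rschwartz_decay 2 f'S.
have gi : mu.-integrable setT (EFin \o g) by exact: integrable_trig.
have mg : measurable_fun setT g by have /measurable_int/measurable_EFinP := gi.
(* D and C bound the two terms of dg; the factor 4 is the square of the weight 1 + |h| <= 2 of the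
   displacement h e_i. *)
pose K := 4 * (D + C * `|xi ord0 i|).
have dgK (y x : V) (h : R) : x = y + h *: e -> `|h| < 1 -> `|dg y| <= K / pweight x ^+ 2.
  move=> xE h1; apply: (@le_trans _ _ ((D + C * `|xi ord0 i|) / pweight y ^+ 2)).
    rewrite mulrDl; apply: le_trans (ler_normD _ _) _; apply: lerD.
      by rewrite normrM; apply: le_trans (f'D y); rewrite ler_piMr// cos_max.
    rewrite normrM mulrAC; apply: ler_pM => //.
    by rewrite normrM normrN ler_piMl// sin_max.
  rewrite /K [4 * _]mulrC -mulrA ler_wpM2l ?addr_ge0 ?mulr_ge0 ?(ltW C0) ?(ltW D0)//.
  have y0 := pweight_gt0 y; have x0 := pweight_gt0 x.
  rewrite ler_pdivlMr ?exprn_gt0// mulrC ler_pdivrMr ?exprn_gt0//.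
  have -> : 4 * pweight y ^+ 2 = (pweight y * 2) ^+ 2 by ring.
  apply: lerXn2r; rewrite ?nnegrE ?mulr_ge0 ?(ltW y0) ?(ltW x0)//.
  rewrite xE; apply: le_trans (pweightD _ _) _; rewrite pweight_delta.
  by rewrite ler_wpM2l ?(ltW y0)//; lra.
have dg0 : \int[mu]_x dg x = 0.
  apply: (@Rintegral_flow_derive _ _ _ mu (fun h x => x + h *: e) g dg
    (fun x => K / pweight x ^+ 2)).
  - by move=> x; rewrite scale0r addr0.
  - by move=> h; exact: integrable_rV_shift.
  - by move=> h; exact: Rintegral_rV_shift.
  - move=> h x.
    have dE t : dotv (x + t *: e) xi + th = t * xi ord0 i + (dotv x xi + th).
      by rewrite dotvDl dotvZl dotv_delta addrAC addrC addrA.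
    rewrite /g /dg dE; under eq_fun do rewrite dE.
    apply: is_derive1_mulfun; first exact: rschwartz_line.
    by apply: is_derive1_compfun; exact: is_derive1_lin.
  - move=> h x h1; apply: (dgK _ _ (- h)); last by rewrite normrN.
    by rewrite scaleNr addrK.
  - exact: integrable_pweight_decay.
have -> : xi ord0 i * trigt f xi (th - pi / 2) =
    \int[mu]_x (xi ord0 i * (f x * cos (dotv x xi + (th - pi / 2)))).
  by rewrite RintegralZl//; exact: integrable_trig.
apply/eqP; rewrite -subr_eq0 /trigt -RintegralB//; last 2 first.
- exact: integrable_trig.
- by apply: integrableZl_fun; exact: integrable_trig.
apply/eqP; rewrite -[RHS]dg0; apply: eq_Rintegral => x _.
by rewrite addrA cosBpihalf /dg; ring.
Qed.

(** The symbol of the product of the operators 1 - d_i^2. It dominates 1 + |xi|^2, and its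
    reciprocal is integrable because it factors over the coordinates. *)
Definition sqweight (xi : V) : R := \prod_i (1 + xi ord0 i ^+ 2).

Lemma sqweight_dotv xi : 1 + dotv xi xi <= sqweight xi.
Proof.
rewrite /sqweight /dotv.
have [+ _] : 1 + \sum_i xi ord0 i * xi ord0 i <= \prod_i (1 + xi ord0 i ^+ 2) /\
    0 <= \sum_i xi ord0 i * xi ord0 i; last by [].
elim/big_rec2: _ => [|i s p _ [s1 s0]]; first by rewrite addr0.
by have := sqr_ge0 (xi ord0 i); rewrite -expr2 => ?; split; nra.
Qed.

Lemma sqweight_ge1 xi : 1 <= sqweight xi.
Proof. by apply: le_trans (sqweight_dotv xi); rewrite lerDl dotv_ge0. Qed.

Lemma integrable_sqweightV : mu.-integrable setT (EFin \o (fun xi => (sqweight xi)^-1)).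
Proof.
have E xi : (sqweight xi)^-1 = \prod_i (1 + xi ord0 i ^+ 2)^-1 by rewrite /sqweight prodfV.
apply: integrable_ge0P.
- under eq_fun do rewrite E.
  by apply: (@measurable_prod_coord _ _ (fun _ t => (1 + t ^+ 2)^-1)) => i; exact: measurable_oneDsqrV.
- by move=> x; rewrite invr_ge0 (le_trans ler01)// sqweight_ge1.
- under eq_integral do rewrite E.
  rewrite (@integral_rV_prod _ _ (fun _ t => (1 + t ^+ 2)^-1)) ?ltry// => _.
  + exact: measurable_oneDsqrV.
  + by move=> x; rewrite invr_ge0 addr_ge0 ?sqr_ge0.
  + exact: integral_oneDsqrV.
Qed.

(** The function g is obtained from f by applying 1 - d_i^2 for each i in s, two phase shifts by -
    pi / 2 amounting to a sign. A list s allows repeated factors. *)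
Lemma trigt_sqweight (s : seq 'I_n) f : rschwartz f -> exists g, rschwartz g /\
  forall xi th, trigt g xi th = \prod_(i <- s) (1 + xi ord0 i ^+ 2) * trigt f xi th.
Proof.
move=> fS; elim: s => [|i s [g [gS gE]]].
  by exists f; split=> // xi th; rewrite big_nil mul1r.
have g2S := rschwartz_partials [:: i; i] gS.
have g2N := rschwartzZ (-1) g2S.
exists (fun x => g x + -1 * partials [:: i; i] g x); split.
  exact: rschwartzD.
move=> xi th; rewrite trigtD; try exact: rschwartz_integrable.
rewrite trigtZ; last exact: rschwartz_integrable.
rewrite (_ : partials [:: i; i] g = partials [:: i] (partials [:: i] g))//.
rewrite trigt_partial; last exact: rschwartz_partials.
rewrite trigt_partial// big_cons.
have -> : trigt g xi (th - pi / 2 - pi / 2) = -1 * trigt g xi th.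
  rewrite /trigt -RintegralZl//; last by apply: integrable_trig; exact: rschwartz_integrable.
  apply: eq_Rintegral => x _.
  by rewrite !addrA cosBpihalf sinBpihalf; ring.
by rewrite gE; ring.
Qed.

(** Of the two powers of the weight, one makes the transform integrable, and the other absorbs the
    factor |xi|^2 lost when the Gaussian cut-off is removed in the inversion formula. *)
Lemma trigt_decay f : rschwartz f -> exists C, 0 <= C /\
  forall xi th, `|trigt f xi th| <= C * (sqweight xi ^+ 2)^-1.
Proof.
move=> fS.
have [g [gS gE]] := trigt_sqweight (index_enum 'I_n ++ index_enum 'I_n) fS.
exists (\int[mu]_x `|g x|); split; first exact: Rintegral_ge0.
move=> xi th; have q0 : 0 < sqweight xi by rewrite (lt_le_trans ltr01)// sqweight_ge1.
have := normr_trigt_le xi th (rschwartz_integrable gS).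
rewrite gE big_cat/= -/(sqweight xi) -expr2 normrM ger0_norm ?exprn_ge0 ?(ltW q0)//.
by rewrite ler_pdivlMr ?exprn_gt0// mulrC.
Qed.

Lemma integrable_trigt f (th : V -> R) : rschwartz f -> measurable_fun setT th ->
  mu.-integrable setT (EFin \o (fun xi => trigt f xi (th xi))).
Proof.
move=> fS mth; have [C [C0 HC]] := trigt_decay fS.
apply: (@integrable_dominated _ _ _ mu _ (fun xi => C * (sqweight xi)^-1)).
- by apply: measurable_trigt => //; exact: rschwartz_measurable.
- move=> xi; apply: le_trans (HC _ _) _; apply: ler_wpM2l => //.
  have q1 := sqweight_ge1 xi; have q0 : 0 < sqweight xi by rewrite (lt_le_trans ltr01).
  by rewrite lef_pV2 ?posrE ?exprn_gt0// expr2 ler_peMl// ltW.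
- by apply: integrableZl_fun; exact: integrable_sqweightV.
Qed.

End transform_decay.

Section fourier_inversion.
Variables (R : realType) (n : nat).
Local Notation V := 'rV[R]_n.
Local Notation mu := (lebesgue_rV R n).
Implicit Types (f : V -> R) (xi x y u : V) (e : R).

Lemma gaussVE (s : R) x : s != 0 -> gaussV s x =
  normal_peak s ^+ n * expR (- (dotv x x / (2 * s ^+ 2))).
Proof.
move=> s0; rewrite /gaussV /dotv mulr_suml -sumrN expR_sum.
rewrite -[X in _ ^+ X](card_ord n) -prodr_const -big_split.
by apply: eq_bigr => i _; rewrite normal_pdf0E// -expr2.
Qed.

(* From [t <= exp (t^2 / 4)] with [t = |u_i| / e], at the price of a wider
   Gaussian. *)
Lemma gaussV_moment e u : 0 < e ->
  (\sum_i `|u ord0 i|) * gaussV e u <=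
  n%:R * e * Num.sqrt 2 ^+ n * gaussV (Num.sqrt 2 * e) u.
Proof.
move=> e0; have s20 : (0 : R) < Num.sqrt 2 by rewrite sqrtr_gt0.
have se0 : 0 < Num.sqrt 2 * e by rewrite mulr_gt0.
have e2 : 0 < e ^+ 2 by rewrite exprn_gt0.
rewrite !gaussVE ?gt_eqF// [(Num.sqrt 2 * e) ^+ 2]exprMn sqr_sqrtr//.
have pk : normal_peak e = Num.sqrt 2 * normal_peak (Num.sqrt 2 * e).
  have -> : (normal_peak (Num.sqrt 2 * e) = (Num.sqrt (2 * (e ^+ 2 * pi *+ 2)))^-1 :> R).
    by rewrite /normal_peak exprMn sqr_sqrtr//; congr (Num.sqrt _)^-1; ring.
  by rewrite sqrtrM// invfM mulrA divff ?mul1r// gt_eqF.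
set d := dotv u u; rewrite pk exprMn.
have -> : expR (- (d / (2 * e ^+ 2))) =
    expR (- (d / (4 * e ^+ 2))) * expR (- (d / (2 * (2 * e ^+ 2)))).
  by rewrite -expRD; congr expR; field; rewrite gt_eqF.
have S : (\sum_i `|u ord0 i|) * expR (- (d / (4 * e ^+ 2))) <= n%:R * e.
  have -> : n%:R * e = \sum_(i < n) e by rewrite sumr_const card_ord mulr_natl.
  rewrite mulr_suml; apply: ler_sum => i _; rewrite expRN ler_pdivrMr ?expR_gt0//.
  have ud : u ord0 i ^+ 2 <= d.
    rewrite /d /dotv (bigD1 i)//= -expr2 lerDl.
    by apply: sumr_ge0 => j _; rewrite -expr2 sqr_ge0.
  apply: (@le_trans _ _ (e * (1 + d / (4 * e ^+ 2)))); last first.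
    by rewrite ler_wpM2l ?expR_ge1Dx// ltW.
  have -> : e * (1 + d / (4 * e ^+ 2)) = (4 * e ^+ 2 + d) / (4 * e).
    by field; rewrite gt_eqF.
  rewrite ler_pdivlMr ?mulr_gt0//.
  have := sqr_ge0 (`|u ord0 i| - 2 * e).
  by rewrite -[u ord0 i ^+ 2]real_normK ?num_real// in ud; nra.
set p := normal_peak _; set E := expR (- (d / (2 * _))).
have p0 : 0 <= Num.sqrt 2 ^+ n * p ^+ n * E.
  by rewrite !mulr_ge0 ?exprn_ge0 ?expR_ge0 ?normal_peak_ge0// ltW.
move: (ler_wpM2r p0 S); move: (expR (- (d / (4 * _)))) => a.
by rewrite !mulrA [_ * a * E]mulrAC; congr (_ <= _); ring.
Qed.

(** The Lipschitz bound on f is integrated against the first absolute moment of a Gaussian of width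
    e, which is of order e; the rate is therefore linear in e and uniform in x. *)
Lemma Rintegral_gaussV_approx f : rschwartz f -> exists K, 0 <= K /\
  forall x e, 0 < e -> `|\int[mu]_u (f (u + x) * gaussV e u) - f x| <= K * e.
Proof.
move=> fS; have [L [L0 HL]] := rschwartz_lipschitz fS.
have [C [C0 HC]] := rschwartz_bounded fS.
have mf := rschwartz_measurable fS.
exists (L * (n%:R * Num.sqrt 2 ^+ n)); split.
  by rewrite !mulr_ge0 ?exprn_ge0 ?sqrtr_ge0.
move=> x e e0; have en0 : e != 0 by rewrite gt_eqF.
have e20 : Num.sqrt 2 * e != 0 by rewrite mulf_neq0// gt_eqF// sqrtr_gt0.
have gi := integrable_gaussV0 en0 n.
have mfx : measurable_fun setT (fun u => f (u + x)).
  by apply: (measurableT_comp mf); exact: measurable_rVD.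
have fgi : mu.-integrable setT (EFin \o (fun u => f (u + x) * gaussV e u)).
  apply: (@integrable_dominated _ _ _ mu _ (fun u => C * gaussV e u)).
  - by apply: measurable_funM => //; exact: measurable_gaussV.
  - by move=> u; rewrite normrM (ger0_norm (gaussV_ge0 _ _)) ler_wpM2r ?gaussV_ge0.
  - exact: integrableZl_fun.
have -> : f x = \int[mu]_u (f x * gaussV e u).
  by rewrite RintegralZl// Rintegral_gaussV// mulr1.
rewrite -RintegralB//; last exact: integrableZl_fun.
pose k := L * (n%:R * Num.sqrt 2 ^+ n) * e.
apply: (@le_trans _ _ (\int[mu]_u (k * gaussV (Num.sqrt 2 * e) u))); last first.
  by rewrite RintegralZl ?Rintegral_gaussV ?mulr1//; exact: integrable_gaussV0.
apply: normr_Rintegral_le.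
- apply: measurable_funB.
    by apply: measurable_funM => //; exact: measurable_gaussV.
  by apply: measurable_funM => //; exact: measurable_gaussV.
- move=> u; rewrite -mulrBl normrM (ger0_norm (gaussV_ge0 _ _)).
  apply: (@le_trans _ _ (L * (\sum_i `|u ord0 i|) * gaussV e u)).
    rewrite ler_wpM2r ?gaussV_ge0//; apply: le_trans (HL _ _) _.
    by rewrite ler_wpM2l//; apply: ler_sum => i _; rewrite mxE addrK.
  rewrite -mulrA; apply: le_trans (ler_wpM2l L0 (gaussV_moment u e0)) _.
  by rewrite /k le_eqVlt; apply/orP; left; apply/eqP; ring.
- by apply: integrableZl_fun; exact: integrable_gaussV0.
Qed.

(* Both sides carry a Gaussian: a Gaussian of width 1/e on the frequency side is
   a multiple of the transform of one of width e, which approximates the point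
   mass at x. *)
Lemma Rintegral_trigt_gauss f x th e : rschwartz f -> 0 < e ->
  \int[mu]_xi (expR (- (e ^+ 2 * dotv xi xi / 2)) * trigt f xi (th - dotv x xi)) =
  (2 * pi) ^+ n * cos th * \int[mu]_u (f (u + x) * gaussV e u).
Proof.
move=> fS e0; have en0 : e != 0 by rewrite gt_eqF.
have s0 : e^-1 != 0 by rewrite invr_eq0.
have fi := rschwartz_integrable fS; have mf := rschwartz_measurable fS.
have [C [C0 HC]] := rschwartz_bounded fS.
have pk0 (s : R) : s != 0 -> normal_peak s != 0 by move=> ?; rewrite gt_eqF// normal_peak_gt0.
(* This product of the normalisations of widths 1/e and e is the source of the factor (2 pi)^n. *)
have pk : normal_peak (e^-1) * normal_peak e = (2 * pi)^-1.
  rewrite /normal_peak -invfM -sqrtrM; last by rewrite mulrn_wge0// mulr_ge0 ?sqr_ge0 ?pi_ge0.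
  have -> : (e^-1 ^+ 2 * pi *+ 2) * (e ^+ 2 * pi *+ 2) = (2 * pi) ^+ 2.
    by move: (pi : R) => p; field.
  by rewrite sqrtr_sqr ger0_norm// mulr_ge0 ?pi_ge0.
have E1 xi : expR (- (e ^+ 2 * dotv xi xi / 2)) =
    (normal_peak (e^-1) ^+ n)^-1 * gaussV e^-1 xi.
  rewrite gaussVE// mulrA mulVf ?expf_neq0 ?pk0// mul1r; congr expR; by field.
have E2 u : expR (- (e^-1 ^+ 2 * dotv u u / 2)) =
    (normal_peak e ^+ n)^-1 * gaussV e u.
  rewrite gaussVE// mulrA mulVf ?expf_neq0 ?pk0// mul1r; congr expR; by field.
(* By Fubini the frequency variable is integrated first; this gives the Gaussian integral
   [Rintegral_gaussV_cos] at y - x, and a translation by x concludes. *)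
pose F (z : V * V) := gaussV e^-1 z.1 * (f z.2 * cos (dotv z.2 z.1 + (th - dotv x z.1))).
have Fi : (mu \x mu)%E.-integrable setT (EFin \o F).
  pose b (z : V * V) := gaussV e^-1 z.1 * `|f z.2|.
  have mg : measurable_fun setT (fun z : V * V => gaussV e^-1 z.1).
    by apply: (measurableT_comp (@measurable_gaussV _ e^-1 n)).
  have mf2 : measurable_fun setT (fun z : V * V => f z.2).
    exact: (measurableT_comp mf).
  have md : measurable_fun setT (fun z : V * V => dotv z.2 z.1 + (th - dotv x z.1)).
    apply: measurable_funD; first exact: measurable_dotv.
    by apply: measurable_funB => //; exact: measurable_dotv.
  apply: (integrable_prodP (g := b)).
  - apply: measurable_funM => //; apply: measurable_funM => //.
    exact: measurable_cos_fun.
  - by apply: measurable_funM => //; exact: measurableT_comp.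
  - move=> z; rewrite normrM (ger0_norm (gaussV_ge0 _ _)) ler_wpM2l ?gaussV_ge0//.
    by rewrite normrM ler_piMr// cos_max.
  - rewrite /b /=; under eq_integral => xi _.
      rewrite -EFin_Rintegral; last by apply: integrableZl_fun; exact: (integrable_norm fi).
      rewrite RintegralZl//; last exact: (integrable_norm fi).
      rewrite mulrC.
      over.
    apply: (integrable_lty_ge0 (mu := mu)); last first.
      by apply: integrableZl_fun; exact: integrable_gaussV0.
    by move=> xi; rewrite mulr_ge0 ?gaussV_ge0// Rintegral_ge0.
have D : \int[mu]_xi (gaussV e^-1 xi * trigt f xi (th - dotv x xi)) =
    (normal_peak e ^+ n)^-1 * cos th * \int[mu]_u (f (u + x) * gaussV e u).
  transitivity (\int[mu]_xi \int[mu]_y F (xi, y)).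
    apply: eq_Rintegral => xi _; rewrite /F /= RintegralZl//.
    exact: integrable_trig.
  rewrite Rfubini//.
  transitivity (\int[mu]_y (f y * (expR (- (e^-1 ^+ 2 * dotv (y - x) (y - x) / 2)) * cos th))).
    apply: eq_Rintegral => y _; rewrite -Rintegral_gaussV_cos// -RintegralZl//; last first.
      exact: integrable_gaussV_cos.
    apply: eq_Rintegral => xi _; rewrite /F /= mulrCA; congr (_ * (_ * cos _)).
    by rewrite [dotv xi _]dotvC dotvBl; ring.
  pose G y := f y * (expR (- (e^-1 ^+ 2 * dotv (y - x) (y - x) / 2)) * cos th).
  have mG : measurable_fun setT G.
    apply: measurable_funM => //; apply: measurable_funM => //.
    apply: (measurableT_comp (@measurable_expR R)); apply: measurable_funN.
    apply: measurable_funM => //; apply: measurable_funM => //.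
    by apply: measurable_dotv; exact: measurable_rVB.
  rewrite -(Rintegral_rV_shift x mG) -RintegralZl//; last first.
    apply: (@integrable_dominated _ _ _ mu _ (fun u => C * gaussV e u)).
    - apply: measurable_funM; last exact: measurable_gaussV.
      by apply: (measurableT_comp mf); exact: measurable_rVD.
    - by move=> u; rewrite normrM (ger0_norm (gaussV_ge0 _ _)) ler_wpM2r ?gaussV_ge0.
    - by apply: integrableZl_fun; exact: integrable_gaussV0.
  by apply: eq_Rintegral => u _; rewrite /G addrK E2; ring.
transitivity ((normal_peak (e^-1) ^+ n)^-1 *
    \int[mu]_xi (gaussV e^-1 xi * trigt f xi (th - dotv x xi))).
  rewrite -RintegralZl//; first by apply: eq_Rintegral => xi _; rewrite E1 mulrA.
  apply: (@integrable_dominated _ _ _ mu _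
    (fun xi => (\int[mu]_y `|f y|) * gaussV e^-1 xi)).
  - apply: measurable_funM; first exact: measurable_gaussV.
    apply: measurable_trigt => //; apply: measurable_funB => //.
    exact: measurable_dotv.
  - move=> xi; rewrite normrM (ger0_norm (gaussV_ge0 _ _)) mulrC.
    by rewrite ler_wpM2r ?gaussV_ge0//; exact: normr_trigt_le.
  - by apply: integrableZl_fun; exact: integrable_gaussV0.
by rewrite D !mulrA -invfM -exprMn pk exprVn invrK.
Qed.

Lemma eq0_normr_le (a K : R) : (forall e, 0 < e <= 1 -> `|a| <= K * e) -> a = 0.
Proof.
move=> aK; apply/eqP; rewrite -normr_le0 leNgt; apply/negP => a0.
have K0 : 0 < K by have := aK 1; rewrite ltr01 lexx mulr1 => /(_ isT); exact: lt_le_trans.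
have Ka : 0 < 2 * (K + `|a|) by rewrite mulr_gt0// addr_gt0.
have := aK (`|a| / (2 * (K + `|a|))); rewrite divr_gt0//= ler_pdivrMr// mul1r.
have -> : `|a| <= 2 * (K + `|a|) by lra.
move=> /(_ isT); rewrite mulrA ler_pdivlMr//; nra.
Qed.

(** The Gaussian factor on the frequency side is removed at a cost of order e, and the identity with
    the factor holds up to order e as well. The two sides thus differ by at most a constant times e
    for every e in ]0, 1], and explicit rates replace the passage to the limit. *)
Lemma Rintegral_trigt_inversion f x th : rschwartz f ->
  \int[mu]_xi trigt f xi (th - dotv x xi) = (2 * pi) ^+ n * (f x * cos th).
Proof.
move=> fS; have [K [K0 HK]] := Rintegral_gaussV_approx fS.
have [C [C0 HC]] := trigt_decay fS.
have mth : measurable_fun setT (fun xi => th - dotv x xi).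
  by apply: measurable_funB => //; exact: measurable_dotv.
have Fi := integrable_trigt fS mth.
have p0 : 0 <= (2 * pi : R) ^+ n by rewrite exprn_ge0// mulr_ge0// pi_ge0.
pose F xi := trigt f xi (th - dotv x xi).
have mF : measurable_fun setT F by have /measurable_int/measurable_EFinP := Fi.
pose I := \int[mu]_xi (sqweight xi)^-1.
apply/eqP; rewrite -subr_eq0; apply/eqP.
apply: (@eq0_normr_le _ (C * I + (2 * pi) ^+ n * K)) => e /andP[e0 e1].
pose G xi : R := expR (- (e ^+ 2 * dotv xi xi / 2)).
have y0 xi : 0 <= e ^+ 2 * dotv xi xi / 2 by rewrite divr_ge0// mulr_ge0 ?sqr_ge0 ?dotv_ge0.
have G1 xi : G xi <= 1 by rewrite /G -[leRHS]expR0 ler_expR oppr_le0.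
have mG : measurable_fun setT G.
  apply: (measurableT_comp (@measurable_expR R)); apply: measurable_funN.
  by apply: measurable_funM => //; apply: measurable_funM => //; exact: measurable_dotv.
have GFi : mu.-integrable setT (EFin \o (fun xi => G xi * F xi)).
  apply: (@integrable_dominated _ _ _ mu _ (fun xi => `|F xi|)).
  - exact: measurable_funM.
  - by move=> xi; rewrite normrM ler_piMl// ger0_norm ?expR_ge0.
  - exact: (integrable_norm Fi).
have A : `|\int[mu]_xi F xi - \int[mu]_xi (G xi * F xi)| <= C * I * e.
  rewrite -RintegralB//.
  apply: (@le_trans _ _ (\int[mu]_xi ((C * e) * (sqweight xi)^-1))); last first.
    by rewrite RintegralZl//; [rewrite mulrAC|exact: integrable_sqweightV].
  apply: normr_Rintegral_le.
  - by apply: measurable_funB => //; exact: measurable_funM.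
  - move=> xi; have q1 := sqweight_ge1 xi.
    have q0 : 0 < sqweight xi by rewrite (lt_le_trans ltr01).
    rewrite -{1}[F xi]mul1r -mulrBl normrM ger0_norm ?subr_ge0//.
    (* From 1 - exp (- y) <= y with y = e^2 |xi|^2 / 2, and e^2 <= e. *)
    apply: (@le_trans _ _ (e * sqweight xi * (C * (sqweight xi ^+ 2)^-1))).
      apply: ler_pM; rewrite ?subr_ge0//; last exact: HC.
      have := expR_ge1Dx (- (e ^+ 2 * dotv xi xi / 2)); rewrite -/(G xi).
      have := sqweight_dotv xi; have := dotv_ge0 xi.
      move: (sqweight xi) (dotv xi xi) => q d d0 qd Gd.
      have e2 : e ^+ 2 <= e by rewrite expr2 ler_piMl// ltW.
      have : e ^+ 2 * d <= e * q by apply: ler_pM => //; [exact: sqr_ge0|lra].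
      have : 0 <= e ^+ 2 * d by rewrite mulr_ge0 ?sqr_ge0.
      lra.
    by rewrite le_eqVlt; apply/orP; left; apply/eqP; field; rewrite gt_eqF.
  - by apply: integrableZl_fun; exact: integrable_sqweightV.
rewrite [leRHS]mulrDl -(subrKA (\int[mu]_xi (G xi * F xi))).
apply: le_trans (ler_normD _ _) _; apply: lerD => //.
rewrite /G /F Rintegral_trigt_gauss// -mulrA -mulrBr normrM (ger0_norm p0) -mulrA.
rewrite ler_wpM2l// mulrC -mulrBl normrM.
by apply: le_trans (HK x e e0); rewrite ler_piMr// cos_max.
Qed.

End fourier_inversion.

(** * Complex-valued functions *)

Section complex_packaging.
Variables (R : realType) (n : nat).
Local Notation V := 'rV[R]_n.
Local Notation mu := (lebesgue_rV R n).
Local Notation Re := (@complex.Re R).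
Local Notation Im := (@complex.Im R).
Local Open Scope complex_scope.
Implicit Types (f g h phi psi : V -> R[i]) (xi x : V) (z w : R[i]).

Lemma ReM z w : Re (z * w) = Re z * Re w - Im z * Im w.
Proof. by case: z w => a b []. Qed.

Lemma ImM z w : Im (z * w) = Re z * Im w + Im z * Re w.
Proof. by case: z w => a b []. Qed.

Lemma complexE z : z = Re z +i* Im z. Proof. by case: z. Qed.

Lemma ReB z w : Re (z - w) = Re z - Re w.
Proof. by case: z w => a b []. Qed.

Lemma ImB z w : Im (z - w) = Im z - Im w.
Proof. by case: z w => a b []. Qed.

Lemma schwartzB phi psi : schwartz phi -> schwartz psi ->
  schwartz (fun x => phi x - psi x).
Proof.
move=> /schwartz_rschwartz[pR pI] /schwartz_rschwartz[qR qI].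
apply/schwartz_rschwartz; split.
- rewrite (_ : (fun x => _) = (fun x => Re (phi x) + -1 * Re (psi x))).
    by apply: rschwartzD => //; exact: rschwartzZ.
  by apply/funext => x; rewrite ReB mulN1r.
- rewrite (_ : (fun x => _) = (fun x => Im (phi x) + -1 * Im (psi x))).
    by apply: rschwartzD => //; exact: rschwartzZ.
  by apply/funext => x; rewrite ImB mulN1r.
Qed.

Lemma inv_fourierE phi xi : schwartz phi -> inv_fourier phi xi =
  ((2 * pi) ^- n)%:C * (
    (trigt (Re \o phi) xi 0 - trigt (Im \o phi) xi (- (pi / 2))) +i*
    (trigt (Re \o phi) xi (- (pi / 2)) + trigt (Im \o phi) xi 0)).
Proof.
move=> /schwartz_rschwartz[/rschwartz_integrable aI /rschwartz_integrable bI].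
rewrite /inv_fourier /cintegral; congr (_ * (_ +i* _)).
- rewrite /trigt -RintegralB//; try exact: integrable_trig.
  apply: eq_Rintegral => x _; rewrite ReM /= cosBpihalf addr0 [dotv xi x]dotvC; ring.
- rewrite /trigt -RintegralD//; try exact: integrable_trig.
  apply: eq_Rintegral => x _; rewrite ImM /= cosBpihalf addr0 [dotv xi x]dotvC; ring.
Qed.

Lemma inv_fourierB phi psi xi : schwartz phi -> schwartz psi ->
  inv_fourier (fun x => phi x - psi x) xi = inv_fourier phi xi - inv_fourier psi xi.
Proof.
move=> pS qS; rewrite !inv_fourierE//; last exact: schwartzB.
have tB (u v : V -> R) th : rschwartz u -> rschwartz v ->
    trigt (fun x => u x - v x) xi th = trigt u xi th - trigt v xi th.
  move=> uS vS.
  rewrite (_ : (fun x => u x - v x) = (fun x => u x + -1 * v x)); last first.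
    by apply/funext => x; rewrite mulN1r.
  rewrite trigtD ?trigtZ ?mulN1r//; try exact: rschwartz_integrable.
  by apply: integrableZl_fun; exact: rschwartz_integrable.
have ReE : Re \o (fun x => phi x - psi x) = (fun x => Re (phi x) - Re (psi x)).
  by apply/funext => x /=; rewrite ReB.
have ImE : Im \o (fun x => phi x - psi x) = (fun x => Im (phi x) - Im (psi x)).
  by apply/funext => x /=; rewrite ImB.
have [pR pI] := (schwartz_rschwartz phi).1 pS.
have [qR qI] := (schwartz_rschwartz psi).1 qS.
rewrite ReE ImE !tB// -mulrBr; congr (_ * _).
by rewrite [RHS]complexE ReB ImB /=; congr (_ +i* _); rewrite /comp; ring.
Qed.

(** This order of composition is the one met by transposition, where a functional is evaluated at
    [fourier] of a symbol times [inv_fourier phi]. Real and imaginary parts reduce to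
    [Rintegral_trigt_inversion] at the phases 0 and - pi / 2; at the latter the cosine vanishes,
    which kills the cross terms. *)
Lemma fourier_inv_fourier phi : schwartz phi -> fourier (inv_fourier phi) = phi.
Proof.
move=> pS; have [pR pI] := (schwartz_rschwartz phi).1 pS.
have aI := rschwartz_integrable pR; have bI := rschwartz_integrable pI.
apply/funext => x; rewrite /fourier /cintegral [RHS]complexE.
pose k : R := (2 * pi) ^- n.
have k1 (y : R) : k * ((2 * pi) ^+ n * y) = y.
  rewrite mulrA mulVf ?mul1r// expf_neq0// mulf_neq0//.
  by rewrite gt_eqF// pi_gt0.
have mth (c : R) : measurable_fun setT (fun xi => c - dotv x xi).
  by apply: measurable_funB => //; exact: measurable_dotv.
have ReE xi : Re (inv_fourier phi xi) =
    k * (trigt (Re \o phi) xi 0 - trigt (Im \o phi) xi (- (pi / 2))).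
  by rewrite inv_fourierE// ReM /= mul0r subr0.
have ImE xi : Im (inv_fourier phi xi) =
    k * (trigt (Re \o phi) xi (- (pi / 2)) + trigt (Im \o phi) xi 0).
  by rewrite inv_fourierE// ImM /= mul0r addr0.
(* Multiplication by exp (- i x . xi) amounts to shifting the phases by - x . xi. *)
have ph (u : V -> R) xi : mu.-integrable setT (EFin \o u) ->
    trigt u xi (0 - dotv x xi) =
      cos (dotv xi x) * trigt u xi 0 + sin (dotv xi x) * trigt u xi (- (pi / 2)) /\
    trigt u xi (- (pi / 2) - dotv x xi) =
      - sin (dotv xi x) * trigt u xi 0 + cos (dotv xi x) * trigt u xi (- (pi / 2)).
  move=> ui; split; rewrite [LHS]trigt_phase// [dotv x xi]dotvC.
    by rewrite sub0r cosN sinN; ring.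
  rewrite [- (pi / 2) - _]addrC cosBpihalf sinBpihalf sinN cosN; ring.
congr (_ +i* _).
- transitivity (\int[mu]_xi (k * (trigt (Re \o phi) xi (0 - dotv x xi) -
      trigt (Im \o phi) xi (- (pi / 2) - dotv x xi)))).
    apply: eq_Rintegral => xi _; rewrite ReM ReE ImE/=.
    by rewrite (ph _ _ aI).1 (ph _ _ bI).2; ring.
  rewrite RintegralZl//; last first.
    rewrite (_ : _ \o _ = (EFin \o (fun xi => trigt (Re \o phi) xi (0 - dotv x xi) +
      -1 * trigt (Im \o phi) xi (- (pi / 2) - dotv x xi)))); last first.
      by apply/funext => xi /=; rewrite mulN1r.
    apply: integrableD_fun; first exact: integrable_trigt.
    by apply: integrableZl_fun; exact: integrable_trigt.
  rewrite RintegralB//; try exact: integrable_trigt.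
  rewrite !Rintegral_trigt_inversion// mulrBr !k1 cos0 cosN cos_pihalf.
  by rewrite mulr1 mulr0 subr0.
- transitivity (\int[mu]_xi (k * (trigt (Re \o phi) xi (- (pi / 2) - dotv x xi) +
      trigt (Im \o phi) xi (0 - dotv x xi)))).
    apply: eq_Rintegral => xi _; rewrite ImM ReE ImE/=.
    by rewrite (ph _ _ aI).2 (ph _ _ bI).1; ring.
  rewrite RintegralZl//; last first.
    by apply: integrableD_fun; exact: integrable_trigt.
  rewrite RintegralD//; try exact: integrable_trigt.
  rewrite !Rintegral_trigt_inversion// mulrDr !k1 cos0 cosN cos_pihalf.
  by rewrite mulr1 mulr0 add0r.
Qed.

Lemma le_Lnorm (q : R) (u v : V -> R) : 0 < q -> measurable_fun setT u ->
  measurable_fun setT v -> (forall x, `|u x| <= `|v x|) ->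
  (Lnorm mu q%:E (EFin \o u) <= Lnorm mu q%:E (EFin \o v))%E.
Proof.
move=> q0 mu_ mv uv; rewrite unlock; apply: gt0_ler_poweR.
- by rewrite invr_ge0 ltW.
- by rewrite in_itv/= leey andbT integral_ge0// => x _; exact: poweR_ge0.
- by rewrite in_itv/= leey andbT integral_ge0// => x _; exact: poweR_ge0.
- apply: ge0_le_integral => //.
  + by move=> x _; exact: poweR_ge0.
  + by apply: (@measurableT_comp _ _ _ _ _ _ EFin) => //; exact: measurable_powR_abs.
  + by apply: (@measurableT_comp _ _ _ _ _ _ EFin) => //; exact: measurable_powR_abs.
  + move=> x _; rewrite /= lee_fin; apply: ge0_ler_powR; rewrite ?nnegrE//.
    exact: ltW.
Qed.

Lemma measurable_normc f : measurable_fun setT (Re \o f) ->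
  measurable_fun setT (Im \o f) -> measurable_fun setT (fun x => Normc.normc (f x)).
Proof.
move=> mR mI.
rewrite (_ : (fun x => _) = (@Num.sqrt R) \o (fun x => Re (f x) ^+ 2 + Im (f x) ^+ 2)).
  apply: measurableT_comp.
    by apply: continuous_measurable_fun; exact: sqrt_continuous.
  by apply: measurable_funD; exact: measurable_funX.
by apply/funext => x /=; case: (f x).
Qed.

Lemma in_Lq_rLq (q : R) f : 0 < q -> in_Lq q f ->
  [/\ in_rLq q (Re \o f), in_rLq q (Im \o f),
      (Lnorm mu q%:E (EFin \o (Re \o f)) <= Lq_norm q f)%E &
      (Lnorm mu q%:E (EFin \o (Im \o f)) <= Lq_norm q f)%E].
Proof.
move=> q0 [mR mI foo]; have mN := measurable_normc mR mI.
have R1 : (Lnorm mu q%:E (EFin \o (Re \o f)) <= Lq_norm q f)%E.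
  apply: (@le_Lnorm q (Re \o f) (fun x => Normc.normc (f x))) => // x.
  exact: le_trans (normc_Re _) (ler_norm _).
have I1 : (Lnorm mu q%:E (EFin \o (Im \o f)) <= Lq_norm q f)%E.
  apply: (@le_Lnorm q (Im \o f) (fun x => Normc.normc (f x))) => // x.
  exact: le_trans (normc_Im _) (ler_norm _).
by split => //; split => //; exact: le_lt_trans foo.
Qed.

Lemma Lq_norm_le (q : R) (a b : V -> R) : 1 < q -> measurable_fun setT a ->
  measurable_fun setT b ->
  (Lq_norm q (fun x => a x +i* b x) <=
   Lnorm mu q%:E (EFin \o a) + Lnorm mu q%:E (EFin \o b))%E.
Proof.
move=> q1 ma mb; have q0 : 0 < q by rewrite (lt_trans _ q1).
have mna : measurable_fun setT (fun x => `|a x|) by exact: measurableT_comp.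
have mnb : measurable_fun setT (fun x => `|b x|) by exact: measurableT_comp.
have mab : measurable_fun setT (fun x => Normc.normc (a x +i* b x)).
  exact: (@measurable_normc (fun x => a x +i* b x)).
apply: (@le_trans _ _ (Lnorm mu q%:E (EFin \o (fun x => `|a x| + `|b x|)%R))).
  apply: (@le_Lnorm q (fun x => Normc.normc (a x +i* b x))) => //.
    exact: measurable_funD.
  move=> x; rewrite ger0_norm ?sqrtr_ge0//; apply: le_trans (normc_le _ _) _.
  exact: ler_norm.
apply: le_trans (minkowski_EFin mu mna mnb (ltW q1)) _; apply: leeD.
  by apply: le_Lnorm => // x; rewrite normr_id.
by apply: le_Lnorm => // x; rewrite normr_id.
Qed.

Lemma distribution_of_funE (q : R) f phi : 1 < q -> in_Lq q f -> schwartz phi ->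
  distribution_of_fun f phi =
  (\int[mu]_x (Re (f x) * Re (phi x)) - \int[mu]_x (Im (f x) * Im (phi x)))%R +i*
  (\int[mu]_x (Re (f x) * Im (phi x)) + \int[mu]_x (Im (f x) * Re (phi x)))%R.
Proof.
move=> q1 fq /schwartz_rschwartz[pR pI].
have q0 : 0 < q by rewrite (lt_trans _ q1).
have [fR fI _ _] := in_Lq_rLq q0 fq.
have i (u v : V -> R) := @in_rLq_schwartz_integrable _ n q u v q1.
rewrite /distribution_of_fun /cintegral; congr (_ +i* _).
  rewrite -RintegralB//; [|exact: i fR pR|exact: i fI pI].
  by apply: eq_Rintegral => x _; rewrite ReM.
rewrite -RintegralD//; [|exact: i fR pI|exact: i fI pR].
by apply: eq_Rintegral => x _; rewrite ImM.
Qed.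

Lemma distribution_of_funB (q : R) f phi psi : 1 < q -> in_Lq q f ->
  schwartz phi -> schwartz psi ->
  distribution_of_fun f (fun x => phi x - psi x) =
  distribution_of_fun f phi - distribution_of_fun f psi.
Proof.
move=> q1 fq pS qS; have q0 : 0 < q by rewrite (lt_trans _ q1).
have [fR fI _ _] := in_Lq_rLq q0 fq.
have [pR pI] := (schwartz_rschwartz phi).1 pS.
have [qR qI] := (schwartz_rschwartz psi).1 qS.
have B (h u v : V -> R) : in_rLq q h -> rschwartz u -> rschwartz v ->
    \int[mu]_x (h x * (u x - v x)) =
    \int[mu]_x (h x * u x) - \int[mu]_x (h x * v x).
  move=> hq uS vS.
  rewrite -RintegralB//; try exact: (in_rLq_schwartz_integrable q1).
  by apply: eq_Rintegral => x _; rewrite mulrBr.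
have BR (h : V -> R) : in_rLq q h -> \int[mu]_x (h x * Re (phi x - psi x)) =
    \int[mu]_x (h x * Re (phi x)) - \int[mu]_x (h x * Re (psi x)).
  by move=> hq; under eq_Rintegral do rewrite ReB; exact: B.
have BI (h : V -> R) : in_rLq q h -> \int[mu]_x (h x * Im (phi x - psi x)) =
    \int[mu]_x (h x * Im (phi x)) - \int[mu]_x (h x * Im (psi x)).
  by move=> hq; under eq_Rintegral do rewrite ImB; exact: B.
rewrite !(distribution_of_funE q1 fq)//; last exact: schwartzB.
rewrite (BR _ fR) (BI _ fI) (BI _ fR) (BR _ fI).
rewrite [RHS]complexE ReB ImB /=; congr (_ +i* _); ring.
Qed.

(* Real and imaginary parts are treated separately, whence the factor 2. *)
Lemma bounded_symbol_complex (m : V -> R) (B : R) : bounded_symbol m B ->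
  exists U : (V -> R[i]) -> (V -> R[i]),
  (forall phi, schwartz phi -> schwartz (U phi) /\
    forall xi, inv_fourier (U phi) xi = (m xi)%:C * inv_fourier phi xi) /\
  (forall q, 1 < q -> forall h, in_Lq q h -> exists g,
    [/\ in_Lq q g, (Lq_norm q g <= (2 * B)%:E * Lq_norm q h)%E &
        forall phi, schwartz phi ->
          distribution_of_fun g phi = distribution_of_fun h (U phi)]).
Proof.
move=> [B0 [U [US Uq]]].
exists (fun phi x => U (Re \o phi) x +i* U (Im \o phi) x).
have UcS phi : schwartz phi ->
    schwartz (fun x => U (Re \o phi) x +i* U (Im \o phi) x).
  move=> /schwartz_rschwartz[pR pI]; apply/schwartz_rschwartz; split.
  - exact: (US _ pR).1.
  - exact: (US _ pI).1.
split=> [phi pS|q q1 h hq].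
  have [pR pI] := (schwartz_rschwartz phi).1 pS.
  split=> [|xi]; first exact: UcS.
  rewrite !inv_fourierE//; last exact: UcS.
  rewrite !(US _ pR).2 !(US _ pI).2 mulrCA; congr (_ * _).
  by rewrite [RHS]complexE ReM ImM /=; congr (_ +i* _); ring.
have q0 : 0 < q by rewrite (lt_trans _ q1).
have [hR hI hRn hIn] := in_Lq_rLq q0 hq.
have [a [aq aN aE]] := Uq q q1 _ hR.
have [b [bq bN bE]] := Uq q q1 _ hI.
have N : (Lq_norm q (fun x => a x +i* b x) <= (2 * B)%:E * Lq_norm q h)%E.
  apply: le_trans (Lq_norm_le q1 aq.1 bq.1) _.
  rewrite [2 * B]mulr_natl mulr2n EFinD ge0_muleDl ?lee_fin//.
  apply: leeD; [apply: le_trans aN _|apply: le_trans bN _];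
    by apply: lee_wpmul2l; rewrite ?lee_fin.
have gq : in_Lq q (fun x => a x +i* b x).
  split; [exact: aq.1|exact: bq.1|apply: le_lt_trans N _].
  by case: hq => _ _ hoo; rewrite lte_mul_pinfty ?lee_fin ?mulr_ge0.
exists (fun x => a x +i* b x); split => // phi pS.
have [pR pI] := (schwartz_rschwartz phi).1 pS.
rewrite (distribution_of_funE q1 gq pS) (distribution_of_funE q1 hq (UcS _ pS))/=.
by rewrite !aE// !bE.
Qed.

(* No linearity of T is needed: by the hypothesis on T, each of the two terms
   is the value of [distribution_of_fun h] at a Schwartz function. *)
Lemma multiplier_difference (q B1 B : R) (r m1 dm : V -> R)
    (T : schwartz_functional) h :
  1 < q -> in_Lq q h ->
  (forall psi, schwartz psi ->
    T (fourier (fun xi => (r xi)%:C * inv_fourier psi xi)) = distribution_of_fun h psi) ->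
  bounded_symbol m1 B1 -> bounded_symbol dm B ->
  exists g, [/\ in_Lq q g,
    forall phi, schwartz phi ->
      multiplier (fun xi => (r xi * m1 xi)%:C) T phi -
      multiplier (fun xi => (r xi * (m1 xi - dm xi))%:C) T phi =
      distribution_of_fun g phi &
    (Lq_norm q g <= (2 * B)%:E * Lq_norm q h)%E].
Proof.
move=> q1 hq Th /bounded_symbol_complex[U1 [U1S _]] /bounded_symbol_complex[U [US Uq]].
have [g [gq gN gE]] := Uq q q1 h hq.
exists g; split => // phi pS; rewrite gE//.
have [S1 E1] := U1S _ pS; have [S E] := US _ pS.
have S2 := schwartzB S1 S.
rewrite /multiplier /inv_fourierD /mulD /fourierD.
(* Once m1 and dm are moved inside [inv_fourier] as operators on phi, only the factor r is left in
   front, and the hypothesis on T applies to both terms. *)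
have -> : (fun xi => (r xi * m1 xi)%:C * inv_fourier phi xi) =
    (fun xi => (r xi)%:C * inv_fourier (U1 phi) xi).
  by apply/funext => xi; rewrite E1 mulrA -rmorphM.
have -> : (fun xi => (r xi * (m1 xi - dm xi))%:C * inv_fourier phi xi) =
    (fun xi => (r xi)%:C * inv_fourier (fun x => U1 phi x - U phi x) xi).
  by apply/funext => xi; rewrite inv_fourierB// E1 E rmorphM rmorphB; ring.
transitivity (distribution_of_fun h (U1 phi) -
  distribution_of_fun h (fun x => U1 phi x - U phi x)).
  by congr (_ - _); [exact: Th _ S1|exact: Th _ S2].
transitivity (distribution_of_fun h (U1 phi) -
  (distribution_of_fun h (U1 phi) - distribution_of_fun h (U phi))).
  by congr (_ - _); exact: distribution_of_funB q1 hq S1 S.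
by rewrite subKr.
Qed.

(** The case r = 1 and h = f of [multiplier_difference], in which the hypothesis on T is Fourier
    inversion. *)
Lemma resolvent_difference_Lq (c q : R) f : 2 <= c -> 1 < q -> in_Lq q f ->
  exists g, [/\ in_Lq q g,
    distribution_eq (distribution_sub
      (inv_Pinfty_D (distribution_of_fun f)) (inv_Pc_D c (distribution_of_fun f)))
      (distribution_of_fun g) &
    (Lq_norm q g <= (2 * (6 / c ^+ 2))%:E * Lq_norm q f)%E].
Proof.
move=> c2 q1 fq.
have Tf psi : schwartz psi -> distribution_of_fun f
    (fourier (fun xi => 1%:C * inv_fourier psi xi)) = distribution_of_fun f psi.
  move=> pS; rewrite (_ : (fun xi => _) = inv_fourier psi).
    by rewrite fourier_inv_fourier.
  by apply/funext => xi; rewrite rmorph1 mul1r.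
have [g [gq gE gN]] := multiplier_difference (r := fun=> 1)
  (m1 := fun xi => (Pinfty xi)^-1) q1 fq Tf
  (@bounded_symbol_PinftyV R n) (bounded_symbol_sub n c2).
have E1 : (fun xi => (1 * (Pinfty xi)^-1)%:C) = (fun xi : V => ((Pinfty xi)^-1)%:C).
  by apply/funext => xi; rewrite mul1r.
have E2 : (fun xi => (1 * ((Pinfty xi)^-1 - ((Pinfty xi)^-1 - (Pc c xi)^-1)))%:C) =
    (fun xi : V => ((Pc c xi)^-1)%:C).
  by apply/funext => xi; rewrite mul1r subKr.
rewrite E1 E2 in gE.
by exists g; split; [exact: gq|exact: gE|exact: gN].
Qed.

(** Here f need not be a function, but h stands for 1/T applied to f. So the factor r = 1/T is kept
    next to f, and with m1 = 1/T and dm = T (1/P_oo - 1/P_c) the products r m1 and r (m1 - dm) are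
    1/P_oo and 1/P_c. *)
Lemma resolvent_difference_sqrt (c q : R) (f : schwartz_functional) h :
  2 <= c -> 1 < q -> in_Lq q h ->
  distribution_eq (inv_sqrt_Pinfty_D f) (distribution_of_fun h) ->
  exists g, [/\ in_Lq q g,
    distribution_eq (distribution_sub (inv_Pinfty_D f) (inv_Pc_D c f))
      (distribution_of_fun g) &
    (Lq_norm q g <= (2 * (6 / c))%:E * Lq_norm q h)%E].
Proof.
move=> c2 q1 hq fh.
have [g [gq gE gN]] := multiplier_difference
  (r := fun xi => Pinfty xi `^ (- 2^-1))
  (m1 := fun xi => (Num.sqrt (dotv xi xi + 1))^-1) q1 hq fh
  (@bounded_symbol_rsqrt R n) (bounded_symbol_sqrt_sub n c2).
have s0 xi : Num.sqrt (dotv xi xi + 1) != 0.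
  by rewrite gt_eqF// sqrtr_gt0 -PinftyE Pinfty_gt0.
have sV xi : (Num.sqrt (dotv xi xi + 1))^-1 * (Num.sqrt (dotv xi xi + 1))^-1 =
    (Pinfty xi)^-1.
  by rewrite PinftyE -invfM -expr2 sqr_sqrtr// addr_ge0 ?dotv_ge0.
have E1 : (fun xi => (Pinfty xi `^ (- 2^-1) * (Num.sqrt (dotv xi xi + 1))^-1)%:C) =
    (fun xi : V => ((Pinfty xi)^-1)%:C).
  by apply/funext => xi; rewrite PinftyVsqrtE sV.
have E2 : (fun xi => (Pinfty xi `^ (- 2^-1) * ((Num.sqrt (dotv xi xi + 1))^-1 -
    Num.sqrt (dotv xi xi + 1) * ((Pinfty xi)^-1 - (Pc c xi)^-1)))%:C) =
    (fun xi : V => ((Pc c xi)^-1)%:C).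
  by apply/funext => xi; rewrite PinftyVsqrtE mulrBr sV mulrA mulVf// mul1r subKr.
rewrite E1 E2 in gE.
by exists g; split; [exact: gq|exact: gE|exact: gN].
Qed.

End complex_packaging.

Unset Implicit Arguments.
Set Strict Implicit.
Set Printing Implicit Defensive.

Theorem theorem2p1 (R : realType) (n : nat) (n_ge1 : (1 <= n)%N) :
  (forall q : R, 1 < q ->
    exists C : R, 0 < C /\
      forall (c : R) (f : 'rV[R]_n -> R[i]), 2 <= c -> in_Lq q f ->
        exists g : 'rV[R]_n -> R[i],
          [/\ in_Lq q g,
              distribution_eq
                (distribution_sub
                   (inv_Pinfty_D (distribution_of_fun f))
                   (inv_Pc_D c (distribution_of_fun f)))
                (distribution_of_fun g) &
              (Lq_norm q g <= (C / c ^+ 2)%:E * Lq_norm q f)%E])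
  /\
  (forall q : R, 1 < q ->
    exists C : R, 0 < C /\
      forall (c : R) (f : @schwartz_functional R n), 2 <= c -> tempered f ->
        forall h : 'rV[R]_n -> R[i],
          in_Lq q h ->
          distribution_eq (inv_sqrt_Pinfty_D f) (distribution_of_fun h) ->
          exists g : 'rV[R]_n -> R[i],
            [/\ in_Lq q g,
                distribution_eq
                  (distribution_sub (inv_Pinfty_D f) (inv_Pc_D c f))
                  (distribution_of_fun g) &
                (Lq_norm q g <= (C / c)%:E * Lq_norm q h)%E]).
Proof.
(* The constant 12 is the bound 6 on the symbols, doubled by the separate treatment of real and
   imaginary parts; it depends neither on q nor on n. *)
have E12 (d : R) : 12 / d = 2 * (6 / d) by rewrite mulrA -natrM.
split=> q q1; exists 12; split=> // c f c2; last move=> _ h; rewrite E12.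
  exact: resolvent_difference_Lq.
exact: resolvent_difference_sqrt.
Qed.
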